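(* Let $X$ be a compact connected Riemann surface equipped with an anti-holomorphic involution $\tau:X\to X$. Let $L$ be a holomorphic line bundle on $X$ with a fixed isomorphism $L^{\otimes 2}\cong TX$, and let $\mathbb P_L\to X$ be the projective bundle $\mathbb P(J^1(L))$ (equivalently, the associated principal $\mathrm{PGL}(2,\mathbb C)$-bundle). Then the involution $\tau$ has a canonical lift to a $C^\infty$ involution $\widehat\tau:\mathbb P_L\to\mathbb P_L$. Moreover, a projective structure on $X$ is real (that is, compatible with $\tau$) if and only if the corresponding holomorphic connection on $\mathbb P_L$ is preserved by the involution $\widehat\tau$.
   Context: A holomorphic coordinate function on an open $U\subset X$ is an injective holomorphic map $\phi:U\to\mathbb{CP}^1$. A projective structure on $X$ is an equivalence class of collections $\{(U_i,\phi_i)\}_{i\in I}$ of holomorphic coordinate functions with $\bigcup_i U_i=X$ such that each $\phi_{i'}\circ\phi_i^{-1}:\phi_i(U_i\cap U_{i'})\to\phi_{i'}(U_i\cap U_{i'})$ is the restriction of a Möbius transformation; two collections are equivalent if their union is again such a collection. Coordinate functions compatible with a projective structure are called its projective coordinates. A projective structure is compatible with $\tau$, or real, if for each projective coordinate $(U,\phi)$ the pair $(\tau^{-1}(U),\overline{\phi\circ\tau})$ is also a projective coordinate. $TX$ and $K_X$ are the holomorphic tangent and cotangent bundles; $J^1(L)$ is the first jet bundle, with exact sequence $0\to L\otimes K_X\to J^1(L)\to L\to 0$. For a holomorphic vector bundle $V$, $\overline V$ denotes the conjugate $C^\infty$ complex bundle, and $\tau^*\overline V$ carries the holomorphic structure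 in which a local section over $U$ is holomorphic iff the corresponding section of $V$ over $\tau(U)$ is. The differential $d\tau$ gives a holomorphic isomorphism $TX\cong\tau^*\overline{TX}$. The canonical lift: put $L_1=\tau^*\overline L$. Then $L_1^{\otimes 2}\cong TX\cong L^{\otimes 2}$, so $L_1\cong L\otimes\xi_0$ with $\xi_0^{\otimes 2}$ holomorphically trivial; $\xi_0$ has a unique connection inducing the trivial connection on $\xi_0^{\otimes 2}=\mathcal O_X$. Tensoring sections with flat sections of $\xi_0$ gives an isomorphism $J^1(L_1)\cong J^1(L)\otimes\xi_0$, hence a canonical isomorphism $\mathbb P(J^1(L_1))\cong\mathbb P(J^1(L))=\mathbb P_L$. Combined with the tautological fiberwise conjugate linear identification of $J^1(L)$ with $J^1(L_1)=\tau^*\overline{J^1(L)}$ over $\tau$, this gives the map $\widehat\tau:\mathbb P_L\to\mathbb P_L$ over $\tau$, which is fiberwise anti-holomorphic. Explicitly, for a local holomorphic section $s$ of $L$ near $x$ with nonzero 1-jet at $x$, $\widehat\tau$ sends the line spanned by $j^1_x(s)$ to the line spanned by $j^1_{\tau(x)}(\overline{s\circ\tau}\otimes\alpha)$, where $\overline{s\circ\tau}$ is the corresponding local holomorphic section of $\tau^*\overline L=L\otimes\xi_0$ near $\tau(x)$ and $\alpha$ is a nonzero local flat section of $\xi_0^*$. The connection corresponding to a projective structure $P$ (Gunning): a holomorphic connection on $\mathbb P_L$ for which the second fundamental form of the section of $\mathbb P_L$ defined by $L\otimes K_X\subset J^1(L)$, a section of $\mathrm{Hom}(L\otimes K_X,L)\otimes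 K_X=\mathcal O_X$, is the constant function $1$. Explicitly, if $z:U\to\mathbb C$ is a projective coordinate of $P$ and $\omega$ is a holomorphic section of $L$ over $U$ with $\omega\otimes\omega=\partial/\partial z$, the flat sections of $\mathbb P_L|_U$ are those spanned by the 1-jets $j^1((az+b)\omega)$, with $(a,b)\in\mathbb C^2\setminus\{0\}$; these local flat connections agree on overlaps. *)

(* Defs.v *)
From HB Require Import structures.
From mathcomp Require Import all_boot all_order all_algebra.
From mathcomp Require Import generic_quotient ring_quotient complex.
From mathcomp Require Import all_classical all_reals all_analysis.

Set Implicit Arguments.
Unset Strict Implicit.
Unset Printing Implicit Defensive.

Import Order.TTheory GRing.Theory Num.Theory.
Import numFieldNormedType.Exports.

Local Open Scope classical_set_scope.
Local Open Scope ring_scope.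

(* The complex numbers R[i]; the name makes the topology that
   MathComp-Analysis puts on any numClosedFieldType available on them. *)
Definition cplx (R : realType) : numClosedFieldType := R[i].

Section QuotientModule.
Context {K : pzRingType} {V : lmodType K} (W : submodClosed V).

Definition submod_pred : {pred V} := fun v => v \in W.

Fact submod_pred_closed : zmod_closed submod_pred.
Proof.
split=> [|u v uW vW]; first exact: rpred0.
by apply: (@rpredD V W) => //; rewrite -scaleN1r; apply: (@rpredZ K V W).
Qed.

HB.instance Definition _ := GRing.isZmodClosed.Build V submod_pred
  submod_pred_closed.

Definition quotient_module : Type := Quotient.quot submod_pred.

HB.instance Definition _ := GRing.Zmodule.on quotient_module.

Local Notation Q := quotient_module.

Definition quotient_class (v : V) : Q :=
  (\pi_(Quotient.quot submod_pred) v)%qT.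

Definition quotient_scale (a : K) (q : Q) : Q :=
  quotient_class (a *: repr (q : Quotient.quot submod_pred)).

Lemma quotient_classE u v :
  (quotient_class u = quotient_class v) <-> (u - v \in W).
Proof.
rewrite -[_ \in W]/((u - v) \in submod_pred) Quotient.idealrBE.
by split => [e|/eqP//]; apply/eqP.
Qed.

Lemma quotient_classD u v :
  quotient_class (u + v) = quotient_class u + quotient_class v.
Proof. exact: (@Quotient.pi_add V submod_pred u v). Qed.

Lemma quotient_classZ a v :
  quotient_class (a *: v) = quotient_scale a (quotient_class v).
Proof.
apply/quotient_classE; rewrite -scalerBr rpredZ//.
by apply/quotient_classE; rewrite /quotient_class reprK.
Qed.

Lemma quotient_class_surj (q : Q) : exists v, q = quotient_class v.
Proof. by exists (repr (q : Quotient.quot submod_pred)); rewrite /quotient_class reprK. Qed.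

Fact quotient_scaleA a b q :
  quotient_scale a (quotient_scale b q) = quotient_scale (a * b) q.
Proof.
have [v ->] := quotient_class_surj q.
by rewrite -!quotient_classZ scalerA.
Qed.

Fact quotient_scale1 : left_id 1 quotient_scale.
Proof.
move=> q; have [v ->] := quotient_class_surj q.
by rewrite -quotient_classZ scale1r.
Qed.

Fact quotient_scaleDr : right_distributive quotient_scale +%R.
Proof.
move=> a q q'; have [v ->] := quotient_class_surj q.
have [v' ->] := quotient_class_surj q'.
by rewrite -quotient_classD -!quotient_classZ scalerDr quotient_classD.
Qed.

Fact quotient_scaleDl q : {morph quotient_scale^~ q : a b / a + b}.
Proof.
move=> a b; have [v ->] := quotient_class_surj q.
by rewrite -!quotient_classZ scalerDl quotient_classD.
Qed.

HB.instance Definition _ := GRing.Zmodule_isLmodule.Build K Q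
  quotient_scaleA quotient_scale1 quotient_scaleDr quotient_scaleDl.

End QuotientModule.

Section Conjugate.
Context {K : numClosedFieldType} (V : lmodType K).

Definition conj_module : Type := V.

HB.instance Definition _ := GRing.Zmodule.on conj_module.

Definition conj_scale (a : K) (v : conj_module) : conj_module :=
  a^* *: (v : V).

Fact conj_scaleA a b v :
  conj_scale a (conj_scale b v) = conj_scale (a * b) v.
Proof. by rewrite /conj_scale scalerA rmorphM. Qed.

Fact conj_scale1 : left_id 1 conj_scale.
Proof. by move=> v; rewrite /conj_scale rmorph1 scale1r. Qed.

Fact conj_scaleDr : right_distributive conj_scale +%R.
Proof. by move=> a u v; rewrite /conj_scale scalerDr. Qed.

Fact conj_scaleDl v : {morph conj_scale^~ v : a b / a + b}.
Proof. by move=> a b; rewrite /conj_scale rmorphD scalerDl. Qed.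

HB.instance Definition _ := GRing.Zmodule_isLmodule.Build K conj_module
  conj_scaleA conj_scale1 conj_scaleDr conj_scaleDl.

End Conjugate.

Section Projectivization.
Context {K : fieldType}.

(* P(V): the one-dimensional subspaces of V. *)
Record pspace (V : lmodType K) := PSpace {
  line : set V;
  _ : exists2 v, v != 0 & line = [set a *: v | a in [set: K]] }.

Definition spans (V : lmodType K) (v : V) (p : pspace V) := v != 0 /\ line p v.

End Projectivization.

Section ComplexDifferentiability.
Context {K : numFieldType}.
Implicit Types (f g : K -> K) (a z : K).

(* For K the complex numbers: f is holomorphic in a neighbourhood of z. *)
Definition holomorphic_near f z := \forall w \near z, derivable f w 1.

Lemma holomorphic_near0 z : holomorphic_near (fun=> 0) z.
Proof. by near=> w; exact: derivable_cst.
Unshelve. all: by end_near. Qed.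

Lemma derivable_lin a f g z : derivable f z 1 -> derivable g z 1 ->
  derivable (fun w => a * f w + g w) z 1.
Proof.
move=> df dg.
have -> : (fun w => a * f w + g w) = (a \*: (f : K -> K^o)) \+ g by [].
by apply: derivableD => //; exact: derivableZ.
Qed.

Lemma holomorphic_near_lin a f g z :
  holomorphic_near f z -> holomorphic_near g z ->
  holomorphic_near (fun w => a * f w + g w) z.
Proof. by apply: filterS2 => w; exact: derivable_lin. Qed.

Lemma derive1_lin a f g z : derivable f z 1 -> derivable g z 1 ->
  derive1 (fun w => a * f w + g w) z = a * derive1 f z + derive1 g z.
Proof.
move=> df dg; rewrite !derive1E.
have -> : (fun w => a * f w + g w) = (a \*: (f : K -> K^o)) \+ g by [].
rewrite deriveD//; last exact: derivableZ.
by rewrite deriveZ.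
Qed.

End ComplexDifferentiability.

Section Defs.
Context {C : numClosedFieldType}.

Definition conj_point (p : pspace 'rV[C]_2) : pspace 'rV[C]_2.
Proof.
refine (@PSpace _ _ [set map_mx Num.conj v | v in line p] _).
case: p => l /= [v v0 ->]; exists (map_mx Num.conj v).
  by rewrite map_mx_eq0.
apply/seteqP; split => [_ [_ [a _ <-] <-]|_ [a _ <-]].
  by exists (Num.conj a) => //; rewrite map_mxZ.
exists (Num.conj a *: v); first by exists (Num.conj a).
by rewrite map_mxZ /= conjCK.
Defined.

Record chart (X : Type) := Chart {
  cdom : set X;
  cmap : X -> C;
  cinv : C -> X }.

Definition is_chart (X : topologicalType) (phi : chart X) :=
  [/\ open (cdom phi), open (cmap phi @` cdom phi),
      forall x, cdom phi x -> {for x, continuous (cmap phi)},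
      forall z, (cmap phi @` cdom phi) z -> {for z, continuous (cinv phi)}
    & forall x, cdom phi x -> cinv phi (cmap phi x) = x].

Record riemann_surface := RiemannSurface {
  rs_space :> topologicalType;
  atlas : set (chart rs_space);
  rs_hausdorff : hausdorff_space rs_space;
  rs_chart : forall phi, atlas phi -> is_chart phi;
  rs_cover : forall x, exists2 phi, atlas phi & cdom phi x;
  rs_compat : forall phi psi, atlas phi -> atlas psi ->
    forall z, (cmap phi @` (cdom phi `&` cdom psi)) z ->
      derivable (cmap psi \o cinv phi : C -> C) z 1 }.

Context {X : riemann_surface}.

(* Holomorphy in a neighbourhood of x. *)
Definition hol_at (x : X) (f : X -> C) :=
  forall phi, atlas phi -> cdom phi x ->
    holomorphic_near (f \o cinv phi) (cmap phi x).

(* df/dphi at x *)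
Definition chart_deriv (phi : chart X) (f : X -> C) (x : X) : C :=
  derive1 (f \o cinv phi : C -> C) (cmap phi x).

Definition antiholomorphic_involution (tau : X -> X) :=
  [/\ involutive tau, continuous tau
    & forall x psi, atlas psi -> cdom psi (tau x) ->
        hol_at x (fun y => (cmap psi (tau y))^*)].

(* Fibres E_x together with a family of local frames; [holomorphic_bundle]
   below says when these data form a holomorphic vector bundle of rank r. *)
Record local_frame (r : nat) (fib : X -> lmodType C) := LocalFrame {
  fdom : set X;
  fvec : 'I_r -> forall x, fib x }.

Record bundle (r : nat) := Bundle {
  fiber :> X -> lmodType C;
  frames : set (local_frame r fiber) }.
Arguments frames {r} b _.

Definition section (r : nat) (E : bundle r) : Type := forall x, E x.

(* s is holomorphic in a neighbourhood of x. *)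
Definition hol_section (r : nat) (E : bundle r) (x : X) (s : section E) :=
  forall e, frames E e -> fdom e x -> exists c : 'I_r -> X -> C,
    (forall i, hol_at x (c i)) /\
    \forall y \near x, s y = \sum_(i < r) c i y *: fvec e i y.

Definition holomorphic_bundle (r : nat) (E : bundle r) :=
  [/\ forall x, exists2 e, frames E e & fdom e x,
      forall e, frames E e -> open (fdom e),
      forall e x, frames E e -> fdom e x -> forall v : E x,
        exists! c : 'I_r -> C, v = \sum_(i < r) c i *: fvec e i x
    & forall e x i, frames E e -> fdom e x ->
        @hol_section r E x (fvec e i)].

Lemma hol_at0 (x : X) : hol_at x (fun=> 0 : C).
Proof. by move=> phi _ _; exact: holomorphic_near0. Qed.

Lemma hol_at_lin (x : X) (a : C) (f g : X -> C) :
  hol_at x f -> hol_at x g -> hol_at x (fun y => a * f y + g y).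
Proof.
by move=> hf hg phi aphi xphi; apply: holomorphic_near_lin; [exact: hf|exact: hg].
Qed.

Lemma chart_deriv_lin (phi : chart X) (x : X) (a : C) (f g : X -> C) :
  atlas phi -> cdom phi x -> hol_at x f -> hol_at x g ->
  chart_deriv phi (fun y => a * f y + g y) x =
  a * chart_deriv phi f x + chart_deriv phi g x.
Proof.
move=> aphi xphi /(_ _ aphi xphi)/nbhs_singleton hf.
move=> /(_ _ aphi xphi)/nbhs_singleton hg.
exact: derive1_lin.
Qed.

Section SectionModule.
Context {r : nat} (E : bundle r).

HB.instance Definition _ := gen_eqMixin (section E).
HB.instance Definition _ := gen_choiceMixin (section E).

Let sadd (s t : section E) : section E := fun x => s x + t x.
Let sopp (s : section E) : section E := fun x => - s x.
Let sscale (a : C) (s : section E) : section E := fun x => a *: s x.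

Fact section_addA : associative sadd.
Proof. by move=> s t u; apply: functional_extensionality_dep => x; exact: addrA. Qed.

Fact section_addC : commutative sadd.
Proof. by move=> s t; apply: functional_extensionality_dep => x; exact: addrC. Qed.

Fact section_add0 : left_id ((fun=> 0) : section E) sadd.
Proof. by move=> s; apply: functional_extensionality_dep => x; exact: add0r. Qed.

Fact section_addN : left_inverse ((fun=> 0) : section E) sopp sadd.
Proof. by move=> s; apply: functional_extensionality_dep => x; exact: addNr. Qed.

HB.instance Definition _ := GRing.isZmodule.Build (section E)
  section_addA section_addC section_add0 section_addN.

Fact section_scaleA a b s : sscale a (sscale b s) = sscale (a * b) s.
Proof. by apply: functional_extensionality_dep => x; exact: scalerA. Qed.

Fact section_scale1 : left_id 1 sscale.
Proof. by move=> s; apply: functional_extensionality_dep => x; exact: scale1r. Qed.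

Fact section_scaleDr : right_distributive sscale +%R.
Proof. by move=> a s t; apply: functional_extensionality_dep => x; exact: scalerDr. Qed.

Fact section_scaleDl s : {morph sscale^~ s : a b / a + b}.
Proof. by move=> a b; apply: functional_extensionality_dep => x; exact: scalerDl. Qed.

HB.instance Definition _ := GRing.Zmodule_isLmodule.Build C (section E)
  section_scaleA section_scale1 section_scaleDr section_scaleDl.

End SectionModule.

Section Jets.
Context {r : nat} (E : bundle r) (x : X).

Definition hol_germ : {pred section E} := fun s => `[< hol_section x s >].

Fact hol_germ_closed : submod_closed hol_germ.
Proof.
split.
  apply/asboolP => e _ _; exists (fun=> fun=> 0); split=> [i|].
    exact: hol_at0.
  by near=> y; rewrite big1// => i _; rewrite scale0r.
move=> a s t /asboolP hs /asboolP ht; apply/asboolP => e Ee xe.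
have [c [hc sc]] := hs e Ee xe; have [d [hd td]] := ht e Ee xe.
exists (fun i y => a * c i y + d i y); split=> [i|].
  exact: hol_at_lin.
near=> y; rewrite -[LHS]/(a *: s y + t y).
have -> : s y = \sum_(i < r) c i y *: fvec e i y by near: y.
have -> : t y = \sum_(i < r) d i y *: fvec e i y by near: y.
rewrite scaler_sumr -big_split; apply: eq_bigr => i _.
by rewrite scalerDl scalerA.
Unshelve. all: by end_near. Qed.

HB.instance Definition _ := GRing.isSubmodClosed.Build C (section E) hol_germ
  hol_germ_closed.

(* Sections of E which are holomorphic near x. *)
Record local_section := LocalSection {
  lsec : section E;
  lsecP : lsec \in hol_germ }.

HB.instance Definition _ := [isSub for lsec].
HB.instance Definition _ := [Choice of local_section by <:].
HB.instance Definition _ := [SubChoice_isSubLmodule of local_section by <:].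

(* The 1-jet at x vanishes: in every frame, the coefficients and their first
   derivatives vanish at x. *)
Definition vanishing_jet : {pred local_section} := fun s =>
  `[< forall e, frames E e -> fdom e x -> exists c : 'I_r -> X -> C,
      [/\ forall i, hol_at x (c i),
          \forall y \near x, lsec s y = \sum_(i < r) c i y *: fvec e i y
        & forall i, c i x = 0 /\ forall phi, atlas phi -> cdom phi x ->
            chart_deriv phi (c i) x = 0] >].

Fact vanishing_jet_closed : submod_closed vanishing_jet.
Proof.
split.
  apply/asboolP => e _ _; exists (fun=> fun=> 0); split=> [i||i].
  - exact: hol_at0.
  - by near=> y; rewrite big1// => i _; rewrite scale0r.
  - split=> // phi _ _; rewrite /chart_deriv derive1E.
    exact: derive_cst.
move=> a s t /asboolP hs /asboolP ht; apply/asboolP => e Ee xe.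
have [c [hc sc c0]] := hs e Ee xe; have [d [hd td d0]] := ht e Ee xe.
exists (fun i y => a * c i y + d i y); split=> [i||i].
- exact: hol_at_lin.
- near=> y; rewrite -[LHS]/(a *: lsec s y + lsec t y).
  have -> : lsec s y = \sum_(i < r) c i y *: fvec e i y by near: y.
  have -> : lsec t y = \sum_(i < r) d i y *: fvec e i y by near: y.
  rewrite scaler_sumr -big_split; apply: eq_bigr => i _.
  by rewrite scalerDl scalerA.
- have [ci0 dci] := c0 i; have [di0 ddi] := d0 i.
  split=> [|phi aphi xphi]; first by rewrite ci0 di0 mulr0 addr0.
  by rewrite chart_deriv_lin// dci// ddi// mulr0 addr0.
Unshelve. all: by end_near. Qed.

HB.instance Definition _ := GRing.isSubmodClosed.Build C local_section
  vanishing_jet vanishing_jet_closed.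

(* The fibre at x of the bundle of 1-jets. *)
Definition jet_space : lmodType C := quotient_module vanishing_jet.

(* j^1_x(s), with junk value 0 if s is not holomorphic near x. *)
Definition jet (s : section E) : jet_space :=
  quotient_class vanishing_jet (insubd (0 : local_section) s).

End Jets.

Section Tangent.
Context (x : X).

(* A tangent vector at x: its components in all the charts around x, which
   transform by the derivatives of the coordinate changes. *)
Definition tangent_family : {pred chart X -> C} := fun v =>
  `[< (forall phi, ~ (atlas phi /\ cdom phi x) -> v phi = 0) /\
      (forall phi psi, atlas phi -> cdom phi x -> atlas psi -> cdom psi x ->
         v psi = v phi * chart_deriv phi (cmap psi) x) >].

Fact tangent_family_closed : submod_closed tangent_family.
Proof.
split.
  by apply/asboolP; split=> // phi psi _ _ _ _; rewrite mul0r.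
move=> a u v /asboolP[u0 hu] /asboolP[v0 hv]; apply/asboolP; split.
  by move=> phi h; rewrite -[LHS]/(a * u phi + v phi) u0// v0// mulr0 addr0.
move=> phi psi aphi xphi apsi xpsi.
rewrite -[LHS]/(a * u psi + v psi) -[in RHS]/(a * u phi + v phi).
by rewrite (hu phi psi)// (hv phi psi)// mulrDl mulrA.
Qed.

HB.instance Definition _ := GRing.isSubmodClosed.Build C (chart X -> C)
  tangent_family tangent_family_closed.

Record tangent_vector := TangentVector {
  tcomp : chart X -> C;
  tcompP : tcomp \in tangent_family }.

HB.instance Definition _ := [isSub for tcomp].
HB.instance Definition _ := [Choice of tangent_vector by <:].
HB.instance Definition _ := [SubChoice_isSubLmodule of tangent_vector by <:].

Definition tangent_space : lmodType C := tangent_vector.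

End Tangent.

(* TX, framed over each chart phi by the coordinate vector field d/dphi. *)
Definition tangent_bundle : bundle 1 :=
  @Bundle 1 tangent_space [set e | exists2 phi, atlas phi &
    fdom e = cdom phi /\
    forall x i, cdom phi x -> tcomp (fvec e i x : tangent_vector x) phi = 1].

(* v = (d/dz)_x, i.e. dz(v) = 1. *)
Definition is_coord_vector (z : X -> C) (x : X) (v : tangent_bundle x) :=
  forall phi, atlas phi -> cdom phi x ->
    tcomp (v : tangent_vector x) phi * chart_deriv phi z x = 1.

(* The differential of the antiholomorphic map tau at x maps v to w. *)
Definition is_conj_differential (tau : X -> X) (x : X)
    (v : tangent_bundle x) (w : tangent_bundle (tau x)) :=
  forall phi psi, atlas phi -> cdom phi x -> atlas psi -> cdom psi (tau x) ->
    tcomp (w : tangent_vector (tau x)) psi =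
    (tcomp (v : tangent_vector x) phi *
     chart_deriv phi (fun y => (cmap psi (tau y))^*) x)^*.

Record line_bundle := LineBundle {
  lb_bundle :> bundle 1;
  lb_holomorphic : holomorphic_bundle lb_bundle }.

(* An isomorphism of L (x) L with TX, given by the corresponding nondegenerate
   fibrewise bilinear map L x L -> TX, (u, v) |-> image of u (x) v. *)
Record tangent_root (L : bundle 1) := TangentRoot {
  tsq : forall x, L x -> L x -> tangent_bundle x;
  tsq_linl : forall x v, linear (fun u => tsq u v : tangent_bundle x);
  tsq_linr : forall x u, linear (tsq u : L x -> tangent_bundle x);
  tsq_neq0 : forall x (u v : L x), u != 0 -> v != 0 -> tsq u v != 0;
  tsq_hol : forall x (s t : section L), hol_section x s -> hol_section x t ->
    @hol_section 1 tangent_bundle x (fun y => tsq (s y) (t y)) }.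

(* J^1(E) for a line bundle E: over a chart phi and a frame e of E, it is
   framed by the 1-jets of e and of phi e. *)
Definition jet_bundle (E : bundle 1) : bundle 2 :=
  @Bundle 2 (jet_space E) [set f | exists phi e,
    [/\ atlas phi, frames E e &
        f = LocalFrame (cdom phi `&` fdom e) (fun i x =>
          jet x (if i == 0 then fvec e 0
                 else (fun y => cmap phi y *: fvec e 0 y) : section E))]].

(* tau^* of the conjugate of E; its local holomorphic sections are the s o tau
   with s a local holomorphic section of E. *)
Definition conj_pullback (tau : X -> X) (r : nat) (E : bundle r) : bundle r :=
  @Bundle r (fun x => conj_module (E (tau x))) [set f | exists2 e, frames E e &
    f = LocalFrame (tau @^-1` fdom e)
          (fun i x => fvec e i (tau x) : conj_module (E (tau x)))].

Definition pullback_section (tau : X -> X) (r : nat) (E : bundle r)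
    (s : section E) : section (conj_pullback tau E) := fun x => s (tau x).

(* With L1 = tau^*(conj L) and xi_0 = Hom(L, L1), alpha is, near x, a nonzero
   flat section of the dual of xi_0, i.e. a holomorphic homomorphism
   L1 -> L.  A section alpha of Hom(L1, L) is flat for the connection inducing
   the trivial one on Hom(L1^2, L^2) iff alpha (x) alpha is locally a constant
   multiple c of the isomorphism L1^2 = tau^*(conj TX) = TX = L^2, where the
   middle identification is the inverse of the differential of tau. *)
Definition flat_hom_at (tau : X -> X) (L : bundle 1) (q : tangent_root L)
    (x : X) (alpha : forall y, conj_pullback tau L y -> L y) :=
  [/\ \forall y \near x, linear (alpha y),
      \forall y \near x, forall t : section (conj_pullback tau L),
        hol_section y t -> @hol_section 1 L y (fun y' => alpha y' (t y'))
    & exists2 c : C, c != 0 & \forall y \near x,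
        forall u v : conj_pullback tau L y,
          is_conj_differential (tsq q (alpha y u) (alpha y v))
            (c *: tsq q (u : L (tau y)) (v : L (tau y)))].

Section ProjectiveBundle.
Context {r : nat} (E : bundle r).

(* Set-theoretic sections, and the total space, of P(E). *)
Definition psection : Type := forall x, pspace (E x).
Definition ptotal : Type := {x : X & pspace (E x)}.

Definition hol_psection (x : X) (sigma : psection) :=
  exists2 s : section E, hol_section x s &
    \forall y \near x, spans (s y) (sigma y).

(* A holomorphic connection on P(E), given by its horizontal local sections:
   [horizontal x sigma] says that sigma is a holomorphic section near x whose
   1-jet at x is horizontal.  In a frame of E over a chart phi, the horizontal
   sections are the classes [f] with df + A f dphi proportional to f, where
   A dphi is a matrix of holomorphic 1-forms (well defined modulo scalars). *)
Record hol_connection := HolConnection {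
  horizontal : X -> psection -> Prop;
  horizontal_hol : forall x sigma, horizontal x sigma -> hol_psection x sigma;
  horizontal_local : forall phi e, atlas phi -> frames E e ->
    exists A : X -> 'M[C]_r,
      forall x, cdom phi x -> fdom e x ->
        (forall i j, hol_at x (fun y => A y i j)) /\
        forall (f : X -> 'cV[C]_r) (sigma : psection),
          (forall i, hol_at x (fun y => f y i 0)) ->
          (\forall y \near x,
             spans (\sum_(i < r) f y i 0 *: fvec e i y) (sigma y)) ->
          (horizontal x sigma <-> exists a : C, 
             (\col_i chart_deriv phi (fun y => f y i 0) x) + A x *m f x
             = a *: f x) }.

Definition flat_on (D : hol_connection) (V : set X) (sigma : psection) :=
  forall x, V x -> horizontal D x sigma.

Section Lift.
Context (tau : X -> X) (F : forall x, pspace (E x) -> pspace (E (tau x))).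

Definition total_map (p : ptotal) : ptotal :=
  existT _ (tau (projT1 p)) (F (projT2 p)).

(* F maps the horizontal directions of D to horizontal directions. *)
Definition preserves_connection (D : hol_connection) :=
  forall x (sigma sigma' : psection),
    (\forall y \near x, sigma' (tau y) = F (sigma y)) ->
    (horizontal D x sigma <-> horizontal D (tau x) sigma').

End Lift.
End ProjectiveBundle.

Definition canonical_lift (tau : X -> X) (L : bundle 1) (q : tangent_root L)
    (F : forall x, pspace (jet_bundle L x) -> pspace (jet_bundle L (tau x))) :=
  forall x (s : section L) (alpha : forall y, conj_pullback tau L y -> L y)
      (p : pspace (jet_bundle L x)),
    hol_section x s -> spans (jet x s : jet_bundle L x) p ->
    flat_hom_at q (tau x) alpha ->
    spans (jet (tau x) ((fun y => alpha y (pullback_section tau s y))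
                          : section L) : jet_bundle L (tau x)) (F x p).

Section ProjectiveStructures.

Definition coordinate : Type := (set X * (X -> pspace 'rV[C]_2))%type.

Definition hol_coordinate (u : coordinate) :=
  [/\ open u.1, set_inj u.1 u.2
    & forall x, u.1 x -> exists2 f : X -> 'rV[C]_2,
        forall i, hol_at x (fun y => f y 0 i) &
        \forall y \near x, spans (f y) (u.2 y)].

(* The transition map is the restriction of a Moebius transformation near each
   point, equivalently on each connected component of the overlap. *)
Definition moebius_compatible (u v : coordinate) :=
  forall x, u.1 x -> v.1 x -> exists2 A : 'M[C]_2, A \in unitmx &
    \forall y \near x, line (v.2 y) = [set w *m A | w in line (u.2 y)].

Definition projective_atlas (P : set coordinate) :=
  [/\ forall u, P u -> hol_coordinate u,
      forall x, exists2 u, P u & u.1 x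
    & forall u v, P u -> P v -> moebius_compatible u v].

Definition atlas_equiv (P Q : set coordinate) := projective_atlas (P `|` Q).

Record projective_structure := ProjectiveStructure {
  ps_class : set (set coordinate);
  ps_classP : exists2 P, projective_atlas P &
    ps_class = [set Q | projective_atlas Q /\ atlas_equiv P Q] }.

Definition projective_coordinate (S : projective_structure) (u : coordinate) :=
  exists2 P, ps_class S P & P u.

Definition real_structure (tau : X -> X) (S : projective_structure) :=
  forall u, projective_coordinate S u ->
    projective_coordinate S (tau @^-1` u.1, fun x => conj_point (u.2 (tau x))).

(* z : U -> C is a projective coordinate of S, via C = {[z : 1]} in P^1. *)
Definition affine_coordinate (S : projective_structure) (U : set X)
    (z : X -> C) :=
  exists2 phi, projective_coordinate S (U, phi) &
    forall x, U x -> spans (\row_(i < 2) (if i == 0 then z x else 1)) (phi x).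

(* D is the connection corresponding to S. *)
Definition corresponding_connection (L : bundle 1) (q : tangent_root L)
    (S : projective_structure) (D : hol_connection (jet_bundle L)) :=
  forall (U : set X) (z : X -> C) (omega : section L),
    affine_coordinate S U z ->
    (forall x, U x -> hol_section x omega) ->
    (forall x, U x -> is_coord_vector z (tsq q (omega x) (omega x))) ->
    forall (V : set X) (sigma : psection (jet_bundle L)),
      open V -> connected V -> V `<=` U ->
      (flat_on D V sigma <-> exists a b : C, (a, b) != (0, 0) /\
         forall x, V x ->
           spans (jet x ((fun y => (a * z y + b) *: omega y) : section L)
                    : jet_bundle L x) (sigma x)).

End ProjectiveStructures.

End Defs.

Arguments riemann_surface C : clear implicits.
Arguments bundle {C} X r.
Arguments frames {C X r} b _.
Arguments line_bundle {C} X.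
Arguments projective_structure {C} X.

Section Smooth.
Context {R : realType}.

Fixpoint Ck_on (U V : normedModType R) (A : set U) (k : nat) (f : U -> V) :=
  match k with
  | 0%N => forall x, A x -> {for x, continuous f}
  | k.+1 => (forall x, A x -> differentiable f x) /\
            forall v, Ck_on A k (fun x => 'D_v f x)
  end.

Definition smooth_at (U V : normedModType R) (x : U) (f : U -> V) :=
  exists2 A, open_nbhs x A & forall k, Ck_on A k f.

Context {X : riemann_surface (cplx R)} (E : bundle X 2).

(* The point q of P(E) has real coordinates u = (Re z, Im z, Re w, Im w), where
   z is its coordinate in the chart phi and q = [e_i + w e_(1-i)]. *)
Definition has_coords (phi : @chart (cplx R) X) (e : local_frame 2 E) (i : 'I_2)
    (q : ptotal E) (u : 'rV[R]_4) :=
  [/\ cdom phi (projT1 q), fdom e (projT1 q),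
      cmap phi (projT1 q) = (u 0 0 +i* u 0 1)%C :> R[i]
    & spans (fvec e i (projT1 q) +
             ((u 0 (inord 2) +i* u 0 (inord 3))%C : cplx R) *:
               fvec e (rev_ord i) (projT1 q)) (projT2 q)].

Definition smooth_map (F : ptotal E -> ptotal E) :=
  forall p phi e i u phi' e' i' u',
    atlas phi -> frames E e -> has_coords phi e i p u ->
    atlas phi' -> frames E e' -> has_coords phi' e' i' (F p) u' ->
    exists2 g : 'rV[R]_4 -> 'rV[R]_4, smooth_at u g &
      \forall v \near u, forall q, has_coords phi e i q v ->
        has_coords phi' e' i' (F q) (g v).

End Smooth.

(* Main.v *)
(** Near a point x let z be an affine projective coordinate and omega a section of
    L with omega^2 = d/dz.  Since j^1(h omega) = (h - h_z z) j^1 omega + h_z j^1(z omega),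
    the pair (j^1 omega, j^1(z omega)) is a frame of J^1(L), and sections of P_L are
    [g1 : g2] in this frame.  Passing to another such pair changes the frame by a
    constant matrix, because z' = (a z + b) / (c z + d) forces
    omega' = k (c z + d) omega with k locally constant.  Hence the condition
    g1 dg2 = g2 dg1 defines a connection; it corresponds to the structure, and it is
    the only one that does, since the sections with constant g1, g2 determine the
    connection matrix modulo scalars.

    A flat alpha carries omega to a section beta near tau x, and the lift is
    [a : b] |-> [conj a : conj b] from the frame of (z, omega) to that of
    (conj (z o tau), beta).  If the structure is real then, up to a constant factor
    on beta, this second pair is of the same kind as the first, so flat sections are
    preserved.  Conversely, let (w, eta) be adapted to the structure near tau x.
    In its frame j^1(h eta) has Wronskian h h_ww, so if flat sections are preserved
    then beta = k eta with k and k conj (z o tau) both affine in w, and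
    conj (z o tau) is a Moebius transform of w.

    Projective coordinates are only assumed to be injective and holomorphic, so
    that dz != 0, which makes the frames above available, comes from the argument
    principle; this and the holomorphy of derivatives rest on Cauchy's formula on
    a square. *)

From HB Require Import structures.
Require Import Defs.
From mathcomp Require Import all_boot all_order all_algebra.
From mathcomp Require Import complex.
From mathcomp Require Import all_classical all_reals all_analysis.
From mathcomp Require Import ring lra.

Set Implicit Arguments.
Unset Strict Implicit.
Unset Printing Implicit Defensive.

Import Order.TTheory GRing.Theory Num.Theory.
Import numFieldNormedType.Exports.

Local Open Scope classical_set_scope.
Local Open Scope ring_scope.

(** * Complex derivatives *)

(** Functions, sections and homomorphisms are total maps that are constrained only near a point, so
    nearly every statement is about germs. Constants found near single points are glued over a
    connected open set in one place only, to meet [corresponding_connection], which tests flatness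
    on connected open sets.

    Contours are squares with sides parallel to the axes, so that integrals reduce to real
    antiderivatives. Cauchy's formula is normalised by the integral of 1 / z itself: only that it is
    nonzero matters, and 2 pi i never appears.

    Square roots enter through omega^2. Two sections of L whose squares have constant ratio have
    locally constant ratio; this single remark gives the uniqueness of the flat alpha up to a
    constant, the involutivity of the lift and the change of flat frame.

    Since [tau (tau x)] and [x] are equal but not convertible, facts at [x] are often restated at
    [tau (tau x)]. *)

Section DerivativeRules.
Context {K : numFieldType}.
Implicit Types (f g : K -> K) (z d : K).

(** Without a quotient, h = 0 is no exception; the chain rule relies on this, since the increment of
    the inner function may vanish. *)
Lemma is_derive1P f z d : is_derive z 1 f d <->
  forall e, 0 < e -> \forall h \near (0 : K),
    `|f (z + h) - f z - d * h| <= e * `|h|.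
Proof.
have key (e h : K) : h != 0 ->
    (`|d - h^-1 *: ((f \o shift z) (h *: (1 : K)) - f z)| <= e)
    = (`|f (z + h) - f z - d * h| <= e * `|h|).
  move=> h0; rewrite -ler_pdivrMr ?normr_gt0// -normfV -normrM.
  rewrite -normrN /= [h *: 1]mulr1 addrC; congr (`|_| <= _).
  by rewrite /GRing.scale/= (addrC h z); field; exact: h0.
split=> [[df fd] e e0|H].
  have : (fun h => h^-1 *: ((f \o shift z) (h *: (1 : K)) - f z)) @ 0^' --> d.
    by rewrite -fd; exact: df.
  move=> /cvgrPdist_le /(_ e e0); rewrite near_withinE => He.
  near=> h; have [->|h0] := eqVneq h 0.
    by rewrite addr0 subrr mulr0 subrr normr0 mulr0.
  rewrite -key//; move: h0; near: h; exact: He.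
have cv : (fun h => h^-1 *: ((f \o shift z) (h *: (1 : K)) - f z)) @ 0^' --> d.
  apply/cvgrPdist_le => e e0; rewrite near_withinE.
  by near=> h => h0; rewrite key//; near: h; exact: H.
split; first by apply/cvg_ex; exists d.
exact/cvg_lim.
Unshelve. all: by end_near. Qed.

Lemma is_derive1_continuous f z d : is_derive z 1 f d -> {for z, continuous f}.
Proof.
by move=> [/derivable1_diffP df _]; exact: differentiable_continuous.
Qed.

Lemma is_derive1E f z : derivable f z 1 -> is_derive z 1 f (derive1 f z).
Proof. by move=> df; rewrite derive1E; exact: derivableP. Qed.

Lemma is_derive1_val f z d : is_derive z 1 f d -> derive1 f z = d.
Proof. by case=> _; rewrite derive1E. Qed.

Lemma is_derive1_near f g z d : (\forall w \near z, f w = g w) ->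
  is_derive z 1 f d -> is_derive z 1 g d.
Proof. exact: near_eq_is_derive. Qed.

Lemma is_derive1_cst (a z : K) : is_derive z 1 (fun=> a) (0 : K).
Proof. exact: is_derive_cst. Qed.

Lemma is_derive1_id z : is_derive z 1 (fun w : K => w) 1.
Proof. exact: is_derive_id. Qed.

Lemma is_derive1D f g z a b : is_derive z 1 f a -> is_derive z 1 g b ->
  is_derive z 1 (fun w => f w + g w) (a + b).
Proof. exact: is_deriveD. Qed.

Lemma is_derive1N f z a : is_derive z 1 f a ->
  is_derive z 1 (fun w => - f w) (- a).
Proof. exact: is_deriveN. Qed.

Lemma is_derive1B f g z a b : is_derive z 1 f a -> is_derive z 1 g b ->
  is_derive z 1 (fun w => f w - g w) (a - b).
Proof. exact: is_deriveB. Qed.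

Lemma is_derive1M f g z a b : is_derive z 1 f a -> is_derive z 1 g b ->
  is_derive z 1 (fun w => f w * g w) (f z * b + g z * a).
Proof. exact: is_deriveM. Qed.

Lemma is_derive1Z c f z a : is_derive z 1 f a ->
  is_derive z 1 (fun w => c * f w) (c * a).
Proof.
by move=> /(is_derive1M (is_derive1_cst c z)); rewrite mulr0 addr0.
Qed.

Lemma is_derive1V f z a : f z != 0 -> is_derive z 1 f a ->
  is_derive z 1 (fun w => (f w)^-1) (- a / f z ^+ 2).
Proof.
move=> fz0 [df fa]; split; first exact: derivableV.
by rewrite deriveV// fa /GRing.scale/= mulNr mulrC mulNr.
Qed.

Lemma is_derive1_compose f g z a b : is_derive z 1 f a -> is_derive (f z) 1 g b ->
  is_derive z 1 (fun w => g (f w)) (b * a).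
Proof.
move=> fa gb; apply/is_derive1P => e e0.
have a1 : 0 < `|a| + 1 by rewrite ltr_wpDl.
have b1 : 0 < `|b| + 1 by rewrite ltr_wpDl.
(* The error splits into that of [g] at the increment k of [f], where |k| <= (|a| + 1) |h|, and b
   times that of [f]; each receives e / 2. The summands 1 keep the denominators positive. *)
have e1 : 0 < e / 2 / (`|a| + 1) by rewrite !divr_gt0.
have e2 : 0 < e / 2 / (`|b| + 1) by rewrite !divr_gt0.
have /is_derive1P /(_ _ e1) Hg := gb.
have /is_derive1P Hf := fa.
have Hg' : \forall h \near (0 : K),
    `|g (f z + (f (z + h) - f z)) - g (f z) - b * (f (z + h) - f z)| <=
    e / 2 / (`|a| + 1) * `|f (z + h) - f z|.
  have /nbhs_ballP[t /= t0 Ht] := Hg.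
  have Ht2 : \forall h \near (0 : K), `|h| < t / (`|a| + 1).
    apply/nbhs_ballP; exists (t / (`|a| + 1)); first exact: divr_gt0.
    by move=> h; rewrite -ball_normE /ball_ /= sub0r normrN.
  near=> h; apply: Ht; rewrite -ball_normE /ball_ /= sub0r normrN.
  have ka1 : `|f (z + h) - f z - a * h| <= 1 * `|h| by near: h; exact: Hf.
  rewrite -(subrK (a * h) (f _ - _)) (le_lt_trans (ler_normD _ _))//.
  rewrite normrM; apply: le_lt_trans (lerD ka1 (lexx _)) _.
  rewrite -mulrDl addrC mulrC -ltr_pdivlMr//.
  by near: h.
near=> h.
have ka : `|f (z + h) - f z - a * h| <= e / 2 / (`|b| + 1) * `|h|.
  by near: h; exact: Hf.
have ka1 : `|f (z + h) - f z - a * h| <= 1 * `|h| by near: h; exact: Hf.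
have gk : `|g (f z + (f (z + h) - f z)) - g (f z) - b * (f (z + h) - f z)| <=
    e / 2 / (`|a| + 1) * `|f (z + h) - f z| by near: h; exact: Hg'.
have -> : f (z + h) = f z + (f (z + h) - f z) by ring.
move: (f (z + h) - f z) ka ka1 gk => k ka ka1 gk.
have -> : g (f z + k) - g (f z) - b * a * h =
    (g (f z + k) - g (f z) - b * k) + b * (k - a * h) by ring.
have kk : `|k| <= (`|a| + 1) * `|h|.
  rewrite -(subrK (a * h) k) mulrDl addrC (le_trans (ler_normD _ _))//.
  by rewrite normrM lerD2l.
rewrite (le_trans (ler_normD _ _))// [e in leRHS]splitr mulrDl; apply: lerD.
  apply: le_trans gk _; apply: le_trans (ler_wpM2l (ltW e1) kk) _.
  by rewrite mulrA divfK// gt_eqF.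
rewrite normrM; apply: le_trans (ler_wpM2l _ ka) _ => //.
rewrite mulrA ler_wpM2r// mulrCA ler_piMr ?divr_ge0 ?(ltW e0)//.
by rewrite ler_pdivrMr// mul1r lerDl.
Unshelve. all: by end_near. Qed.

Lemma is_derive1_affine (a b z : K) : is_derive z 1 (fun w => a + w * b) b.
Proof.
have := is_derive1D (is_derive1_cst a z)
  (is_derive1M (is_derive1_id z) (is_derive1_cst b z)).
by rewrite mulr0 !add0r mulr1.
Qed.

Lemma continuousC_D f g z : {for z, continuous f} ->
  {for z, continuous g} -> {for z, continuous (fun w => f w + g w)}.
Proof. exact: continuousD. Qed.

Lemma continuousC_N f z : {for z, continuous f} ->
  {for z, continuous (fun w => - f w)}.
Proof. exact: continuousN. Qed.

Lemma continuousC_M f g z : {for z, continuous f} ->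
  {for z, continuous g} -> {for z, continuous (fun w => f w * g w)}.
Proof. exact: continuousM. Qed.

Lemma continuousC_V f z : f z != 0 -> {for z, continuous f} ->
  {for z, continuous (fun w => (f w)^-1)}.
Proof. exact: continuousV. Qed.

Lemma continuousC_cst (a z : K) : {for z, continuous (fun _ : K => a)}.
Proof. exact: cst_continuous. Qed.

Lemma continuousC_id z : {for z, continuous (fun w : K => w)}.
Proof. exact: cvg_id. Qed.

End DerivativeRules.

(** * The modulus as a real number, and derivatives along lines *)

Section ComplexNorm.
Context {R : realType}.
Local Notation C := (cplx R).
Local Open Scope complex_scope.
Implicit Types (z w : C) (r : R).

(** The norm of [C] has values in [C]; as a real number it is open to linear arithmetic and to the
    real mean value theorem. *)
Definition nrm z : R := complex.Re `|z|.

Lemma nrmE z : `|z| = (nrm z)%:C.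
Proof. by rewrite /nrm; case: `|z| (normr_ge0 z) => a b; rewrite lecE /= => /andP[/eqP-> _]. Qed.

Lemma nrm_def z : nrm z = Num.sqrt (complex.Re z ^+ 2 + complex.Im z ^+ 2).
Proof. by rewrite /nrm normc_def. Qed.

Lemma nrm_ge0 z : 0 <= nrm z.
Proof. by rewrite -ler0c -nrmE normr_ge0. Qed.

Lemma nrm0 : nrm 0 = 0.
Proof. by rewrite /nrm normr0. Qed.

Lemma nrm_eq0 z : (nrm z == 0) = (z == 0).
Proof. by rewrite -(normr_eq0 z) nrmE -[0 in RHS]/((0 : R)%:C) (inj_eq (@complexI R)). Qed.

Lemma nrm_gt0 z : (0 < nrm z) = (z != 0).
Proof. by rewrite lt_def nrm_eq0 nrm_ge0 andbT. Qed.

Lemma nrmD z w : nrm (z + w) <= nrm z + nrm w.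
Proof. by rewrite -lecR rmorphD/= -!nrmE ler_normD. Qed.

Lemma nrmN z : nrm (- z) = nrm z.
Proof. by rewrite /nrm normrN. Qed.

Lemma nrmBC z w : nrm (z - w) = nrm (w - z).
Proof. by rewrite -nrmN opprB. Qed.

Lemma nrmB z w : nrm (z - w) <= nrm z + nrm w.
Proof. by rewrite -[nrm w]nrmN nrmD. Qed.

Lemma nrmB_ge z w : nrm z - nrm w <= nrm (z - w).
Proof. by rewrite lerBlDr; apply: le_trans (nrmD _ _); rewrite subrK. Qed.

Lemma nrmM z w : nrm (z * w) = nrm z * nrm w.
Proof. by apply: complexI; rewrite rmorphM/= -!nrmE normrM. Qed.

Lemma nrmV z : nrm z^-1 = (nrm z)^-1.
Proof. by apply: (@complexI R); rewrite fmorphV/= -!nrmE normfV. Qed.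

Lemma nrmX z n : nrm (z ^+ n) = nrm z ^+ n.
Proof. by apply: complexI; rewrite rmorphXn/= -!nrmE normrX. Qed.

Lemma nrm_real r : nrm (r%:C : C) = `|r|.
Proof. by rewrite nrm_def /= expr0n addr0 sqrtr_sqr. Qed.

Lemma nrm_conj z : nrm (Num.conj z) = nrm z.
Proof. by rewrite /nrm norm_conjC. Qed.

Lemma Re_le_nrm z : `|complex.Re z| <= nrm z.
Proof. by rewrite nrm_def -sqrtr_sqr ler_wsqrtr// lerDl sqr_ge0. Qed.

Lemma Im_le_nrm z : `|complex.Im z| <= nrm z.
Proof. by rewrite nrm_def -sqrtr_sqr ler_wsqrtr// lerDr sqr_ge0. Qed.

Lemma nrm_le_ReIm z : nrm z <= `|complex.Re z| + `|complex.Im z|.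
Proof.
rewrite nrm_def -[leRHS]ger0_norm ?addr_ge0// -[leRHS]sqrtr_sqr ler_sqrt ?sqr_ge0//.
rewrite sqrrD !real_normK ?num_real//.
by rewrite addrAC lerDl mulrn_wge0// mulr_ge0.
Qed.

Lemma complexReB z w : complex.Re (z - w) = complex.Re z - complex.Re w.
Proof. by case: z => ? ?; case: w. Qed.

Lemma complexImB z w : complex.Im (z - w) = complex.Im z - complex.Im w.
Proof. by case: z => ? ?; case: w. Qed.

Lemma complexReD z w : complex.Re (z + w) = complex.Re z + complex.Re w.
Proof. by case: z => ? ?; case: w. Qed.

Lemma complexImD z w : complex.Im (z + w) = complex.Im z + complex.Im w.
Proof. by case: z => ? ?; case: w. Qed.

Lemma complexReM z w : complex.Re (z * w) =
  complex.Re z * complex.Re w - complex.Im z * complex.Im w.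
Proof. by case: z => ? ?; case: w. Qed.

Lemma complexImM z w : complex.Im (z * w) =
  complex.Re z * complex.Im w + complex.Im z * complex.Re w.
Proof. by case: z => ? ?; case: w => ? ? /=; rewrite addrC. Qed.

Lemma nearCP z (P : C -> Prop) : (\forall w \near z, P w) <->
  exists2 r : R, 0 < r & forall w, nrm (w - z) < r -> P w.
Proof.
split=> [/nbhs_ballP[e /= e0 He]|[r r0 Hr]].
  have [eC e0'] : e = (complex.Re e)%:C /\ 0 < complex.Re e.
    by case: e e0 {He} => a b; rewrite ltcE /= => /andP[/eqP-> ->].
  exists (complex.Re e) => // w wz; apply: He.
  by rewrite -ball_normE /ball_ /= distrC nrmE eC ltcR.
apply/nbhs_ballP; exists (r%:C) => /=; first by rewrite ltcR.
move=> w; rewrite -ball_normE /ball_ /= distrC nrmE ltcR; exact: Hr.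
Qed.

Lemma nearRP (t : R) (P : R -> Prop) : (\forall w \near t, P w) <->
  exists2 r : R, 0 < r & forall w : R, `|w - t| < r -> P w.
Proof.
split=> [/nbhs_ballP[e /= e0 He]|[r r0 Hr]].
  exists e => // w wz; apply: He.
  by rewrite -ball_normE /ball_ /= distrC.
apply/nbhs_ballP; exists r => //=.
by move=> w; rewrite -ball_normE /ball_ /= distrC; exact: Hr.
Qed.

Lemma is_deriveCP (f : C -> C) z d : is_derive z 1 f d <->
  forall e : R, 0 < e -> exists2 r, 0 < r & forall w, nrm (w - z) < r ->
    nrm (f w - f z - d * (w - z)) <= e * nrm (w - z).
Proof.
rewrite is_derive1P; split=> H e e0.
  have eC : 0 < (e%:C : C) by rewrite ltcR.
  have /nearCP[r r0 Hr] := H _ eC.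
  exists r => // w wz; have := Hr (w - z); rewrite subr0 => /(_ wz).
  by rewrite [z + _]addrC subrK !nrmE -rmorphM lecR.
have [eE e0'] : e = (complex.Re e)%:C /\ 0 < complex.Re e.
  by case: e e0 => a b; rewrite ltcE /= => /andP[/eqP-> ->].
have [r r0 Hr] := H _ e0'.
apply/nearCP; exists r => // h; rewrite subr0 => hr.
have := Hr (z + h); rewrite addrAC subrr add0r => /(_ hr).
by rewrite eE !nrmE -rmorphM lecR.
Qed.

Lemma continuousCP (f : C -> C) z : {for z, continuous f} <->
  forall e : R, 0 < e -> exists2 r, 0 < r & forall w, nrm (w - z) < r ->
    nrm (f w - f z) < e.
Proof.
split=> [/cvgrPdist_lt H e e0|H].
  have eC : 0 < (e%:C : C) by rewrite ltcR.
  have /nearCP[r r0 Hr] := H _ eC; exists r => // w /Hr.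
  by rewrite nrmE ltcR nrmBC.
move=> A /nearCP[e e0 HA]; have [r r0 Hr] := H _ e0.
by apply/nearCP; exists r => // w /Hr /HA.
Qed.

(* Taking [c = 1] and [c = - 'i] yields real and imaginary parts. *)
Lemma is_derive_Re_line (f : C -> C) (c p v d : C) (t : R) :
  is_derive (p + t%:C * v) 1 f d ->
  is_derive t 1 (fun s : R => complex.Re (c * f (p + s%:C * v)))
    (complex.Re (c * d * v)).
Proof.
move=> /is_deriveCP fd; apply/is_derive1P => e e0.
set m := nrm c * (nrm v + 1) + 1.
have m0 : 0 < m by rewrite ltr_wpDl// mulr_ge0// ?addr_ge0// nrm_ge0.
have [r r0 Hr] := fd (e / m) (divr_gt0 e0 m0).
apply/nearRP; exists (r / (nrm v + 1)).
  by rewrite divr_gt0// ltr_wpDl// nrm_ge0.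
move=> h; rewrite subr0 ltr_pdivlMr; last by rewrite ltr_wpDl// nrm_ge0.
move=> hr; set z := p + t%:C * v in Hr *.
have E : p + (t + h)%:C * v = z + h%:C * v.
  by rewrite /z rmorphD/= mulrDl addrA.
have hv : nrm (h%:C * v) < r.
  rewrite nrmM nrm_real; apply: le_lt_trans hr; apply: ler_wpM2l => //; lra.
have := Hr (z + h%:C * v); rewrite addrAC subrr add0r => /(_ hv) H.
rewrite E -!complexReB.
have -> : complex.Re (c * d * v) * h = complex.Re (c * d * v * h%:C).
  by rewrite [RHS]complexReM /= mulr0 subr0.
rewrite -complexReB -mulrBr.
have -> : c * (f (z + h%:C * v) - f z) - c * d * v * h%:C =
          c * (f (z + h%:C * v) - f z - d * (h%:C * v)) by ring.
apply: le_trans (Re_le_nrm _) _; rewrite nrmM.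
apply: le_trans (ler_wpM2l (nrm_ge0 _) H) _.
rewrite nrmM nrm_real.
have -> : nrm c * (e / m * (`|h| * nrm v)) = e * `|h| * (nrm c * nrm v / m) by ring.
rewrite ler_piMr ?mulr_ge0// ?(ltW e0)// ler_pdivrMr// mul1r /m mulrDr mulr1.
have := nrm_ge0 c; lra.
Qed.

End ComplexNorm.

(** * Integrals over boxes and the theorem of Goursat *)

Section BoxIntegral.
Context {R : realType}.
Local Notation C := (cplx R).
Local Open Scope complex_scope.
Implicit Types (f g : C -> C) (G H : R -> C) (a b c d x y : R).

Lemma real_antiderivative (u : R -> R) :
  (forall x, -2 <= x <= 2 -> {for x, continuous u}) ->
  exists U : R -> R, forall x, -2 < x < 2 -> is_derive x 1 U (u x).
Proof.
move=> cu.
exists (fun x => \int[lebesgue_measure]_(t in [set` Interval (BLeft (-2)) (BRight x)]) u t).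
move=> x /andP[x1 x2].
have [] := @continuous_FTC1 R u (BLeft (-2)) x 2 x2.
- apply: continuous_compact_integrable; first exact: segment_compact.
  apply: continuous_in_subspaceT => t; rewrite inE /= in_itv /=; exact: cu.
- by rewrite lte_fin.
- by apply: cu; rewrite !ltW.
move=> dU UE; apply: DeriveDef; first exact: dU.
by rewrite -derive1E; exact: UE.
Qed.

(** Componentwise, because the fundamental theorem and the mean value theorem are applied to real
    functions. *)
Definition antiderivative (g G : R -> C) := forall x, -2 < x < 2 ->
  is_derive x 1 (fun t => complex.Re (G t)) (complex.Re (g x)) /\
  is_derive x 1 (fun t => complex.Im (G t)) (complex.Im (g x)).

(* Integrals are only needed inside ]-2, 2[, where every continuous function has an
   antiderivative; without one the value is the junk 0. *)
Definition line_integral (g : R -> C) a b : C :=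
  let G := xget (fun=> 0) [set G | antiderivative g G] in G b - G a.

Lemma antiderivative_lin (k : C) (g h G H : R -> C) :
  antiderivative g G -> antiderivative h H ->
  antiderivative (fun x => k * g x + h x) (fun x => k * G x + H x).
Proof.
move=> gG hH x x2; have [G1 G2] := gG x x2; have [H1 H2] := hH x x2.
split.
  under eq_fun do rewrite complexReD complexReM.
  by rewrite complexReD complexReM; apply: is_derive1D => //; apply: is_derive1B;
    exact: is_derive1Z.
under eq_fun do rewrite complexImD complexImM.
by rewrite complexImD complexImM; apply: is_derive1D => //; apply: is_derive1D; exact: is_derive1Z.
Qed.

Lemma real_mean_value (U u : R -> R) a b : -2 < a -> a <= b -> b < 2 ->
  (forall x, -2 < x < 2 -> is_derive x 1 U (u x)) ->
  exists2 x, a <= x <= b & U b - U a = u x * (b - a).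
Proof.
move=> a2 ab b2 dU; have [||x xab ->] := @MVT_segment R U u a b ab.
- move=> x; rewrite in_itv /= => /andP[ax xb]; apply: dU.
  by rewrite (lt_trans a2 ax) (lt_trans xb b2).
- apply: continuous_in_subspaceT => x; rewrite inE /= in_itv /= => /andP[ax xb].
  apply: (is_derive1_continuous (d := u x)); apply: dU.
  by rewrite (lt_le_trans a2 ax) (le_lt_trans xb b2).
- by exists x => //; rewrite in_itv /= in xab.
Qed.

(** The factor 2 comes from using the mean value theorem for the real and the imaginary part
    separately, at different points. *)
Lemma antiderivative_bound (g G : R -> C) a b (M : R) : antiderivative g G ->
  -2 < a -> a <= b -> b < 2 -> (forall x, a <= x <= b -> nrm (g x) <= M) ->
  nrm (G b - G a) <= 2 * M * (b - a).
Proof.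
move=> gG a2 ab b2 gM; apply: le_trans (nrm_le_ReIm _) _.
rewrite complexReB complexImB mulrDl mul1r mulrDl; apply: lerD.
  have [|x xab ->] := real_mean_value (U := fun t => complex.Re (G t))
    (u := fun t => complex.Re (g t)) a2 ab b2.
    by move=> x x2; have [] := gG x x2.
  rewrite normrM [`|b - a|]ger0_norm ?subr_ge0// ler_wpM2r ?subr_ge0//.
  exact: le_trans (Re_le_nrm _) (gM _ xab).
have [|x xab ->] := real_mean_value (U := fun t => complex.Im (G t))
  (u := fun t => complex.Im (g t)) a2 ab b2.
  by move=> x x2; have [] := gG x x2.
rewrite normrM [`|b - a|]ger0_norm ?subr_ge0// ler_wpM2r ?subr_ge0//.
exact: le_trans (Im_le_nrm _) (gM _ xab).
Qed.

Lemma antiderivative_unique (g G H : R -> C) a b :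
  antiderivative g G -> antiderivative g H -> -2 < a -> a <= b -> b < 2 ->
  G b - G a = H b - H a.
Proof.
move=> gG gH a2 ab b2.
have D := antiderivative_lin (-1) gH gG.
have := antiderivative_bound D a2 ab b2 (M := 0).
rewrite mulr0 mul0r => B.
have /B : forall x, a <= x <= b -> nrm (-1 * g x + g x) <= 0.
  by move=> x _; rewrite mulN1r addNr nrm0.
rewrite le_eqVlt ltNge nrm_ge0 orbF nrm_eq0 => /eqP E.
apply/eqP; rewrite -subr_eq0; apply/eqP.
by rewrite -[RHS]E; ring.
Qed.

Lemma line_integralE (g G : R -> C) a b : antiderivative g G ->
  -2 < a -> a <= b -> b < 2 -> line_integral g a b = G b - G a.
Proof.
move=> gG; rewrite /line_integral; case: xgetP => [G' _ gG'|/(_ G)//].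
by move=> a2 ab b2; exact: (antiderivative_unique gG' gG).
Qed.

Definition pt x y : C := (x +i* y).

Lemma ptE x y : pt x y = x%:C + 'i * y%:C.
Proof. by rewrite /pt [LHS]complexE complexiE. Qed.

Lemma pt_Re_Im (z : C) : pt (complex.Re z) (complex.Im z) = z.
Proof. by case: z. Qed.

Lemma derive_line_h (F : C -> C) (k d : C) x y : is_derive (pt x y) 1 F d ->
  is_derive x 1 (fun s => complex.Re (k * F (pt s y))) (complex.Re (k * d)).
Proof.
move=> Fd; have H s : pt s y = pt 0 y + s%:C * 1.
  by rewrite mulr1 !ptE; ring.
under eq_fun do rewrite H; rewrite -[k * d]mulr1.
by apply: is_derive_Re_line; rewrite -H.
Qed.

Lemma derive_line_v (F : C -> C) (k d : C) x y : is_derive (pt x y) 1 F d ->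
  is_derive y 1 (fun s => complex.Re (k * F (pt x s))) (complex.Re (k * d * 'i)).
Proof.
move=> Fd; have H s : pt x s = pt x 0 + s%:C * 'i.
  by rewrite !ptE; ring.
under eq_fun do rewrite H.
by apply: is_derive_Re_line; rewrite -H.
Qed.

(** Reduces each claim about imaginary parts to the claim about Re (k F) with k multiplied by -i. *)
Lemma Im_Re (z : C) : complex.Im z = complex.Re (- 'i * z).
Proof. by rewrite -complexiE; case: z => p q; rewrite complexReM /=; ring. Qed.

Lemma antiderivative_h (F f : C -> C) y :
  (forall x, -2 < x < 2 -> is_derive (pt x y) 1 F (f (pt x y))) ->
  antiderivative (fun x => f (pt x y)) (fun x => F (pt x y)).
Proof.
move=> dF x x2; split.
  by have := derive_line_h 1 (dF x x2); rewrite mul1r; under eq_fun do rewrite mul1r.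
by rewrite Im_Re; under eq_fun do rewrite Im_Re; apply: derive_line_h; exact: dF.
Qed.

(** On a vertical line d/dy F(x + i y) = i f, and the factor -i removes the i. *)
Lemma antiderivative_v (F f : C -> C) x :
  (forall y, -2 < y < 2 -> is_derive (pt x y) 1 F (f (pt x y))) ->
  antiderivative (fun y => f (pt x y)) (fun y => - 'i * F (pt x y)).
Proof.
move=> dF y y2.
have ii : 'i * 'i = -1 :> C by rewrite -expr2 sqrCi.
split.
  have := derive_line_v (- 'i) (dF y y2).
  by rewrite mulNr mulNr mulrAC ii mulN1r opprK.
rewrite Im_Re; under eq_fun do rewrite Im_Re mulrA mulrNN ii.
have := derive_line_v (-1) (dF y y2).
by rewrite !mulN1r mulNr -mulrN [X in complex.Re (f _ * X)]/= mulrC.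
Qed.

(** Whole lines through the square [-2, 2]^2 rather than just the sides of the box, since
    [antiderivative] makes its demand on all of ]-2, 2[. *)
Definition on_grid a b c d (z : C) :=
  [/\ -2 <= complex.Re z <= 2, -2 <= complex.Im z <= 2 &
   [\/ complex.Re z = a, complex.Re z = b, complex.Im z = c | complex.Im z = d]].

Definition grid_continuous f a b c d :=
  forall z, on_grid a b c d z -> {for z, continuous f}.

(** The counterclockwise contour integral around [a, b] x [c, d]. *)
Definition box_integral f a b c d : C :=
  line_integral (fun x => f (pt x c)) a b
  + 'i * line_integral (fun y => f (pt b y)) c d
  - line_integral (fun x => f (pt x d)) a b
  - 'i * line_integral (fun y => f (pt a y)) c d.

Lemma antiderivative_ex (g : R -> C) :
  (forall x, -2 <= x <= 2 -> forall e, 0 < e -> exists2 r : R, 0 < r &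
     forall t, `|t - x| < r -> nrm (g t - g x) < e) ->
  exists G, antiderivative g G.
Proof.
move=> cg.
have [U HU] : exists U : R -> R, forall x, -2 < x < 2 ->
    is_derive x 1 U (complex.Re (g x)).
  apply: real_antiderivative => x x2 A /nearRP[e e0 HA].
  have [r r0 Hr] := cg x x2 e e0; apply/nearRP; exists r => // t /Hr tr.
  by apply: HA; rewrite -complexReB (le_lt_trans _ tr)// Re_le_nrm.
have [V HV] : exists U : R -> R, forall x, -2 < x < 2 ->
    is_derive x 1 U (complex.Im (g x)).
  apply: real_antiderivative => x x2 A /nearRP[e e0 HA].
  have [r r0 Hr] := cg x x2 e e0; apply/nearRP; exists r => // t /Hr tr.
  by apply: HA; rewrite -complexImB (le_lt_trans _ tr)// Im_le_nrm.
by exists (fun x => U x +i* V x : C) => x x2; split => /=; [exact: HU|exact: HV].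
Qed.

Lemma line_integral_anti (g : R -> C) : (exists G, antiderivative g G) ->
  exists2 G, antiderivative g G & forall a b, line_integral g a b = G b - G a.
Proof.
move=> [G gG]; rewrite /line_integral; case: xgetP => [G' _ gG'|/(_ G)//].
by exists G'.
Qed.

Lemma grid_anti_h f y : (forall x, -2 <= x <= 2 -> {for pt x y, continuous f}) ->
  exists2 G, antiderivative (fun x => f (pt x y)) G &
    forall a b, line_integral (fun x => f (pt x y)) a b = G b - G a.
Proof.
move=> cf; apply/line_integral_anti/antiderivative_ex => x x2 e e0.
have /continuousCP/(_ e e0)[r r0 Hr] := cf x x2.
exists r => // t tx; apply: Hr.
have -> : pt t y - pt x y = (t - x)%:C by rewrite !ptE rmorphB/=; ring.
by rewrite nrm_real.
Qed.

Lemma grid_anti_v f x : (forall y, -2 <= y <= 2 -> {for pt x y, continuous f}) ->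
  exists2 G, antiderivative (fun y => f (pt x y)) G &
    forall a b, line_integral (fun y => f (pt x y)) a b = G b - G a.
Proof.
move=> cf; apply/line_integral_anti/antiderivative_ex => y y2 e e0.
have /continuousCP/(_ e e0)[r r0 Hr] := cf y y2.
exists r => // t ty; apply: Hr.
have -> : pt x t - pt x y = 'i * (t - y)%:C by rewrite !ptE rmorphB/=; ring.
by rewrite nrmM nrm_real /nrm normCi mul1r.
Qed.

Definition box_sides f a b c d G1 G2 G3 G4 :=
  [/\ antiderivative (fun x => f (pt x c)) G1,
      antiderivative (fun y => f (pt b y)) G2,
      antiderivative (fun x => f (pt x d)) G3 &
      antiderivative (fun y => f (pt a y)) G4].

Definition in_box a b c d := [/\ -2 < a, a <= b & b < 2] /\ [/\ -2 < c, c <= d & d < 2].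

Lemma box_integralE f a b c d G1 G2 G3 G4 : in_box a b c d ->
  box_sides f a b c d G1 G2 G3 G4 ->
  box_integral f a b c d =
  (G1 b - G1 a) + 'i * (G2 d - G2 c) - (G3 b - G3 a) - 'i * (G4 d - G4 c).
Proof.
move=> [[a2 ab b2] [c2 cd d2]] [h1 h2 h3 h4].
by rewrite /box_integral (line_integralE h1)// (line_integralE h2)//
  (line_integralE h3)// (line_integralE h4).
Qed.

Lemma grid_sides f a b c d : in_box a b c d -> grid_continuous f a b c d ->
  exists G1 G2 G3 G4, box_sides f a b c d G1 G2 G3 G4.
Proof.
move=> [[a2 ab b2] [c2 cd d2]] cf.
have c22 : -2 <= c <= 2 by lra.
have d22 : -2 <= d <= 2 by lra.
have a22 : -2 <= a <= 2 by lra.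
have b22 : -2 <= b <= 2 by lra.
have [|G1 h1 _] := @grid_anti_h f c.
  by move=> x x2; apply: cf; split => //; apply: Or43.
have [|G2 h2 _] := @grid_anti_v f b.
  by move=> x x2; apply: cf; split => //; apply: Or42.
have [|G3 h3 _] := @grid_anti_h f d.
  by move=> x x2; apply: cf; split => //; apply: Or44.
have [|G4 h4 _] := @grid_anti_v f a.
  by move=> x x2; apply: cf; split => //; apply: Or41.
by exists G1, G2, G3, G4.
Qed.

Lemma box_integral_lin (k : C) f g a b c d : in_box a b c d ->
  grid_continuous f a b c d -> grid_continuous g a b c d ->
  box_integral (fun z => k * f z + g z) a b c d =
  k * box_integral f a b c d + box_integral g a b c d.
Proof.
move=> Q cf cg.
have [F1 [F2 [F3 [F4 Ff]]]] := grid_sides Q cf.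
have [G1 [G2 [G3 [G4 Gg]]]] := grid_sides Q cg.
rewrite (box_integralE Q Ff) (box_integralE Q Gg).
case: Ff => f1 f2 f3 f4; case: Gg => g1 g2 g3 g4.
rewrite (box_integralE Q (And4 (antiderivative_lin k f1 g1)
  (antiderivative_lin k f2 g2) (antiderivative_lin k f3 g3)
  (antiderivative_lin k f4 g4))).
ring.
Qed.

Lemma box_integral_bound f a b c d (M : R) : in_box a b c d ->
  grid_continuous f a b c d ->
  (forall x y, a <= x <= b -> c <= y <= d ->
     [\/ x = a, x = b, y = c | y = d] -> nrm (f (pt x y)) <= M) ->
  nrm (box_integral f a b c d) <= 4 * M * ((b - a) + (d - c)).
Proof.
move=> Q cf fM.
have [F1 [F2 [F3 [F4 Ff]]]] := grid_sides Q cf.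
rewrite (box_integralE Q Ff).
case: Ff => f1 f2 f3 f4; case: Q => -[a2 ab b2] [c2 cd d2].
have aab : a <= a <= b by rewrite lexx.
have bab : a <= b <= b by rewrite lexx ab.
have ccd : c <= c <= d by rewrite lexx.
have dcd : c <= d <= d by rewrite lexx cd.
have B1 := antiderivative_bound f1 a2 ab b2 (fun x xab => fM x c xab ccd (Or43 _ _ _ erefl)).
have B2 := antiderivative_bound f2 c2 cd d2 (fun x xab => fM b x bab xab (Or42 _ _ _ erefl)).
have B3 := antiderivative_bound f3 a2 ab b2 (fun x xab => fM x d xab dcd (Or44 _ _ _ erefl)).
have B4 := antiderivative_bound f4 c2 cd d2 (fun x xab => fM a x aab xab (Or41 _ _ _ erefl)).
have ii (z : C) : nrm ('i * z) = nrm z by rewrite nrmM /nrm normCi mul1r.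
apply: le_trans (nrmB _ _) _; rewrite ii.
apply: le_trans (lerD (nrmB _ _) (lexx _)) _.
apply: le_trans (lerD (lerD (nrmD _ _) (lexx _)) (lexx _)) _; rewrite ii.
lra.
Qed.

Lemma box_integral_primitive (F f : C -> C) a b c d : in_box a b c d ->
  (forall z, on_grid a b c d z -> is_derive z 1 F (f z)) ->
  box_integral f a b c d = 0.
Proof.
move=> Q dF; have [[a2 ab b2] [c2 cd d2]] := Q.
have c22 : -2 <= c <= 2 by lra.
have d22 : -2 <= d <= 2 by lra.
have a22 : -2 <= a <= 2 by lra.
have b22 : -2 <= b <= 2 by lra.
have h1 : antiderivative (fun x => f (pt x c)) (fun x => F (pt x c)).
  by apply: antiderivative_h => x x2; apply: dF; split => /=;
    [lra| |apply: Or43].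
have h2 : antiderivative (fun y => f (pt b y)) (fun y => - 'i * F (pt b y)).
  by apply: antiderivative_v => x x2; apply: dF; split => /=;
    [|lra|apply: Or42].
have h3 : antiderivative (fun x => f (pt x d)) (fun x => F (pt x d)).
  by apply: antiderivative_h => x x2; apply: dF; split => /=;
    [lra| |apply: Or44].
have h4 : antiderivative (fun y => f (pt a y)) (fun y => - 'i * F (pt a y)).
  by apply: antiderivative_v => x x2; apply: dF; split => /=;
    [|lra|apply: Or41].
rewrite (box_integralE Q (And4 h1 h2 h3 h4)).
have ii : 'i * 'i = -1 :> C by rewrite -expr2 sqrCi.
rewrite -!mulrBr !mulrA !mulrN ii opprK !mul1r; ring.
Qed.

(** The side at [m] occurs with both signs; the horizontal antiderivatives of one half serve the
    other half and the whole box as well. *)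
Lemma box_integral_splitx f a m b c d : in_box a b c d -> a <= m <= b ->
  grid_continuous f a m c d -> grid_continuous f m b c d ->
  box_integral f a b c d = box_integral f a m c d + box_integral f m b c d.
Proof.
move=> Q /andP[am mb] cf1 cf2; have [[a2 ab b2] [c2 cd d2]] := Q.
have Q1 : in_box a m c d by split; split => //; lra.
have Q2 : in_box m b c d by split; split => //; lra.
have [F1 [F2 [F3 [F4 [f1 f2 f3 f4]]]]] := grid_sides Q1 cf1.
have [G1 [G2 [G3 [G4 [g1 g2 g3 g4]]]]] := grid_sides Q2 cf2.
rewrite (box_integralE Q (And4 f1 g2 f3 f4)) (box_integralE Q1 (And4 f1 f2 f3 f4)).
rewrite (box_integralE Q2 (And4 f1 g2 f3 f2)); ring.
Qed.

Lemma box_integral_splity f a b c m d : in_box a b c d -> c <= m <= d ->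
  grid_continuous f a b c m -> grid_continuous f a b m d ->
  box_integral f a b c d = box_integral f a b c m + box_integral f a b m d.
Proof.
move=> Q /andP[cm md] cf1 cf2; have [[a2 ab b2] [c2 cd d2]] := Q.
have Q1 : in_box a b c m by split; split => //; lra.
have Q2 : in_box a b m d by split; split => //; lra.
have [F1 [F2 [F3 [F4 [f1 f2 f3 f4]]]]] := grid_sides Q1 cf1.
have [G1 [G2 [G3 [G4 [g1 g2 g3 g4]]]]] := grid_sides Q2 cf2.
rewrite (box_integralE Q (And4 f1 f2 g3 f4)) (box_integralE Q1 (And4 f1 f2 f3 f4)).
rewrite (box_integralE Q2 (And4 f3 f2 g3 f4)); ring.
Qed.

Lemma box_integral_affine (A B p : C) a b c d : in_box a b c d ->
  box_integral (fun z => A + B * (z - p)) a b c d = 0.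
Proof.
move=> Q; apply: (box_integral_primitive
  (F := fun z => A * z + B / 2 * ((z - p) * (z - p))) Q) => z _.
have D : is_derive z 1 (fun w : C => w - p) 1.
  by have := is_derive1B (is_derive1_id z) (is_derive1_cst p z); rewrite subr0.
have := is_derive1D (is_derive1Z A (is_derive1_id z))
  (is_derive1Z (B / 2) (is_derive1M D D)).
have -> : A * 1 + B / 2 * ((z - p) * 1 + (z - p) * 1) = A + B * (z - p) :> C.
  by field.
by [].
Qed.

Lemma affine_continuous (A B p z : C) :
  {for z, continuous (fun z => A + B * (z - p))}.
Proof.
apply: continuousC_D; first exact: continuousC_cst.
apply: continuousC_M; first exact: continuousC_cst.
by apply: continuousC_D; [exact: continuousC_id|exact: continuousC_cst].
Qed.

Lemma exists_expn2_lt (r K0 : R) : 0 < r -> exists n, K0 / 2 ^+ n < r.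
Proof.
move=> r0; have [n Hn] : exists n : nat, K0 / r < n%:R.
  by exists (Num.truncn (K0 / r)).+1; exact: truncnS_gt.
exists n; rewrite ltr_pdivrMr ?exprn_gt0// mulrC -ltr_pdivrMr//.
by rewrite (lt_le_trans Hn)// -natrX ler_nat ltnW// ltn_expl.
Qed.

(** If all four quarters had integrals below [eta], the total would be below 4 eta. Sides are
    written as [S + S] so that no halving occurs in the bounds. *)
Lemma box_bisect f u v (S T eta : R) : in_box u (u + (S + S)) v (v + (T + T)) ->
  (forall z : C, -2 <= complex.Re z <= 2 -> -2 <= complex.Im z <= 2 ->
     {for z, continuous f}) ->
  4 * eta <= nrm (box_integral f u (u + (S + S)) v (v + (T + T))) ->
  exists2 p : R * R, [/\ u <= p.1, p.1 + S <= u + (S + S),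
      v <= p.2 & p.2 + T <= v + (T + T)] &
    eta <= nrm (box_integral f p.1 (p.1 + S) p.2 (p.2 + T)).
Proof.
move=> Q cf; have [[a2 ab b2] [c2 cd d2]] := Q.
have gcf a' b' c' d' : grid_continuous f a' b' c' d' by move=> z [? ? _]; exact: cf.
have S0 : 0 <= S by lra.
have T0 : 0 <= T by lra.
have E : box_integral f u (u + (S + S)) v (v + (T + T)) =
  box_integral f u (u + S) v (v + T)
  + box_integral f u (u + S) (v + T) (v + T + T)
  + box_integral f (u + S) (u + S + S) v (v + T)
  + box_integral f (u + S) (u + S + S) (v + T) (v + T + T).
  rewrite !addrA in a2 ab b2 c2 cd d2 *.
  have u1 : u <= u + S <= u + S + S by rewrite !lerDl S0.
  have v1 : v <= v + T <= v + T + T by rewrite !lerDl T0.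
  rewrite (@box_integral_splitx _ _ (u + S)) //.
  have Q1 : in_box u (u + S) v (v + T + T) by split; split => //; lra.
  have Q2 : in_box (u + S) (u + S + S) v (v + T + T) by split; split => //; lra.
  rewrite (box_integral_splity Q1 v1) // (box_integral_splity Q2 v1) //.
  by rewrite !addrA.
move=> H; apply: contrapT => N.
have B p : [/\ u <= p.1, p.1 + S <= u + (S + S),
      v <= p.2 & p.2 + T <= v + (T + T)] ->
    nrm (box_integral f p.1 (p.1 + S) p.2 (p.2 + T)) < eta.
  by move=> hp; rewrite ltNge; apply/negP => hh; apply: N; exists p.
have := B (u, v); have := B (u, v + T); have := B (u + S, v).
have := B (u + S, v + T) => /=.
have h1 : u <= u by []. have h2 : u <= u + S by rewrite lerDl.
have h3 : v <= v by []. have h4 : v <= v + T by rewrite lerDl.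
have h5 : u + S <= u + (S + S) by rewrite addrA lerDl.
have h6 : v + T <= v + (T + T) by rewrite addrA lerDl.
have h7 : u + S + S <= u + (S + S) by rewrite addrA.
have h8 : v + T + T <= v + (T + T) by rewrite addrA.
move=> /(_ (And4 h2 h7 h4 h8)) b4 /(_ (And4 h2 h7 h3 h6)) b3.
move=> /(_ (And4 h1 h5 h4 h8)) b2' /(_ (And4 h1 h5 h3 h6)) b1.
move: H; rewrite E; apply/negP; rewrite -ltNge.
apply: le_lt_trans (nrmD _ _) _.
apply: le_lt_trans (lerD (nrmD _ _) (lexx _)) _.
apply: le_lt_trans (lerD (lerD (nrmD _ _) (lexx _)) (lexx _)) _.
clear -b1 b2' b3 b4; lra.
Qed.

Lemma goursat f a b c d : in_box a b c d ->
  (forall z : C, -2 <= complex.Re z <= 2 -> -2 <= complex.Im z <= 2 ->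
     {for z, continuous f}) ->
  (forall z : C, a <= complex.Re z <= b -> c <= complex.Im z <= d ->
     exists D, is_derive z 1 f D) ->
  box_integral f a b c d = 0.
Proof.
move=> Q cf df; apply/eqP; rewrite -nrm_eq0; apply/negP => /negP.
rewrite nrm_eq0 -nrm_gt0; set eta := nrm _ => eta0.
have [[a2 ab b2] [c2 cd d2]] := Q.
have gcf a' b' c' d' : grid_continuous f a' b' c' d' by move=> z [? ? _]; exact: cf.
pose s := b - a; pose t := d - c.
pose S n := s / 2 ^+ n; pose T n := t / 2 ^+ n.
have s0 : 0 <= s by rewrite subr_ge0.
have t0 : 0 <= t by rewrite subr_ge0.
have S0 n : 0 <= S n by rewrite divr_ge0// exprn_ge0.
have T0 n : 0 <= T n by rewrite divr_ge0// exprn_ge0.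
have SS n : S n = S n.+1 + S n.+1.
  by rewrite /S exprS; field; rewrite expf_neq0.
have TT n : T n = T n.+1 + T n.+1.
  by rewrite /T exprS; field; rewrite expf_neq0.
pose bad n (p : R * R) := [/\ a <= p.1, p.1 + S n <= b, c <= p.2, p.2 + T n <= d &
  eta / 4 ^+ n <= nrm (box_integral f p.1 (p.1 + S n) p.2 (p.2 + T n))].
(* Stated as an implication for every pair, because [choice] needs a total successor function; for a
   pair that is not [bad] any value will do. *)
have step (np : nat * (R * R)) : exists p', bad np.1 np.2 ->
    bad np.1.+1 p' /\ [/\ np.2.1 <= p'.1, p'.1 + S np.1.+1 <= np.2.1 + S np.1,
      np.2.2 <= p'.2 & p'.2 + T np.1.+1 <= np.2.2 + T np.1].
  case: np => n [u v]; have [B|] := pselect (bad n (u, v)); last first.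
    by move=> NB; exists (u, v).
  have [/= au ub cv vd B5] := B.
  have [||| p' [p1 p2 p3 p4] p5] := @box_bisect f u v (S n.+1) (T n.+1) (eta / 4 ^+ n.+1).
  - rewrite -SS -TT; split; split; last 2 first.
    + by rewrite lerDl.
    + exact: le_lt_trans vd d2.
    + exact: lt_le_trans a2 au.
    + by rewrite lerDl.
    + exact: le_lt_trans ub b2.
    + exact: lt_le_trans c2 cv.
  - exact: cf.
  - rewrite -SS -TT; apply: le_trans B5; rewrite exprS invfM mulrCA.
    by rewrite mulVKf// pnatr_eq0.
  rewrite -SS in p2; rewrite -TT in p4.
  exists p' => _; split; split => //=.
  + exact: le_trans au p1.
  + exact: le_trans p2 ub.
  + exact: le_trans cv p3.
  + exact: le_trans p4 vd.
have [F HF] := choice step.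
pose u := fix u n := if n is m.+1 then F (m, u m) else (a, c).
have bad0 : bad 0%N (a, c).
  by split => //=; rewrite /S /T expr0 !divr1 /s /t ?subrKC//
    [a + _]addrC [c + _]addrC !subrK.
have badn n : bad n (u n).
  by elim: n => [//|n IH]; have [] := HF (n, u n) IH.
have mon m n : (m <= n)%N -> [/\ (u m).1 <= (u n).1, (u n).1 + S n <= (u m).1 + S m,
    (u m).2 <= (u n).2 & (u n).2 + T n <= (u m).2 + T m].
  elim: n => [|n IH]; first by rewrite leqn0 => /eqP ->.
  rewrite leq_eqVlt => /orP[/eqP -> //|/IH[i1 i2 i3 i4]].
  have [_ /= [j1 j2 j3 j4]] := HF (n, u n) (badn n).
  by split; [exact: le_trans i1 j1|exact: le_trans j2 i2|
             exact: le_trans i3 j3|exact: le_trans j4 i4].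
(* Nested intervals: the supremum of the left ends lies in all of them. *)
have key (w : nat -> R) (W : nat -> R) : (forall n, 0 <= W n) ->
    (forall m n, (m <= n)%N -> w m <= w n /\ w n + W n <= w m + W m) ->
    exists p, forall n, w n <= p <= w n + W n.
  move=> W0 H; exists (sup (range w)) => n.
  have ub m k : w m <= w k + W k.
    have [mk|/ltnW km] := leqP m k.
      by have [h1 h2] := H _ _ mk; rewrite (le_trans h1)// lerDl.
    by have [h1 h2] := H _ _ km; rewrite (le_trans _ h2)// lerDl.
  apply/andP; split.
    by apply: ub_le_sup; [exists (w 0%N + W 0%N) => _ [m _ <-]|exists n].
  by apply: ge_sup; [exists (w 0%N), 0%N|move=> _ [m _ <-]].
have [px Hx] := key (fun n => (u n).1) S S0 (fun m n mn => let: And4 h1 h2 _ _ :=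
  mon m n mn in conj h1 h2).
have [py Hy] := key (fun n => (u n).2) T T0 (fun m n mn => let: And4 _ _ h1 h2 :=
  mon m n mn in conj h1 h2).
pose p := pt px py.
have [D /is_deriveCP HD] : exists D, is_derive p 1 f D.
  apply: df => /=.
    have := Hx 0%N; rewrite /= /S expr0 divr1 /s; lra.
  have := Hy 0%N; rewrite /= /T expr0 divr1 /t; lra.
(* The error e / k leads to the bound eta / 4 ^ n times 4 (s + t)^2 / k, and this choice makes the
   last factor less than 1; the summand 1 covers a degenerate box. *)
pose k := 8 * (s + t + 1) ^+ 2.
have st0 : 0 < s + t + 1 by lra.
have k0 : 0 < k by rewrite mulr_gt0// exprn_gt0.
have [r r0 Hr] := HD (eta / k) (divr_gt0 eta0 k0).
have [n Hn] := exists_expn2_lt (s + t) r0.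
have [/= h1 h2 h3 h4 h5] := badn n.
have Qn : in_box (u n).1 ((u n).1 + S n) (u n).2 ((u n).2 + T n).
  split; split; rewrite ?lerDl//.
  + exact: lt_le_trans a2 h1.
  + exact: le_lt_trans h2 b2.
  + exact: lt_le_trans c2 h3.
  + exact: le_lt_trans h4 d2.
(* The affine part has a primitive and integrates to zero; what is left is small compared with the
   size of the box. *)
pose E z := f z - (f p + D * (z - p)).
have fE : f = (fun z => 1 * E z + (f p + D * (z - p))).
  by apply/funext => z; rewrite /E; ring.
have cE : grid_continuous E (u n).1 ((u n).1 + S n) (u n).2 ((u n).2 + T n).
  move=> z Hz; apply: continuousC_D; first exact: gcf Hz.
  by apply: continuousC_N; exact: affine_continuous.
have JE : box_integral f (u n).1 ((u n).1 + S n) (u n).2 ((u n).2 + T n) =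
    box_integral E (u n).1 ((u n).1 + S n) (u n).2 ((u n).2 + T n).
  have := box_integral_lin 1 Qn cE (fun z _ => @affine_continuous (f p) D p z).
  rewrite (box_integral_affine _ _ _ Qn) addr0 mul1r => <-; rewrite -fE; reflexivity.
have STn : S n + T n = (s + t) / 2 ^+ n by rewrite /S /T -mulrDl.
have Ebd x y : (u n).1 <= x <= (u n).1 + S n -> (u n).2 <= y <= (u n).2 + T n ->
    [\/ x = (u n).1, x = (u n).1 + S n, y = (u n).2 | y = (u n).2 + T n] ->
    nrm (E (pt x y)) <= eta / k * (S n + T n).
  move=> xx yy _; have zp : nrm (pt x y - p) <= S n + T n.
    apply: le_trans (nrm_le_ReIm _) _; rewrite complexReB complexImB /=.
    have := Hx n; have := Hy n => hy hx.
    by apply: lerD; rewrite ler_norml; [clear - hx xx|clear - hy yy]; lra.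
  have -> : E (pt x y) = f (pt x y) - f p - D * (pt x y - p) by rewrite /E; ring.
  apply: le_trans (Hr _ _) _; first by rewrite (le_lt_trans zp)// STn.
  by rewrite ler_wpM2l// divr_ge0// ltW.
have := box_integral_bound Qn cE Ebd.
rewrite -JE; apply/negP; rewrite -ltNge; apply: lt_le_trans h5.
have -> : (u n).1 + S n - (u n).1 + ((u n).2 + T n - (u n).2) = S n + T n by ring.
rewrite STn.
have -> : 4 * (eta / k * ((s + t) / 2 ^+ n)) * ((s + t) / 2 ^+ n) =
    eta / 4 ^+ n * (4 * (s + t) ^+ 2 / k).
  have -> : (4 : R) ^+ n = 2 ^+ n * 2 ^+ n.
    by rewrite -exprMn; congr (_ ^+ _); rewrite -natrM.
  by field; rewrite gt_eqF//= expf_neq0.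
rewrite gtr_pMr ?divr_gt0 ?exprn_gt0// ltr_pdivrMr// mul1r /k.
have : (s + t) ^+ 2 <= (s + t + 1) ^+ 2.
  have : 0 <= s + t by exact: addr_ge0.
  by clear; move: (s + t) => x x0; rewrite !expr2; nra.
have : 0 < (s + t + 1) ^+ 2 by rewrite exprn_gt0.
by clear; move: ((s + t) ^+ 2) ((s + t + 1) ^+ 2) => x y; lra.
Qed.

(** Cutting away four boxes that avoid [w] leaves a square of side 2 e around it, whose integral
    tends to 0 with e because [f] is bounded near [w]. *)
Lemma goursat_punctured f (w : C) a b c d : in_box a b c d ->
  a < complex.Re w < b -> c < complex.Im w < d ->
  (forall z : C, -2 <= complex.Re z <= 2 -> -2 <= complex.Im z <= 2 ->
     {for z, continuous f}) ->
  (forall z : C, z != w -> a <= complex.Re z <= b -> c <= complex.Im z <= d ->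
     exists D, is_derive z 1 f D) ->
  box_integral f a b c d = 0.
Proof.
move=> Q /andP[aw wb] /andP[cw wd] cf df.
have [[a2 ab b2] [c2 cd d2]] := Q.
have gcf a' b' c' d' : grid_continuous f a' b' c' d' by move=> z [? ? _]; exact: cf.
move: aw wb cw wd; set p := complex.Re w; set q := complex.Im w => aw wb cw wd.
have /continuousCP/(_ 1 ltr01)[r r0 Hr] : {for w, continuous f}.
  by apply: cf; apply/andP; split; apply: ltW; rewrite -/p -/q;
    [apply: lt_trans a2 aw|apply: lt_trans wb b2|apply: lt_trans c2 cw|apply: lt_trans wd d2].
pose M := nrm (f w) + 1.
have fM z : nrm (z - w) < r -> nrm (f z) <= M.
  move=> /Hr zw; rewrite -(subrK (f w) (f z)) /M addrC.
  by apply: le_trans (nrmD _ _) _; rewrite lerD2l ltW.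
have M0 : 0 < M by rewrite ltr_wpDl// nrm_ge0.
have avoid z : (complex.Re z != p) || (complex.Im z != q) -> z != w.
  by apply: contraTneq => ->; rewrite /p /q !eqxx.
have small (e : R) : 0 < e -> p - e > a -> p + e < b -> q - e > c -> q + e < d ->
    e + e < r -> nrm (box_integral f a b c d) <= 4 * M * (4 * e).
  move=> e0 e1 e2 e3 e4 er.
  have e5 : a <= p - e <= b by clear - e1 e0 wb; lra.
  have e6 : p - e <= p + e <= b by clear - e0 e2; lra.
  have e7 : c <= q - e <= d by clear - e3 e0 wd; lra.
  have e8 : q - e <= q + e <= d by clear - e0 e4; lra.
  rewrite (box_integral_splitx Q e5)//.
  have Q1 : in_box a (p - e) c d.
    by split; split => //; clear - a2 e5 b2; lra.
  have Q2 : in_box (p - e) b c d.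
    by split; split => //; clear - a2 e5 b2; lra.
  rewrite (@goursat f a (p - e))//; last first.
    move=> z zx zy; apply: df; rewrite ?avoid//.
      by rewrite lt_eqF//; clear - zx e0; lra.
    by clear - zx e5; lra.
  rewrite add0r (box_integral_splitx Q2 e6)//.
  have Q3 : in_box (p - e) (p + e) c d.
    by split; split => //; clear - a2 e5 b2 e6; lra.
  have Q4 : in_box (p + e) b c d.
    by split; split => //; clear - a2 e5 b2 e6; lra.
  rewrite (@goursat f (p + e))//; last first.
    move=> z zx zy; apply: df; rewrite ?avoid//.
      by rewrite gt_eqF//; clear - zx e0; lra.
    by clear - zx e5 e6; lra.
  rewrite addr0 (box_integral_splity Q3 e7)//.
  have Q5 : in_box (p - e) (p + e) c (q - e).
    by split; first (by case: Q3); split => //; clear - c2 e7 d2; lra.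
  have Q6 : in_box (p - e) (p + e) (q - e) d.
    by split; first (by case: Q3); split => //; clear - c2 e7 d2; lra.
  rewrite (@goursat f (p - e) (p + e) c)//; last first.
    move=> z zx zy; apply: df; rewrite ?avoid//.
    - by rewrite orbC lt_eqF//; clear - zy e0; lra.
    - by clear - zx e5 e6; lra.
    - by clear - zy e7; lra.
  rewrite add0r (box_integral_splity Q6 e8)//.
  have Q7 : in_box (p - e) (p + e) (q - e) (q + e).
    by split; first (by case: Q3); split => //; clear - c2 e7 d2 e8; lra.
  have Q8 : in_box (p - e) (p + e) (q + e) d.
    by split; first (by case: Q3); split => //; clear - c2 e7 d2 e8; lra.
  rewrite (@goursat f (p - e) (p + e) (q + e))//; last first.
    move=> z zx zy; apply: df; rewrite ?avoid//.
    - by rewrite orbC gt_eqF//; clear - zy e0; lra.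
    - by clear - zx e5 e6; lra.
    - by clear - zy e7 e8; lra.
  rewrite addr0.
  have := @box_integral_bound f (p - e) (p + e) (q - e) (q + e) M Q7 (gcf _ _ _ _).
  have -> : p + e - (p - e) + (q + e - (q - e)) = 4 * e by ring.
  apply => x y xx yy _; apply: fM; apply: le_lt_trans er.
  apply: le_trans (nrm_le_ReIm _) _; rewrite complexReB complexImB /= -/p -/q.
  by apply: lerD; rewrite ler_norml; [clear - xx|clear - yy]; lra.
apply/eqP; rewrite -nrm_eq0; apply/negP => /negP; rewrite nrm_eq0 -nrm_gt0.
set eta := nrm _ => eta0.
pose m := Num.min (Num.min (p - a) (b - p)) (Num.min (q - c) (d - q)).
have m0 : 0 < m by rewrite !lt_min !subr_gt0 aw wb cw wd.
(* The three terms keep the small square inside the box, keep it where |f| <= M, and push the bound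
   16 M e down to eta / 2. *)
pose e := Num.min (m / 2) (Num.min (r / 4) (eta / (32 * M))).
have e0 : 0 < e by rewrite !lt_min !divr_gt0// mulr_gt0.
have em : e < m.
  by rewrite gt_min ltr_pdivrMr// ltr_pMr// ltr1n.
have [em1 em2] : e < p - a /\ e < b - p.
  by move: em; rewrite !lt_min => /andP[/andP[-> ->] _].
have [em3 em4] : e < q - c /\ e < d - q.
  by move: em; rewrite !lt_min => /andP[_ /andP[-> ->]].
have er : e <= r / 4 by rewrite !ge_min lexx orbT.
have ee : e <= eta / (32 * M) by rewrite !ge_min lexx !orbT.
have := small e e0; rewrite ltrBrDl -ltrBrDr => /(_ em1).
rewrite -ltrBrDl => /(_ em2).
rewrite ltrBrDl -ltrBrDr => /(_ em3).
rewrite -ltrBrDl => /(_ em4) H.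
have : nrm (box_integral f a b c d) <= 4 * M * (4 * e).
  by apply: H; clear - er r0; lra.
apply/negP; rewrite -ltNge -/eta.
move: ee; rewrite ler_pdivlMr ?mulr_gt0// => ee.
have -> : 4 * M * (4 * e) = (e * (32 * M)) / 2 by field.
by clear -ee eta0; lra.
Qed.

Lemma Im_line_integral_pos (g : R -> C) :
  (exists G, antiderivative g G) -> (forall x, 0 < complex.Im (g x)) ->
  0 < complex.Im (line_integral g (-1) 1).
Proof.
move=> /line_integral_anti[G gG ->] g0; rewrite complexImB.
have dG x : -2 < x < 2 -> is_derive x 1 (fun t => complex.Im (G t)) (complex.Im (g x)).
  by move=> /gG[].
have [m2 m1 m3] : [/\ -2 < -1 :> R, -1 <= 1 :> R & 1 < 2 :> R] by split; lra.
have [x _ ->] := real_mean_value m2 m1 m3 dG.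
by rewrite mulr_gt0// opprK.
Qed.

Lemma ptV x y : (pt x y)^-1 =
  pt (x / (x ^+ 2 + y ^+ 2)) (- (y / (x ^+ 2 + y ^+ 2))).
Proof. by []. Qed.

(** Along each of the four sides the integrand, including the direction of travel, has positive
    imaginary part, so the value need not be computed. *)
Lemma box_integral_inv_neq0 : box_integral (fun z => z^-1) (-1) 1 (-1) 1 != 0.
Proof.
have cV z : z != 0 -> {for z, continuous (fun z : C => z^-1)}.
  by move=> z0; apply: continuousC_V => //; exact: continuousC_id.
have hx y : y != 0 -> exists G, antiderivative (fun x => (pt x y)^-1) G.
  move=> y0; have [x _|G HG _] := @grid_anti_h (fun z => z^-1) y; last by exists G.
  by apply: cV; apply: contraNneq y0 => -[_ ->].
have vx x : x != 0 -> exists G, antiderivative (fun y => (pt x y)^-1) G.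
  move=> x0; have [y _|G HG _] := @grid_anti_v (fun z => z^-1) x; last by exists G.
  by apply: cV; apply: contraNneq x0 => -[-> _].
have mul_anti (k : C) (g : R -> C) : (exists G, antiderivative g G) ->
    line_integral (fun x => k * g x) (-1) 1 = k * line_integral g (-1) 1.
  move=> /line_integral_anti[G gG ->].
  have z0 : antiderivative (fun=> 0) (fun=> 0).
    by move=> x _; split; exact: is_derive1_cst.
  have H := antiderivative_lin k gG z0.
  have E : (fun x => k * g x + 0) = (fun x => k * g x).
    by apply/funext => x; rewrite addr0.
  have [m2 m1 m3] : [/\ -2 < -1 :> R, -1 <= 1 :> R & 1 < 2 :> R] by split; lra.
  rewrite E in H; rewrite (line_integralE H m2 m1 m3).
  by rewrite !addr0 mulrBr.
have ex_mul (k : C) (g : R -> C) : (exists G, antiderivative g G) ->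
    exists G, antiderivative (fun x => k * g x) G.
  move=> [G gG]; exists (fun x => k * G x + 0).
  have z0 : antiderivative (fun=> 0) (fun=> 0).
    by move=> x _; split; exact: is_derive1_cst.
  have H := antiderivative_lin k gG z0.
  by have -> : (fun x => k * g x) = (fun x => k * g x + 0)
    by apply/funext => x; rewrite addr0.
(* The factors i and -1 are moved under the integral signs, so that [Im_line_integral_pos] applies
   to each of the four terms. *)
rewrite /box_integral -!mul_anti; try (by apply: vx; rewrite ?oppr_eq0 oner_eq0).
have N1 : forall z : C, - z = -1 * z by move=> z; rewrite mulN1r.
rewrite [X in _ + X + _]N1 [X in _ + X]N1 -!mul_anti; last 2 first.
- by apply: ex_mul; apply: vx; rewrite ?oppr_eq0 oner_eq0.
- by apply: hx; rewrite ?oppr_eq0 oner_eq0.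
apply/negP => /eqP/(congr1 (@complex.Im R)); apply/eqP; rewrite gt_eqF//.
have pos (x : R) : 0 < 1 + x ^+ 2 by rewrite ltr_pwDl// sqr_ge0.
rewrite 3!complexImD [X in X < _]/=.
apply: addr_gt0; first apply: addr_gt0; first apply: addr_gt0;
  apply: Im_line_integral_pos.
- by apply: hx; rewrite oppr_eq0 oner_eq0.
- by move=> x; rewrite ptV /= mulNr opprK sqrrN expr1n addrC divr_gt0.
- by apply: ex_mul; apply: vx; rewrite oner_eq0.
- by move=> x; rewrite ptV -complexiE complexImM /= mul0r add0r mul1r expr1n divr_gt0.
- by apply: ex_mul; apply: hx; rewrite oner_eq0.
- move=> x; rewrite ptV -N1 -[- _]/(pt _ _) /= opprK.
  by rewrite expr1n addrC divr_gt0.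
- by apply/ex_mul/ex_mul/vx; rewrite oppr_eq0 oner_eq0.
- move=> x; rewrite ptV -complexiE -N1 -[- _]/(pt _ _) /= sqrrN expr1n.
  by rewrite mul0r add0r mul1r mulNr opprK divr_gt0.
Qed.

End BoxIntegral.

(** * Holomorphic functions *)

Section Cauchy.
Context {R : realType}.
Local Notation C := (cplx R).
Local Open Scope complex_scope.
Implicit Types (f g u : C -> C) (z w p : C).

Lemma is_derive1_derivable f z D : is_derive z 1 f D -> derivable f z 1.
Proof. by case. Qed.

Lemma derivable1_continuous f z : derivable f z 1 -> {for z, continuous f}.
Proof. by move=> /is_derive1E; exact: is_derive1_continuous. Qed.

(** The mean value theorem on the segment from z to w, for Re (c f) with c = 1 and c = -i. *)
Lemma derive0_constant f z (r : R) :
  (forall w, nrm (w - z) < r -> is_derive w 1 f 0) ->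
  forall w, nrm (w - z) < r -> f w = f z.
Proof.
move=> df w wr.
have line (t : R) : 0 <= t <= 1 -> is_derive (z + t%:C * (w - z)) 1 f 0.
  move=> t01; apply: df; rewrite addrAC subrr add0r nrmM nrm_real.
  apply: le_lt_trans wr; rewrite ger0_norm; last by case/andP: t01.
  by rewrite ler_piMl ?nrm_ge0//; case/andP: t01.
have key (c : C) : complex.Re (c * f w) = complex.Re (c * f z).
  pose psi (t : R) := complex.Re (c * f (z + t%:C * (w - z))).
  have dpsi (t : R) : 0 <= t <= 1 -> is_derive t 1 psi 0.
    move=> /line /(is_derive_Re_line c); rewrite mulr0 mul0r.
    by move=> H; exact: H.
  have [||t _] := @MVT_segment R psi (fun=> 0) 0 1 ler01.
  - by move=> t; rewrite in_itv /= => /andP[t0 t1]; apply: dpsi; rewrite !ltW.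
  - apply: continuous_in_subspaceT => t; rewrite inE /= in_itv /= => t01.
    exact: is_derive1_continuous (dpsi t t01).
  rewrite mul0r /psi -[1%:C]/(1 : C) -[0%:C]/(0 : C) mul1r mul0r addr0 subrKC.
  by move/eqP; rewrite subr_eq0 => /eqP.
rewrite -[f w]pt_Re_Im -[f z]pt_Re_Im !Im_Re !key.
by have := key 1; rewrite !mul1r => ->.
Qed.

Local Notation JQ f := (box_integral f (-1) 1 (-1) 1).
Local Notation gridc f := (grid_continuous f (-1) 1 (-1) 1).
Local Notation ongrid := (on_grid (-1) 1 (-1) 1).

Lemma unit_box : in_box (-1 : R) 1 (-1) 1.
Proof. by split; split; lra. Qed.

Lemma grid_nrm_ge1 z : ongrid z -> 1 <= nrm z.
Proof.
have n1 : `|-1| = 1 :> R by rewrite normrN1.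
have n2 : `|1| = 1 :> R by rewrite normr1.
by move=> [_ _ [] h];
  [have := Re_le_nrm z|have := Re_le_nrm z|have := Im_le_nrm z|have := Im_le_nrm z];
  rewrite h ?n1 ?n2.
Qed.

Lemma grid_nrm_le4 z : -2 <= complex.Re z <= 2 -> -2 <= complex.Im z <= 2 -> nrm z <= 4.
Proof.
move=> h1 h2; apply: le_trans (nrm_le_ReIm z) _.
have : `|complex.Re z| <= 2 by rewrite ler_norml.
have : `|complex.Im z| <= 2 by rewrite ler_norml.
by lra.
Qed.

Lemma line_bounded (g : R -> C) :
  (forall x, -2 <= x <= 2 -> forall e, 0 < e -> exists2 r : R, 0 < r &
     forall t, `|t - x| < r -> nrm (g t - g x) < e) ->
  exists M, forall x, -2 <= x <= 2 -> nrm (g x) <= M.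
Proof.
move=> cg; have m22 : -2 <= 2 :> R by lra.
have [|c _ Hc] := EVT_max (f := fun x => nrm (g x)) m22.
  apply: continuous_in_subspaceT => x; rewrite inE /= in_itv /= => x2.
  move=> A /nearRP[e e0 HA]; have [r r0 Hr] := cg x x2 e e0.
  apply/nearRP; exists r => // t /Hr tr; apply: HA; apply: le_lt_trans tr.
  rewrite ler_norml; apply/andP; split.
    by rewrite lerNl opprB [leRHS]nrmBC nrmB_ge.
  exact: nrmB_ge.
by exists (nrm (g c)) => x x2; apply: Hc; rewrite in_itv /=.
Qed.

Lemma grid_bounded f : gridc f -> exists2 M, 0 < M & forall z, ongrid z -> nrm (f z) <= M.
Proof.
move=> cf.
have m22 : -2 <= (-1 : R) <= 2 by lra.
have p22 : -2 <= (1 : R) <= 2 by lra.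
have H (y : R) : y = -1 \/ y = 1 -> exists M, forall x, -2 <= x <= 2 -> nrm (f (pt x y)) <= M.
  move=> hy; apply: line_bounded => x x2 e e0.
  have /continuousCP/(_ e e0)[r r0 Hr] : {for pt x y, continuous f}.
    by apply: cf; split => //=; case: hy => ->; rewrite ?m22 ?p22//;
      [apply: Or43|apply: Or44].
  exists r => // t tx; apply: Hr.
  have -> : pt t y - pt x y = (t - x)%:C by rewrite !ptE rmorphB/=; ring.
  by rewrite nrm_real.
have V (x : R) : x = -1 \/ x = 1 -> exists M, forall y, -2 <= y <= 2 -> nrm (f (pt x y)) <= M.
  move=> hx; apply: line_bounded => y y2 e e0.
  have /continuousCP/(_ e e0)[r r0 Hr] : {for pt x y, continuous f}.
    by apply: cf; split => //=; case: hx => ->; rewrite ?m22 ?p22//;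
      [apply: Or41|apply: Or42].
  exists r => // t ty; apply: Hr.
  have -> : pt x t - pt x y = 'i * (t - y)%:C by rewrite !ptE rmorphB/=; ring.
  by rewrite nrmM nrm_real /nrm normCi mul1r.
have [M1 h1] := H (-1) (or_introl erefl); have [M2 h2] := H 1 (or_intror erefl).
have [M3 h3] := V (-1) (or_introl erefl); have [M4 h4] := V 1 (or_intror erefl).
exists (`|M1| + `|M2| + `|M3| + `|M4| + 1).
  by rewrite ltr_wpDl// !addr_ge0.
move=> z [zx zy]; rewrite -[z]pt_Re_Im /=.
have a1 := ler_norm M1; have a2 := ler_norm M2; have a3 := ler_norm M3; have a4 := ler_norm M4.
have b1 := normr_ge0 M1; have b2 := normr_ge0 M2; have b3 := normr_ge0 M3; have b4 := normr_ge0 M4.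
move=> [] -> ; [have := h3 _ zy|have := h4 _ zy|have := h1 _ zx|have := h2 _ zx];
  clear - a1 a2 a3 a4 b1 b2 b3 b4; lra.
Qed.

Lemma grid_integral_bound f (M : R) : gridc f -> (forall z, ongrid z -> nrm (f z) <= M) ->
  nrm (JQ f) <= 16 * M.
Proof.
move=> cf fM; have := @box_integral_bound _ f (-1) 1 (-1) 1 M unit_box cf.
have -> : 4 * M * (1 - -1 + (1 - -1)) = 16 * M by ring.
apply => x y /andP[x1 x2] /andP[y1 y2] s; apply: fM; split => //=.
  by clear - x1 x2; lra.
by clear - y1 y2; lra.
Qed.

Lemma box_integral_eq f g : gridc f -> (forall z, ongrid z -> f z = g z) ->
  JQ f = JQ g.
Proof.
move=> cf fg; have [F1 [F2 [F3 [F4 Ff]]]] := grid_sides unit_box cf.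
rewrite (box_integralE unit_box Ff).
have m22 : -2 <= (-1 : R) <= 2 by lra.
have p22 : -2 <= (1 : R) <= 2 by lra.
case: Ff => f1 f2 f3 f4.
have Gg : box_sides g (-1) 1 (-1) 1 F1 F2 F3 F4.
  split=> x x2; have x22 : -2 <= x <= 2 by clear - x2; lra.
  - by rewrite -fg; [exact: f1|split => //; apply: Or43].
  - by rewrite -fg; [exact: f2|split => //; apply: Or42].
  - by rewrite -fg; [exact: f3|split => //; apply: Or44].
  - by rewrite -fg; [exact: f4|split => //; apply: Or41].
by rewrite (box_integralE unit_box Gg).
Qed.

Lemma gridcD f g : gridc f -> gridc g -> gridc (fun z => f z + g z).
Proof. by move=> cf cg z Hz; apply: continuousC_D; [exact: cf|exact: cg]. Qed.

Lemma gridcM f g : gridc f -> gridc g -> gridc (fun z => f z * g z).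
Proof. by move=> cf cg z Hz; apply: continuousC_M; [exact: cf|exact: cg]. Qed.

Lemma gridcV f : gridc f -> (forall z, ongrid z -> f z != 0) -> gridc (fun z => (f z)^-1).
Proof. by move=> cf f0 z Hz; apply: continuousC_V; [exact: f0|exact: cf]. Qed.

Lemma gridc_cst (a : C) : gridc (fun _ : C => a).
Proof. by move=> z _; exact: continuousC_cst. Qed.

Lemma gridc_id : gridc (fun z : C => z).
Proof. by move=> z _; exact: continuousC_id. Qed.

Lemma JQ_lin (k : C) f g : gridc f -> gridc g ->
  JQ (fun z => k * f z + g z) = k * JQ f + JQ g.
Proof. exact: box_integral_lin unit_box. Qed.

Lemma JQ_scale (k : C) f : gridc f -> JQ (fun z => k * f z) = k * JQ f.
Proof.
move=> cf; have c0 := @gridc_cst 0.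
have J0 : JQ (fun _ : C => 0 : C) = 0.
  by apply: (box_integral_primitive (F := fun=> 0)) unit_box _ => z _; exact: is_derive1_cst.
have := JQ_lin k cf c0; rewrite J0 addr0 => <-.
have -> : (fun z => k * f z + 0) = (fun z => k * f z) by apply/funext => z; rewrite addr0.
reflexivity.
Qed.

(** Differentiation under the integral sign: the error is quadratic in w - w0 uniformly on the
    contour, and integration costs a factor 16 at most. *)
Lemma param_derivative (phi : C -> C -> C) (dphi : C -> C) (w0 : C) (r M : R) : 0 < r ->
  (forall w, nrm (w - w0) < r -> gridc (phi w)) -> gridc dphi ->
  (forall w z, nrm (w - w0) < r -> ongrid z ->
     nrm (phi w z - phi w0 z - (w - w0) * dphi z) <= M * nrm (w - w0) ^+ 2) ->
  is_derive w0 1 (fun w => JQ (phi w)) (JQ dphi).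
Proof.
move=> r0 cphi cd H; apply/is_deriveCP => e e0.
have M1 : 0 < 16 * (`|M| + 1) by rewrite mulr_gt0// ltr_wpDl.
exists (Num.min r (e / (16 * (`|M| + 1)))); first by rewrite lt_min r0 divr_gt0.
move=> w; rewrite lt_min => /andP[wr we].
have cw0 : gridc (phi w0) by apply: cphi; rewrite subrr nrm0.
have cw := cphi _ wr.
have E : JQ (fun z => -1 * phi w0 z + (- (w - w0) * dphi z + phi w z)) =
    JQ (phi w) - JQ (phi w0) - JQ dphi * (w - w0).
  have c1 : gridc (fun z => - (w - w0) * dphi z + phi w z).
    exact: gridcD (gridcM (@gridc_cst (- (w - w0))) cd) cw.
  by rewrite (JQ_lin (-1) cw0 c1) (JQ_lin (- (w - w0)) cd cw); ring.
rewrite -E; apply: le_trans (@grid_integral_bound _ (M * nrm (w - w0) ^+ 2) _ _) _.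
- exact: gridcD (gridcM (@gridc_cst (-1)) cw0)
    (gridcD (gridcM (@gridc_cst (- (w - w0))) cd) cw).
- move=> z Hz.
  have -> : -1 * phi w0 z + (- (w - w0) * dphi z + phi w z) =
    phi w z - phi w0 z - (w - w0) * dphi z by ring.
  exact: H.
rewrite expr2 !mulrA ler_wpM2r ?nrm_ge0//.
apply: le_trans (_ : 16 * (`|M| + 1) * nrm (w - w0) <= _).
  by rewrite ler_wpM2r ?nrm_ge0// ler_wpM2l// ler_wpDr// ler_norm.
by rewrite mulrC -ler_pdivlMr// ltW.
Qed.

Lemma sub_nrm_ge (a h : C) (d : R) : d + d <= nrm a -> nrm h < d -> d <= nrm (a - h).
Proof. move=> da hd; apply: le_trans (nrmB_ge _ _); clear - da hd; lra. Qed.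

Lemma ge_neq0 (a : C) (d : R) : 0 < d -> d <= nrm a -> a != 0.
Proof. by move=> d0 da; rewrite -nrm_gt0 (lt_le_trans d0). Qed.

Lemma nrm_div_le (c a : C) (M m : R) : nrm c <= M -> 0 < m -> m <= nrm a ->
  nrm (c / a) <= M / m.
Proof.
move=> cM m0 ma; rewrite nrmM nrmV.
apply: ler_pM => //; rewrite ?nrm_ge0 ?invr_ge0 ?nrm_ge0//.
by rewrite lef_pV2 ?posrE// (lt_le_trans m0).
Qed.

(** With u = id this differentiates Cauchy's formula; with a general u it serves the counting of the
    solutions of u = w. The margin 2 d at w0 leaves d for all w within d of it. *)
Lemma cauchy_kernel_derivative (c u : C -> C) (w0 : C) (d : R) : 0 < d ->
  gridc c -> gridc u -> (forall z, ongrid z -> d + d <= nrm (u z - w0)) ->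
  is_derive w0 1 (fun w => JQ (fun z => c z / (u z - w)))
    (JQ (fun z => c z / (u z - w0) ^+ 2)).
Proof.
move=> d0 cc cu ud; have [M M0 cM] := grid_bounded cc.
have ud1 z : ongrid z -> d <= nrm (u z - w0).
  by move=> /ud; apply: le_trans; rewrite lerDl ltW.
have ud2 w z : nrm (w - w0) < d -> ongrid z -> d <= nrm (u z - w).
  move=> wd /ud uz; have -> : u z - w = (u z - w0) - (w - w0) by ring.
  exact: sub_nrm_ge.
have cuw w : gridc (fun z => u z - w) by exact: gridcD cu (@gridc_cst (- w)).
apply: (@param_derivative _ _ _ d (M / d ^+ 3)).
- exact: d0.
- move=> w wd; apply: (gridcM cc); apply: (gridcV (cuw w)) => z Hz.
  exact: ge_neq0 d0 (ud2 _ _ wd Hz).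
- apply: (gridcM cc); apply: (gridcV (gridcM (cuw w0) (cuw w0))).
  by move=> z Hz; rewrite !mulf_neq0// (ge_neq0 d0)// ud1.
move=> w z wd Hz; have a0 := ge_neq0 d0 (ud1 _ Hz); have b0 := ge_neq0 d0 (ud2 _ _ wd Hz).
have -> : c z / (u z - w) - c z / (u z - w0) - (w - w0) * (c z / (u z - w0) ^+ 2) =
    c z / ((u z - w0) ^+ 2 * (u z - w)) * (w - w0) ^+ 2.
  by field; rewrite a0 b0.
rewrite nrmM nrmX ler_wpM2r ?exprn_ge0 ?nrm_ge0//.
apply: nrm_div_le; rewrite ?exprn_gt0//; first exact: cM.
rewrite nrmM nrmX exprSr; apply: ler_pM; rewrite ?exprn_ge0 ?(ltW d0)//; last exact: ud2.
by rewrite ler_pXn2r ?nnegrE ?nrm_ge0 ?(ltW d0)// ud1.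
Qed.

Lemma cauchy_kernel_derivative2 (c u : C -> C) (w0 : C) (d : R) : 0 < d ->
  gridc c -> gridc u -> (forall z, ongrid z -> d + d <= nrm (u z - w0)) ->
  is_derive w0 1 (fun w => JQ (fun z => c z / (u z - w) ^+ 2))
    (JQ (fun z => 2 * c z / (u z - w0) ^+ 3)).
Proof.
move=> d0 cc cu ud; have [M M0 cM] := grid_bounded cc.
have ud1 z : ongrid z -> d <= nrm (u z - w0).
  by move=> /ud; apply: le_trans; rewrite lerDl ltW.
have ud2 w z : nrm (w - w0) < d -> ongrid z -> d <= nrm (u z - w).
  move=> wd /ud uz; have -> : u z - w = (u z - w0) - (w - w0) by ring.
  exact: sub_nrm_ge.
have cuw w : gridc (fun z => u z - w) by exact: gridcD cu (@gridc_cst (- w)).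
apply: (@param_derivative _ _ _ d (M / d ^+ 4 + 2 * (M / d ^+ 4))).
- exact: d0.
- move=> w wd; apply: (gridcM cc); apply: (gridcV (gridcM (cuw w) (cuw w))).
  by move=> z Hz; rewrite !mulf_neq0// (ge_neq0 d0)// ud2.
- apply: (gridcM (gridcM (@gridc_cst 2) cc)).
  apply: (gridcV (gridcM (cuw w0) (gridcM (cuw w0) (cuw w0)))).
  by move=> z Hz; rewrite !mulf_neq0// (ge_neq0 d0)// ud1.
move=> w z wd Hz; have a0 := ge_neq0 d0 (ud1 _ Hz); have b0 := ge_neq0 d0 (ud2 _ _ wd Hz).
have -> : c z / (u z - w) ^+ 2 - c z / (u z - w0) ^+ 2 - (w - w0) * (2 * c z / (u z - w0) ^+ 3) =
    (c z / ((u z - w0) ^+ 2 * (u z - w) ^+ 2) + 2 * (c z / ((u z - w0) ^+ 3 * (u z - w)))) * (w - w0) ^+ 2.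
  by field; rewrite a0 b0.
rewrite nrmM nrmX ler_wpM2r ?exprn_ge0 ?nrm_ge0//.
have n2 : nrm (2 : C) = 2.
  by apply: complexI; rewrite -nrmE normr_nat (rmorph_nat (real_complex R)).
have P (n : nat) (x : C) : d <= nrm x -> d ^+ n <= nrm x ^+ n.
  by move=> dx; rewrite lerXn2r// nnegrE ?nrm_ge0// ltW.
apply: le_trans (nrmD _ _) _; apply: lerD.
  apply: nrm_div_le; rewrite ?exprn_gt0//; first exact: cM.
  rewrite nrmM !nrmX -[4%N]/(2 + 2)%N exprD; apply: ler_pM; rewrite ?exprn_ge0 ?(ltW d0)//.
    by apply: P; exact: ud1.
  by apply: P; exact: ud2.
rewrite nrmM n2 ler_wpM2l//; apply: nrm_div_le; rewrite ?exprn_gt0//; first exact: cM.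
rewrite nrmM nrmX exprSr; apply: ler_pM; rewrite ?exprn_ge0 ?(ltW d0)//; last exact: ud2.
by apply: P; exact: ud1.
Qed.

Lemma derivable1D f g z : derivable f z 1 -> derivable g z 1 ->
  derivable (fun w => f w + g w) z 1.
Proof.
by move=> /is_derive1E df /is_derive1E dg; exact: is_derive1_derivable (is_derive1D df dg).
Qed.

Lemma derivable1B f g z : derivable f z 1 -> derivable g z 1 ->
  derivable (fun w => f w - g w) z 1.
Proof.
by move=> /is_derive1E df /is_derive1E dg; exact: is_derive1_derivable (is_derive1B df dg).
Qed.

Lemma derivable1M f g z : derivable f z 1 -> derivable g z 1 ->
  derivable (fun w => f w * g w) z 1.
Proof.
by move=> /is_derive1E df /is_derive1E dg; exact: is_derive1_derivable (is_derive1M df dg).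
Qed.

Lemma derivable1V f z : f z != 0 -> derivable f z 1 ->
  derivable (fun w => (f w)^-1) z 1.
Proof.
by move=> f0 /is_derive1E df; exact: is_derive1_derivable (is_derive1V f0 df).
Qed.

Lemma derivable1_cst (a z : C) : derivable (fun _ : C => a) z 1.
Proof. exact: is_derive1_derivable (is_derive1_cst a z). Qed.

Lemma derivable1_id z : derivable (fun w : C => w) z 1.
Proof. exact: is_derive1_derivable (is_derive1_id z). Qed.

Lemma derivable1_near f g z : (\forall w \near z, f w = g w) ->
  derivable f z 1 -> derivable g z 1.
Proof.
by move=> fg /is_derive1E df; exact: is_derive1_derivable (is_derive1_near fg df).
Qed.

Lemma near_neq z p : z != p -> \forall w \near z, w != p.
Proof.
move=> zp; apply/nearCP; exists (nrm (z - p)); first by rewrite nrm_gt0 subr_eq0.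
by move=> w; apply: contraTneq => ->; rewrite nrmBC ltxx.
Qed.

Lemma near_nrm_lt z p (r : R) : nrm (z - p) < r -> \forall w \near z, nrm (w - p) < r.
Proof.
move=> zr; apply/nearCP; exists (r - nrm (z - p)); first by rewrite subr_gt0.
move=> w wz; rewrite -(subrK z w) -addrA; apply: le_lt_trans (nrmD _ _) _.
by rewrite -ltrBrDr.
Qed.

(* The disc of radius 5 contains the square on which grid_continuous tests continuity. *)
Definition holomorphic5 f := forall z, nrm z < 5 -> derivable f z 1.

Lemma holomorphic5_square f z : holomorphic5 f -> -2 <= complex.Re z <= 2 ->
  -2 <= complex.Im z <= 2 -> derivable f z 1.
Proof.
by move=> hf zx zy; apply: hf; rewrite (le_lt_trans (grid_nrm_le4 zx zy))// ltr_nat.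
Qed.

Lemma holomorphic5_gridc f : holomorphic5 f -> gridc f.
Proof.
by move=> hf z [zx zy _]; exact: derivable1_continuous (holomorphic5_square hf zx zy).
Qed.

Lemma holomorphic5_is_derive f z : holomorphic5 f -> ongrid z ->
  is_derive z 1 f (derive1 f z).
Proof.
by move=> hf [zx zy _]; exact: is_derive1E (holomorphic5_square hf zx zy).
Qed.

(** Supplies the continuity at the exceptional point that [goursat_punctured] requires. *)
Lemma difference_quotient_continuous f p : derivable f p 1 ->
  {for p, continuous (fun z => if z == p then derive1 f p else (f z - f p) / (z - p))}.
Proof.
move=> /is_derive1E /is_deriveCP df; apply/continuousCP => e e0.
have e2 : 0 < e / 2 by rewrite divr_gt0.
have [r r0 Hr] := df _ e2; exists r => // z zr; rewrite eqxx.
have [_|zp] := eqVneq z p; first by rewrite subrr nrm0.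
have zp0 : z - p != 0 by rewrite subr_eq0.
have -> : (f z - f p) / (z - p) - derive1 f p =
  (f z - f p - derive1 f p * (z - p)) / (z - p) by field.
rewrite nrmM nrmV ltr_pdivrMr ?nrm_gt0//; apply: le_lt_trans (Hr _ zr) _.
by rewrite ltr_pM2r ?nrm_gt0// ltr_pdivrMr// ltr_pMr// ltr1n.
Qed.

Lemma third_lt1 (w : C) : nrm w < 3^-1 ->
  [/\ -1 < complex.Re w < 1, -1 < complex.Im w < 1 & nrm w < 5].
Proof.
move=> w3; have := Re_le_nrm w; have := Im_le_nrm w; rewrite !ler_norml.
by move=> /andP[i1 i2] /andP[r1 r2]; split; lra.
Qed.

(** Origin of the radius 1/3: |z - w| >= 1 - 1/3 = d + d for d = 1/3, which is the margin of the
    kernel lemmas. *)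
Lemma grid_sub_ge (w z : C) : nrm w < 3^-1 -> ongrid z ->
  (3^-1 + 3^-1 : R) <= nrm (z - w).
Proof.
move=> w3 /grid_nrm_ge1 z1; apply: le_trans (nrmB_ge _ _); lra.
Qed.

Lemma grid_sub_neq0 (w z : C) : nrm w < 3^-1 -> ongrid z -> z - w != 0.
Proof.
by move=> w3 /(grid_sub_ge w3); apply: ge_neq0; rewrite addr_gt0// invr_gt0.
Qed.

Lemma gridc_sub (w : C) : gridc (fun z => z - w).
Proof. exact: gridcD gridc_id (@gridc_cst (- w)). Qed.

Lemma gridc_sub_inv (w : C) : nrm w < 3^-1 -> gridc (fun z => (z - w)^-1).
Proof. by move=> w3; apply: (gridcV (@gridc_sub w)) => z; exact: grid_sub_neq0. Qed.

(** Up to normalisation the integral counts the solutions of u = w. Its derivative in w is the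
    integral of u' / (u - w)^2, which has the primitive -1 / (u - w) and so vanishes. *)
Lemma log_derivative_constant u (du : C -> C) (d : R) : 0 < d -> gridc du ->
  (forall z, ongrid z -> is_derive z 1 u (du z)) ->
  (forall z, ongrid z -> d + d + d <= nrm (u z)) ->
  forall w, nrm w < d -> JQ (fun z => du z / (u z - w)) = JQ (fun z => du z / u z).
Proof.
move=> d0 cdu hu ud w wd.
have cu : gridc u by move=> z Hz; exact: is_derive1_continuous (hu _ Hz).
have ge w0 z : nrm w0 < d -> ongrid z -> d + d <= nrm (u z - w0).
  by move=> w0d /ud uz; apply: le_trans (nrmB_ge _ _); clear - w0d uz; lra.
have -> : (fun z => du z / u z) = (fun z => du z / (u z - 0)).
  by apply/funext => z; rewrite subr0.
apply: (@derive0_constant (fun w => JQ (fun z => du z / (u z - w))) 0 d);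
  last by rewrite subr0.
move=> w0; rewrite subr0 => w0d.
have := cauchy_kernel_derivative d0 cdu cu (fun z => ge w0 z w0d).
have -> // : JQ (fun z => du z / (u z - w0) ^+ 2) = 0.
apply: (box_integral_primitive (F := fun z => - (u z - w0)^-1)) unit_box _ => z Hz.
have nz : u z - w0 != 0.
  by apply: (ge_neq0 _ (ge _ _ w0d Hz)); rewrite addr_gt0.
have D := is_derive1B (hu z Hz) (is_derive1_cst w0 z).
rewrite subr0 in D.
have := is_derive1N (is_derive1V (f := fun z => u z - w0) nz D).
by rewrite mulNr opprK.
Qed.

Lemma kernel_constant w : nrm w < 3^-1 ->
  JQ (fun z => (z - w)^-1) = JQ (fun z => z^-1).
Proof.
move=> w3; have := @log_derivative_constant (fun z => z) (fun=> 1) 3^-1.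
have E1 : (fun z : C => 1 / (z - w)) = (fun z => (z - w)^-1).
  by apply/funext => z; rewrite mul1r.
have E2 : (fun z : C => 1 / z) = (fun z => z^-1).
  by apply/funext => z; rewrite mul1r.
move=> H; rewrite -E1 -E2; apply: H => //.
- exact: gridc_cst.
by move=> z /grid_nrm_ge1; lra.
Qed.

Lemma goursat_unit f : holomorphic5 f -> JQ f = 0.
Proof.
move=> hf; apply: goursat unit_box _ _.
  by move=> z zx zy; exact: derivable1_continuous (holomorphic5_square hf zx zy).
move=> z zx zy; exists (derive1 f z); apply/is_derive1E/(holomorphic5_square hf).
  by clear - zx; lra.
by clear - zy; lra.
Qed.

(** The difference quotient of [f] at w, completed by the derivative, has integral zero; splitting
    it leaves f w times the integral of 1 / (z - w), which equals that of 1 / z. *)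
Lemma cauchy_formula f w : holomorphic5 f -> nrm w < 3^-1 ->
  f w = (JQ (fun z => z^-1))^-1 * JQ (fun z => f z / (z - w)).
Proof.
move=> hf w3; have [wx wy w5] := third_lt1 w3.
pose g z := if z == w then derive1 f w else (f z - f w) / (z - w).
have dg z : z != w -> nrm z < 5 -> derivable g z 1.
  move=> zw z5; apply: (@derivable1_near (fun z => (f z - f w) / (z - w))).
    have := near_neq zw; apply: filterS => v vw.
    by rewrite /g (negbTE vw).
  apply: derivable1M.
    by apply: derivable1B; [exact: hf|exact: derivable1_cst].
  apply: derivable1V; first by rewrite subr_eq0.
  by apply: derivable1B; [exact: derivable1_id|exact: derivable1_cst].
have J0 : JQ g = 0.
  apply: (goursat_punctured unit_box wx wy).
    move=> z zx zy; have z5 : nrm z < 5.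
      by rewrite (le_lt_trans (grid_nrm_le4 zx zy))// ltr_nat.
    have [->|zw] := eqVneq z w; last exact: derivable1_continuous (dg z zw z5).
    by apply: difference_quotient_continuous; exact: hf.
  move=> z zw zx zy; exists (derive1 g z); apply/is_derive1E/dg => //.
  apply: le_lt_trans (grid_nrm_le4 _ _) _; rewrite ?ltr_nat//.
    by clear - zx; lra.
  by clear - zy; lra.
have ci := gridc_sub_inv w3.
have cf := holomorphic5_gridc hf.
have cg : gridc (fun z => (f z - f w) * (z - w)^-1).
  exact: gridcM (gridcD cf (@gridc_cst (- f w))) ci.
have E : JQ (fun z => f w * (z - w)^-1 + (f z - f w) * (z - w)^-1) =
    f w * JQ (fun z => (z - w)^-1) + 0.
  rewrite JQ_lin//; congr (_ + _); rewrite -J0; apply: box_integral_eq => // z Hz.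
  rewrite /g; have := grid_sub_neq0 w3 Hz; rewrite subr_eq0 => /negbTE ->.
  by [].
have -> : (fun z => f z / (z - w)) =
    (fun z => f w * (z - w)^-1 + (f z - f w) * (z - w)^-1).
  by apply/funext => z; ring.
rewrite E addr0 kernel_constant// mulrCA mulVf ?mulr1//.
exact: box_integral_inv_neq0.
Qed.

Lemma holomorphic5_derive f w : holomorphic5 f -> nrm w < 3^-1 ->
  derivable (derive1 f) w 1.
Proof.
move=> hf w3; pose I := (JQ (fun z => z^-1))^-1.
have cf := holomorphic5_gridc hf.
have d3 : 0 < (3^-1 : R) by rewrite invr_gt0.
have d1 v : nrm v < 3^-1 ->
    is_derive v 1 f (I * JQ (fun z => f z / (z - v) ^+ 2)).
  move=> v3; have K := cauchy_kernel_derivative d3 cf gridc_id (fun z => @grid_sub_ge v z v3).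
  have := is_derive1Z I K; apply: is_derive1_near.
  have := @near_nrm_lt v 0 3^-1; rewrite subr0 => /(_ v3); apply: filterS => x.
  by rewrite subr0 => x3; rewrite [RHS](cauchy_formula hf x3).
have K := cauchy_kernel_derivative2 d3 cf gridc_id (fun z => @grid_sub_ge w z w3).
apply: is_derive1_derivable; apply: is_derive1_near (is_derive1Z I K).
have := @near_nrm_lt w 0 3^-1; rewrite subr0 => /(_ w3); apply: filterS => x.
by rewrite subr0 => /d1/is_derive1_val ->.
Qed.

Lemma nrm_real_pos (r : R) : 0 <= r -> nrm (r%:C : C) = r.
Proof. by move=> r0; rewrite nrm_real ger0_norm. Qed.

(** Carries what is proved on the fixed disc of radius 5 to a disc of any radius r about any
    point. *)
Lemma rescale_holomorphic5 f z (r : R) : 0 < r ->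
  (forall w, nrm (w - z) < r -> derivable f w 1) ->
  let rho : C := (r / 5)%:C in [/\ rho != 0,
    (forall w, nrm w < 5 -> nrm (z + w * rho - z) < r),
    holomorphic5 (fun w => f (z + w * rho)) &
    forall w, nrm w < 5 ->
      derive1 (fun w => f (z + w * rho)) w = derive1 f (z + w * rho) * rho].
Proof.
move=> r0 hf rho.
have r5 : 0 < r / 5 by rewrite divr_gt0.
have rho0 : rho != 0 by rewrite -nrm_gt0 nrm_real_pos// ltW.
have S w : nrm w < 5 -> nrm (z + w * rho - z) < r.
  move=> w5; rewrite addrAC subrr add0r nrmM nrm_real_pos ?ltW//.
  by rewrite -ltr_pdivlMr// invf_div mulrCA divff ?mulr1// gt_eqF.
have D w : nrm w < 5 -> is_derive w 1 (fun w => f (z + w * rho)) (derive1 f (z + w * rho) * rho).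
  move=> /S ws; exact (@is_derive1_compose _ (fun w : C => z + w * rho) f _ _ _
    (is_derive1_affine z rho w) (is_derive1E (hf _ ws))).
split=> // w w5; first exact: is_derive1_derivable (D w w5).
exact: is_derive1_val (D w w5).
Qed.

Lemma derivable_derive1 f z (r : R) : 0 < r ->
  (forall w, nrm (w - z) < r -> derivable f w 1) -> derivable (derive1 f) z 1.
Proof.
move=> r0 hf; have [rho0 S hF dF] := rescale_holomorphic5 r0 hf.
move: rho0 S hF dF; set rho : C := (_)%:C => rho0 S hF dF.
have z3 : nrm (0 : C) < 3^-1 by rewrite nrm0 invr_gt0.
have D := is_derive1E (holomorphic5_derive hF z3).
have A : is_derive z 1 (fun v => (v - z) * rho^-1) (rho^-1).
  have H := is_derive1_affine (- z * rho^-1) rho^-1 z.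
  by apply: is_derive1_near H; near=> v; ring.
have A0 : (z - z) * rho^-1 = 0 by rewrite subrr mul0r.
rewrite -A0 in D.
have := is_derive1Z rho^-1 (@is_derive1_compose _ (fun v : C => (v - z) / rho) _ _ _ _ A D).
move=> /is_derive1_derivable; apply: derivable1_near.
have zr : nrm (z - z) < r by rewrite subrr nrm0.
have := near_nrm_lt zr; apply: filterS => v vr.
have E : z + (v - z) / rho * rho = v by rewrite divfK// subrKC.
rewrite dF; last first.
  rewrite nrmM nrmV -[rho]/((r / 5)%:C) nrm_real_pos; last by rewrite divr_ge0 ?ltW.
  by rewrite ltr_pdivrMr ?divr_gt0// mulrCA divff ?mulr1.
by rewrite E mulrCA mulVf ?mulr1.
Unshelve. all: by end_near. Qed.

Lemma holomorphic_near_nrm f z : holomorphic_near f z <->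
  exists2 r : R, 0 < r & forall w, nrm (w - z) < r -> derivable f w 1.
Proof. exact: nearCP. Qed.

Lemma holomorphic_near_derive f z : holomorphic_near f z ->
  holomorphic_near (derive1 f) z.
Proof.
move=> /holomorphic_near_nrm[r r0 Hr]; apply/holomorphic_near_nrm.
exists r; first exact: r0.
move=> w wr; apply: (@derivable_derive1 f w (r - nrm (w - z))).
  by rewrite subr_gt0.
move=> v vw; apply: Hr; rewrite -(subrK w v) -addrA.
by apply: le_lt_trans (nrmD _ _) _; rewrite -ltrBrDr.
Qed.

Lemma holomorphic5_derive1 f : holomorphic5 f -> holomorphic5 (derive1 f).
Proof.
move=> hf z z5; apply: (@derivable_derive1 f z (5 - nrm z)); first by rewrite subr_gt0.
move=> w wz; apply: hf; rewrite -(subrK z w).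
by apply: le_lt_trans (nrmD _ _) _; rewrite -ltrBrDr.
Qed.

Lemma third_gt0 : 0 < (3^-1 : R). Proof. by rewrite invr_gt0. Qed.

(** Only derivability of the quotient at p is in question. Near p the quotient equals the Cauchy
    integral [G] of f(z) / (z - p), by partial fractions and f p = 0, and [G] is derivable. *)
Lemma holomorphic5_divide f p : holomorphic5 f -> nrm p < 3^-1 -> f p = 0 ->
  exists2 g : C -> C, holomorphic5 g & forall z, f z = (z - p) * g z.
Proof.
move=> hf p3 fp0; pose I := (JQ (fun z => z^-1))^-1.
have cf := holomorphic5_gridc hf.
have cfp : gridc (fun z => f z / (z - p)) := gridcM cf (gridc_sub_inv p3).
pose G w := I * JQ (fun z => f z / (z - p) / (z - w)).
pose g z := if z == p then G p else f z / (z - p).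
have fE z : f z = (z - p) * g z.
  rewrite /g; have [->|zp] := eqVneq z p; first by rewrite fp0 subrr mul0r.
  by rewrite mulrCA divff ?mulr1// subr_eq0.
have gG w : nrm w < 3^-1 -> g w = G w.
  rewrite /g; have [->//|wp] := eqVneq w p => w3.
  have wp0 : w - p != 0 by rewrite subr_eq0.
  have ciw := gridc_sub_inv w3.
  have E : (w - p) * JQ (fun z => f z / (z - p) / (z - w)) =
      JQ (fun z => f z / (z - w)) - JQ (fun z => f z / (z - p)).
    have -> : JQ (fun z => f z / (z - w)) - JQ (fun z => f z / (z - p)) =
        -1 * JQ (fun z => f z / (z - p)) + JQ (fun z => f z / (z - w)) by ring.
    have c2 : gridc (fun z => f z / (z - p) / (z - w)) := gridcM cfp ciw.
    rewrite -(JQ_lin (-1) cfp (gridcM cf ciw)) -(JQ_scale (w - p) c2).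
    apply: box_integral_eq.
      exact: gridcM (@gridc_cst (w - p)) c2.
    move=> z Hz; field.
    by rewrite (grid_sub_neq0 w3 Hz) (grid_sub_neq0 p3 Hz).
  rewrite /G (cauchy_formula hf w3) -[LHS]subr0 -[0](mul0r (w - p)^-1) -fp0.
  rewrite (cauchy_formula hf p3) -mulrBl -mulrBr -E /I.
  by field; rewrite wp0 box_integral_inv_neq0.
exists g; last exact: fE.
move=> z z5; have [->|zp] := eqVneq z p.
  have K := cauchy_kernel_derivative third_gt0 cfp gridc_id (fun z => @grid_sub_ge p z p3).
  apply: is_derive1_derivable; apply: is_derive1_near (is_derive1Z I K).
  have := @near_nrm_lt p 0 3^-1; rewrite subr0 => /(_ p3); apply: filterS => x.
  by rewrite subr0 => /gG ->.
apply: (@derivable1_near (fun z => f z / (z - p))).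
  have := near_neq zp; apply: filterS => v vp.
  by rewrite /g (negbTE vp).
apply: derivable1M; first exact: hf.
apply: derivable1V; first by rewrite subr_eq0.
by apply: derivable1B; [exact: derivable1_id|exact: derivable1_cst].
Qed.

(** The constant is the same for all functions; [holomorphic5_order] applies it to an infinite
    sequence of quotients. *)
Lemma cauchy_bound : exists2 B : R, 0 <= B & forall f (M : R), holomorphic5 f ->
  (forall z, ongrid z -> nrm (f z) <= M) -> forall w, nrm w < 3^-1 -> nrm (f w) <= B * M.
Proof.
pose I := (JQ (fun z => z^-1))^-1.
exists (nrm I * (16 / (3^-1 + 3^-1))).
  by rewrite mulr_ge0 ?nrm_ge0// divr_ge0// addr_ge0 ?(ltW third_gt0).
move=> f M hf fM w w3; rewrite (cauchy_formula hf w3) nrmM -/I -!mulrA.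
apply: ler_wpM2l; first exact: nrm_ge0.
have d6 : 0 < (3^-1 + 3^-1 : R) by rewrite addr_gt0 ?third_gt0.
apply: le_trans (grid_integral_bound (M := M / (3^-1 + 3^-1)) _ _) _.
- exact: gridcM (holomorphic5_gridc hf) (gridc_sub_inv w3).
- move=> z Hz; apply: nrm_div_le => //; first exact: fM.
  exact: grid_sub_ge.
by rewrite [_^-1 * M]mulrC.
Qed.

(** Otherwise [f] is divisible by z ^ k for every k. On the contour |z| >= 1, so every quotient is
    bounded there by the bound [M] of [f], and |f q| <= 4 ^ -k B M at q = 1/4 forces f q = 0. *)
Lemma holomorphic5_order f : holomorphic5 f ->
  (forall z, nrm z < 5 -> z != 0 -> f z != 0) ->
  exists k, exists2 g : C -> C, holomorphic5 g &
    g 0 != 0 /\ forall z, f z = z ^+ k * g z.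
Proof.
move=> hf f0; apply: contrapT => N.
have n03 : nrm (0 : C) < 3^-1 by rewrite nrm0 third_gt0.
have all k : exists2 g : C -> C, holomorphic5 g & forall z, f z = z ^+ k * g z.
  elim: k => [|k [g hg fE]]; first by exists f => // z; rewrite expr0 mul1r.
  have g0 : g 0 = 0.
    by apply: contrapT => /eqP g0; apply: N; exists k; exists g.
  have [g1 hg1 gE] := holomorphic5_divide hg n03 g0.
  by exists g1 => // z; rewrite fE gE subr0 exprSr mulrA.
have [B B0 HB] := cauchy_bound.
have [M M0 fM] := grid_bounded (holomorphic5_gridc hf).
pose q : C := (4^-1 : R)%:C.
have q4 : nrm q = 4^-1 by rewrite nrm_real_pos// invr_ge0.
have q0 : q != 0 by rewrite -nrm_gt0 q4 invr_gt0.
have q3 : nrm q < 3^-1 by rewrite q4 ltf_pV2 ?posrE// ltr_nat.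
have q5 : nrm q < 5 by rewrite (lt_trans q3)//; lra.
have fq : 0 < nrm (f q) by rewrite nrm_gt0 f0.
(* Powers of 2 are enough, since |q| * 2 <= 1. *)
have [k Hk] := exists_expn2_lt (B * M) fq.
have [g hg fE] := all k.
have gM z : ongrid z -> nrm (g z) <= M.
  move=> Hz; apply: le_trans (fM z Hz); rewrite fE nrmM nrmX ler_peMl ?nrm_ge0//.
  by rewrite exprn_ege1// grid_nrm_ge1.
have := HB g M hg gM q q3; apply/negP; rewrite -ltNge.
move: Hk; rewrite ltr_pdivrMr ?exprn_gt0// => Hk; apply: lt_le_trans Hk _.
rewrite fE nrmM nrmX q4 mulrAC -exprMn ler_piMl ?nrm_ge0// exprn_ile1//.
by rewrite ler_pdivrMl// mulr1 ler_nat.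
Qed.

Lemma is_derive1X f n z a : is_derive z 1 f a ->
  is_derive z 1 (fun w => f w ^+ n.+1) (n.+1%:R * f z ^+ n * a).
Proof.
move=> fa; elim: n => [|n IH].
  by rewrite expr0 !mul1r; under eq_fun do rewrite expr1.
under eq_fun do rewrite exprS.
have D := is_derive1M fa IH.
have -> : n.+2%:R * f z ^+ n.+1 * a =
    f z * (n.+1%:R * f z ^+ n * a) + f z ^+ n.+1 * a.
  by rewrite [n.+2%:R]mulrS exprS; ring.
exact: D.
Qed.

(** f' / f = (k + 1) / (z - p) + g' / g, and the last term is holomorphic because [g] has no
    zeros. *)
Lemma log_derivative_power f g p k : holomorphic5 g -> nrm p < 3^-1 ->
  (forall z, nrm z < 5 -> g z != 0) -> (forall z, f z = (z - p) ^+ k.+1 * g z) ->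
  JQ (fun z => derive1 f z / f z) = k.+1%:R * JQ (fun z => z^-1).
Proof.
move=> hg p3 g0 fE.
have hq : holomorphic5 (fun z => derive1 g z / g z).
  move=> z z5; apply: derivable1M; first exact: holomorphic5_derive1.
  by apply: derivable1V; [exact: g0|exact: hg].
have ci := gridc_sub_inv p3.
have E z : ongrid z -> k.+1%:R * (z - p)^-1 + derive1 g z / g z = derive1 f z / f z.
  move=> Hz; have [zx zy _] := Hz.
  have z5 : nrm z < 5 by rewrite (le_lt_trans (grid_nrm_le4 zx zy))// ltr_nat.
  have zp := grid_sub_neq0 p3 Hz.
  have D : is_derive z 1 (fun w => w - p) 1.
    by have := is_derive1B (is_derive1_id z) (is_derive1_cst p z); rewrite subr0.
  have := is_derive1M (is_derive1X k D) (is_derive1E (hg _ z5)).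
  have -> : (fun w => (w - p) ^+ k.+1 * g w) = f by apply/funext => w; rewrite fE.
  move=> /is_derive1_val ->; rewrite fE exprS; field.
  by rewrite g0//= zp expf_neq0.
have c1 : gridc (fun z => k.+1%:R * (z - p)^-1 + derive1 g z / g z).
  exact: gridcD (gridcM (@gridc_cst k.+1%:R) ci) (holomorphic5_gridc hq).
rewrite -(box_integral_eq c1 E) (JQ_lin _ ci (holomorphic5_gridc hq)).
by rewrite (goursat_unit hq) addr0 kernel_constant.
Qed.

(** The value 0 is taken k + 1 times, at 0. A nearby value f p is taken once only: by injectivity p
    is its sole preimage, and f' p != 0. Both counts agree by [log_derivative_constant], so k = 0
    and f' 0 = g 0. *)
Lemma holomorphic5_injective f : holomorphic5 f -> f 0 = 0 ->
  (forall z w, nrm z < 5 -> nrm w < 5 -> f z = f w -> z = w) ->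
  derive1 f 0 != 0.
Proof.
move=> hf f00 finj.
have n05 : nrm (0 : C) < 5 by rewrite nrm0.
have n03 : nrm (0 : C) < 3^-1 by rewrite nrm0 third_gt0.
have f0 z : nrm z < 5 -> z != 0 -> f z != 0.
  by move=> z5; apply: contraNneq => fz; apply/eqP/finj => //; rewrite f00.
have [[|k] [g hg [g0 fE]]] := holomorphic5_order hf f0.
  by move: g0; rewrite -[g 0]mul1r -[1](expr0 0) -fE f00 eqxx.
have gnz z : nrm z < 5 -> g z != 0.
  move=> z5; have [->//|z0] := eqVneq z 0.
  by have := f0 z z5 z0; rewrite fE mulf_eq0 negb_or => /andP[].
have cf := holomorphic5_gridc hf.
have fgrid z : ongrid z -> f z != 0.
  move=> Hz; have [zx zy _] := Hz; apply: f0.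
    by rewrite (le_lt_trans (grid_nrm_le4 zx zy))// ltr_nat.
  by rewrite -nrm_gt0 (lt_le_trans _ (grid_nrm_ge1 Hz)).
have [M M0 fM] := grid_bounded (gridcV cf fgrid).
(* [M] bounds 1 / f on the contour, so |f| >= 1 / M = 3 d there, as [log_derivative_constant]
   wants. *)
pose d := (3 * M)^-1.
have d0 : 0 < d by rewrite invr_gt0 mulr_gt0.
have fd z : ongrid z -> d + d + d <= nrm (f z).
  move=> Hz; have -> : d + d + d = M^-1 by rewrite /d; field; rewrite gt_eqF.
  by rewrite -[nrm (f z)]invrK -nrmV lef_pV2 ?posrE ?fM// nrm_gt0 invr_neq0 ?fgrid.
(* f' = z ^ k h with h 0 = (k + 1) g 0 != 0, so f' p != 0 for all small p != 0. *)
pose h z := k.+1%:R * g z + z * derive1 g z.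
have dfE z : nrm z < 5 -> derive1 f z = z ^+ k * h z.
  move=> z5; have := is_derive1M (is_derive1X k (is_derive1_id z)) (is_derive1E (hg z z5)).
  have -> : (fun w => w ^+ k.+1 * g w) = f by apply/funext => w; rewrite fE.
  by move=> /is_derive1_val ->; rewrite /h exprS; ring.
have hh : holomorphic5 h.
  move=> z z5; apply: derivable1D; apply: derivable1M.
  - exact: derivable1_cst.
  - exact: hg.
  - exact: derivable1_id.
  - exact: holomorphic5_derive1.
have h0 : h 0 != 0 by rewrite /h mul0r addr0 mulf_neq0// pnatr_eq0.
have /continuousCP/(_ (nrm (h 0)))[|r1 r10 Hr1] := derivable1_continuous (hh 0 n05).
  by rewrite nrm_gt0.
have /continuousCP/(_ d d0)[r2 r20 Hr2] := derivable1_continuous (hf 0 n05).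
(* Within r of 0 one may divide at p, h is nonzero, and |f p| < d. *)
pose r := Num.min 3^-1 (Num.min r1 r2).
have r0 : 0 < r by rewrite !lt_min third_gt0 r10.
pose p : C := (r / 2)%:C.
have r20' : 0 < r / 2 by rewrite divr_gt0.
have pr : nrm p < r.
  by rewrite nrm_real_pos ?ltW// ltr_pdivrMr// ltr_pMr// ltr1n.
have p0 : p != 0 by rewrite -nrm_gt0 nrm_real_pos// ltW.
move: (pr); rewrite !lt_min => /and3P[p3 p1 p2].
have p5 : nrm p < 5 by rewrite (lt_trans p3)//; lra.
have hp : h p != 0.
  apply/eqP => hp0; have := Hr1 p; rewrite subr0 => /(_ p1).
  by rewrite hp0 sub0r nrmN ltxx.
have fpd : nrm (f p) < d.
  by have := Hr2 p; rewrite subr0 f00 subr0; apply.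
have hfp : holomorphic5 (fun z => f z - f p).
  by move=> z z5; apply: derivable1B; [exact: hf|exact: derivable1_cst].
have [g2 hg2 g2E] := holomorphic5_divide hfp p3 (subrr (f p)).
have dfp z : nrm z < 5 -> derive1 (fun z => f z - f p) z = derive1 f z.
  move=> z5; have := is_derive1B (is_derive1E (hf z z5)) (is_derive1_cst (f p) z).
  by rewrite subr0 => /is_derive1_val.
have g2nz z : nrm z < 5 -> g2 z != 0.
  move=> z5; have [->|zp] := eqVneq z p.
    have D : is_derive p 1 (fun w => w - p) 1.
      by have := is_derive1B (is_derive1_id p) (is_derive1_cst p p); rewrite subr0.
    have := is_derive1M D (is_derive1E (hg2 p p5)).
    have -> : (fun w => (w - p) * g2 w) = (fun w => f w - f p).
      by apply/funext => w; rewrite g2E.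
    rewrite subrr mul0r add0r mulr1 => /is_derive1_val <-.
    by rewrite dfp// dfE// mulf_neq0// expf_neq0.
  have : f z - f p != 0.
    by rewrite subr_eq0; apply: contraNneq zp => /finj ->.
  by rewrite g2E mulf_eq0 negb_or => /andP[].
have N1 : JQ (fun z => derive1 f z / (f z - f p)) = 1 * JQ (fun z => z^-1).
  have := @log_derivative_power (fun z => f z - f p) g2 p 0 hg2 p3 g2nz g2E.
  move=> <-; apply: box_integral_eq.
    apply: (gridcM (holomorphic5_gridc (holomorphic5_derive1 hf))).
    apply: gridcV; first exact: gridcD cf (@gridc_cst (- f p)).
    move=> z Hz; rewrite -nrm_gt0; apply: lt_le_trans (nrmB_ge _ _).
    by rewrite subr_gt0 (lt_le_trans fpd)// (le_trans _ (fd z Hz))// lerDr addr_ge0 ?ltW.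
  move=> z [zx zy _]; rewrite dfp//.
  by rewrite (le_lt_trans (grid_nrm_le4 zx zy))// ltr_nat.
have N2 := @log_derivative_power f g 0 k hg n03 gnz.
have cdf := holomorphic5_gridc (holomorphic5_derive1 hf).
have := log_derivative_constant d0 cdf (fun z => holomorphic5_is_derive hf) fd fpd.
rewrite N1 N2; last by move=> z; rewrite subr0 fE.
move=> /(mulIf box_integral_inv_neq0)/eqP.
rewrite eq_sym -[1]/(1%:R) eqr_nat => /eqP[k0].
by rewrite dfE// k0 expr0 mul1r /h mul0r addr0 mulf_neq0// pnatr_eq0.
Qed.

Lemma injective_derive_neq0 f z (r : R) : 0 < r ->
  (forall w, nrm (w - z) < r -> derivable f w 1) ->
  (forall v w, nrm (v - z) < r -> nrm (w - z) < r -> f v = f w -> v = w) ->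
  derive1 f z != 0.
Proof.
move=> r0 hf finj; have [rho0 S hF dF] := rescale_holomorphic5 r0 hf.
move: rho0 S hF dF; set rho : C := (_)%:C => rho0 S hF dF.
pose F (w : C) := f (z + w * rho) - f z.
have n05 : nrm (0 : C) < 5 by rewrite nrm0.
have z0 : z + 0 * rho = z by rewrite mul0r addr0.
have hF0 : holomorphic5 F.
  by move=> w w5; apply: derivable1B; [exact: hF|exact: derivable1_cst].
have := @holomorphic5_injective F hF0.
have -> : derive1 F 0 = derive1 f z * rho.
  have := is_derive1B (is_derive1E (hF 0 n05)) (is_derive1_cst (f z) 0).
  rewrite subr0 => /is_derive1_val E.
  by rewrite /F E (dF 0 n05) z0.
rewrite mulf_eq0 negb_or; move=> H; have /andP[//] : (derive1 f z != 0) && (rho != 0).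
apply: H; first by rewrite /F z0 subrr.
move=> v w v5 w5 /addIr /(finj _ _ (S v v5) (S w w5)) /addrI.
exact: mulIf.
Qed.

End Cauchy.

(** * Conjugation, local square roots, connectedness of discs *)

Section ComplexFunctions.
Context {R : realType}.
Local Notation C := (cplx R).
Local Open Scope complex_scope.
Implicit Types (f g : C -> C) (z w : C).

Lemma caratheodory f (phi : C -> C) z : {for z, continuous phi} ->
  (\forall w \near z, f w - f z = phi w * (w - z)) -> is_derive z 1 f (phi z).
Proof.
move=> /continuousCP cphi /nearCP[r0 r00 H0]; apply/is_deriveCP => e e0.
have [r r1 Hr] := cphi e e0; exists (Num.min r0 r); first by rewrite lt_min r00.
move=> w; rewrite lt_min => /andP[w0 w1].
by rewrite H0// -mulrBl nrmM ler_wpM2r ?nrm_ge0// ltW// Hr.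
Qed.

Lemma is_derive1_conj f z d : is_derive z 1 f d ->
  is_derive (Num.conj z) 1 (fun w => Num.conj (f (Num.conj w))) (Num.conj d).
Proof.
move=> /is_deriveCP df; apply/is_deriveCP => e e0.
have [r r0 Hr] := df e e0; exists r => // w wr.
have E : Num.conj w - z = Num.conj (w - Num.conj z) by rewrite rmorphB /= conjCK.
have := Hr (Num.conj w); rewrite E nrm_conj => /(_ wr).
rewrite conjCK; move: (w - Num.conj z) => u.
have -> : Num.conj (f (Num.conj w)) - Num.conj (f z) - Num.conj d * u =
    Num.conj (f (Num.conj w) - f z - d * Num.conj u).
  by rewrite !rmorphB rmorphM /= conjCK.
by rewrite nrm_conj.
Qed.

Lemma holomorphic_near_conj f z : holomorphic_near f (Num.conj z) ->
  holomorphic_near (fun w => Num.conj (f (Num.conj w))) z.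
Proof.
move=> /holomorphic_near_nrm[r r0 Hr]; apply/holomorphic_near_nrm.
exists r; first exact: r0.
move=> w wr; have dw : derivable f (Num.conj w) 1.
  by apply: Hr; rewrite -rmorphB nrm_conj.
by have := is_derive1_conj (is_derive1E dw); rewrite conjCK => /is_derive1_derivable.
Qed.

(** [sqrtC] need not be continuous, so at each point the root nearer to [m0] is taken. Then m w + m
    v stays away from 0 near z, and m w - m v = (f w - f v) / (m w + m v) gives continuity and then
    derivability. *)
Lemma local_sqrt f z : holomorphic_near f z -> f z != 0 ->
  exists2 m : C -> C, holomorphic_near m z & forall w, m w ^+ 2 = f w.
Proof.
move=> hf f0; pose m0 := sqrtC (f z).
pose m w := if nrm (sqrtC (f w) - m0) <= nrm (sqrtC (f w) + m0) then sqrtC (f w)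
            else - sqrtC (f w).
have mE w : m w ^+ 2 = f w by rewrite /m; case: ifP => _; rewrite ?sqrrN sqrtCK.
have m0E : m0 ^+ 2 = f z by rewrite sqrtCK.
have m00 : 0 < nrm m0.
  by rewrite nrm_gt0; apply: contraNneq f0 => m00; rewrite -m0E m00 expr0n.
have mle w : nrm (m w - m0) <= nrm (m w + m0).
  rewrite /m; case: ifP => // /negbT; rewrite -ltNge => /ltW.
  have -> : - sqrtC (f w) - m0 = - (sqrtC (f w) + m0) by ring.
  have -> : - sqrtC (f w) + m0 = - (sqrtC (f w) - m0) by ring.
  by rewrite !nrmN.
have mge w : nrm m0 <= nrm (m w + m0).
  have : nrm (m0 + m0) <= nrm (m w + m0) + nrm (m w - m0).
    have -> : m0 + m0 = (m w + m0) - (m w - m0) by ring.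
    exact: nrmB.
  rewrite -mulr2n -mulr_natl nrmM.
  have -> : nrm (2 : C) = 2.
    by apply: complexI; rewrite -nrmE normr_nat (rmorph_nat (real_complex R)).
  have := mle w; lra.
have /continuousCP cf : {for z, continuous f}.
  by apply: derivable1_continuous; exact: nbhs_singleton hf.
(* |m w - m0| |m w + m0| = |f w - f z|, and the second factor is at least |m0|, so the first one is
   below |m0| / 2. *)
have [r r0 Hr] := cf (nrm m0 * (nrm m0 / 2)) (mulr_gt0 m00 (divr_gt0 m00 (ltr0Sn R 1))).
have mclose w : nrm (w - z) < r -> nrm (m w - m0) < nrm m0 / 2.
  move=> /Hr; rewrite -mE -m0E subr_sqr nrmM => H.
  rewrite -(ltr_pM2l m00); apply: le_lt_trans H.
  by rewrite mulrC ler_wpM2l ?nrm_ge0.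
have msum w v : nrm (w - z) < r -> nrm (v - z) < r -> nrm m0 < nrm (m w + m v).
  move=> /mclose wr /mclose vr.
  have : nrm (m0 + m0) <= nrm (m w + m v) + (nrm (m w - m0) + nrm (m v - m0)).
    have -> : m0 + m0 = (m w + m v) - ((m w - m0) + (m v - m0)) by ring.
    by apply: le_trans (nrmB _ _) _; rewrite lerD2l nrmD.
  rewrite -mulr2n -mulr_natl nrmM.
  have -> : nrm (2 : C) = 2.
    by apply: complexI; rewrite -nrmE normr_nat (rmorph_nat (real_complex R)).
  lra.
have mcont w : nrm (w - z) < r -> derivable f w 1 -> {for w, continuous m}.
  move=> wr /derivable1_continuous/continuousCP cw; apply/continuousCP => e e0.
  have [r1 r10 Hr1] := cw (nrm m0 * e) (mulr_gt0 m00 e0).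
  exists (Num.min r1 (r - nrm (w - z))); first by rewrite lt_min r10 subr_gt0.
  move=> v; rewrite lt_min => /andP[v1 v2].
  have vr : nrm (v - z) < r.
    by rewrite -(subrK w v) -addrA (le_lt_trans (nrmD _ _))// -ltrBrDr.
  have := Hr1 _ v1; rewrite -!mE subr_sqr nrmM => H.
  rewrite -(ltr_pM2l m00); apply: le_lt_trans H.
  by rewrite mulrC ler_wpM2l ?nrm_ge0// ltW// msum.
have key (w : C) : nrm (w - z) < r -> derivable f w 1 -> derivable m w 1.
  move=> wr dw.
  pose phi (v : C) : C :=
    (if v == w then derive1 f w else (f v - f w) / (v - w)) / (m v + m w).
  have mw0 : m w + m w != 0 by rewrite -nrm_gt0 (lt_trans m00)// msum.
  have cphi : {for w, continuous phi}.
    apply: continuousC_M; first exact: difference_quotient_continuous.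
    apply: continuousC_V; first exact: mw0.
    by apply: continuousC_D; [exact: mcont|exact: continuousC_cst].
  apply: (is_derive1_derivable (D := phi w)); apply: (caratheodory cphi).
  have := near_nrm_lt wr; apply: filterS => v vr; rewrite /phi.
  have [->|vw] := eqVneq v w; first by rewrite !subrr mulr0.
  have mvw : m v + m w != 0 by rewrite -nrm_gt0 (lt_trans m00)// msum.
  have vw0 : v - w != 0 by rewrite subr_eq0.
  by rewrite -!mE subr_sqr; field; rewrite mvw.
exists m; last exact: mE.
have /holomorphic_near_nrm[r1 r10 Hr1] := hf.
apply/holomorphic_near_nrm; exists (Num.min r r1); first by rewrite lt_min r0.
by move=> w; rewrite lt_min => /andP[wr wr1]; apply: key => //; exact: Hr1.
Qed.

Lemma ball_connected z (r : R) : 0 < r -> connected [set w : C | nrm (w - z) < r].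
Proof.
move=> r0.
pose seg w := [set z + t%:C * (w - z) | t in `[0, 1]%classic : set R] : set C.
have -> : [set w : C | nrm (w - z) < r] = \bigcup_(w in [set w : C | nrm (w - z) < r]) seg w.
  apply/seteqP; split => [w wr|v [w wr [t t01 <-]]].
    exists w => //; exists 1; first by rewrite /= in_itv /= lexx ler01.
    by rewrite -[1%:C]/(1 : C) mul1r subrKC.
  move: t01; rewrite /= in_itv /= => /andP[t0 t1].
  rewrite addrAC subrr add0r nrmM nrm_real_pos//.
  by apply: le_lt_trans wr; rewrite ler_piMl ?nrm_ge0.
apply: bigcup_connected.
  exists z => w wr; exists 0; first by rewrite /= in_itv /= lexx ler01.
  by rewrite -[0%:C]/(0 : C) mul0r addr0.
move=> w wr; apply: connected_continuous_connected; first exact: segment_connected.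
apply: continuous_subspaceT => t A /nearCP[e e0 HA]; apply/nearRP.
have d0 : 0 < nrm (w - z) + 1 by rewrite ltr_wpDl ?nrm_ge0.
exists (e / (nrm (w - z) + 1)); first exact: divr_gt0.
move=> s st; apply: HA.
have -> : z + s%:C * (w - z) - (z + t%:C * (w - z)) = (s - t)%:C * (w - z).
  by rewrite rmorphB /=; ring.
rewrite nrmM nrm_real; move: st; rewrite ltr_pdivlMr// => st.
by apply: le_lt_trans st; rewrite ler_wpM2l// lerDl.
Qed.

End ComplexFunctions.

(** * Holomorphic functions on the surface *)

Section NearCombine.
Context {T : topologicalType} (x : T).
Implicit Types P Q S U : T -> Prop.

Lemma nearS2 P Q S : (\forall y \near x, P y) -> (\forall y \near x, Q y) ->
  (forall y, P y -> Q y -> S y) -> \forall y \near x, S y.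
Proof. by move=> HP HQ H; apply: filterS2 HP HQ. Qed.

Lemma nearS3 P Q S U : (\forall y \near x, P y) -> (\forall y \near x, Q y) ->
  (\forall y \near x, S y) ->
  (forall y, P y -> Q y -> S y -> U y) -> \forall y \near x, U y.
Proof. by move=> HP HQ HS H; apply: filterS3 HP HQ HS. Qed.

End NearCombine.

Section SurfaceFunctions.
Context {R : realType} {X : riemann_surface (cplx R)}.
Local Notation C := (cplx R).
Implicit Types (f g h : X -> C) (x y : X) (phi psi : @chart C X).

Lemma chart_near_dom phi x : atlas phi -> cdom phi x -> \forall y \near x, cdom phi y.
Proof. by move=> /rs_chart[od _ _ _ _] xd; exact: open_nbhs_nbhs. Qed.

Lemma chart_inv phi x : atlas phi -> cdom phi x -> cinv phi (cmap phi x) = x.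
Proof. by move=> /rs_chart[_ _ _ _ K] /K. Qed.

Lemma chart_near_image phi x : atlas phi -> cdom phi x ->
  \forall z \near cmap phi x, cdom phi (cinv phi z) /\ cmap phi (cinv phi z) = z.
Proof.
move=> aphi xd; have [_ oi _ _ K] := rs_chart aphi.
have : nbhs (cmap phi x) (cmap phi @` cdom phi).
  by apply: open_nbhs_nbhs; split => //; exists x.
by apply: filterS => _ [y yd <-]; rewrite K.
Qed.

Lemma chart_cmap_continuous phi x : atlas phi -> cdom phi x ->
  {for x, continuous (cmap phi)}.
Proof. by move=> /rs_chart[_ _ c _ _] /c. Qed.

Lemma chart_cinv_continuous phi x : atlas phi -> cdom phi x ->
  {for cmap phi x, continuous (cinv phi)}.
Proof. by move=> /rs_chart[_ _ _ c _] xd; apply: c; exists x. Qed.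

Lemma chart_near phi x (P : X -> Prop) : atlas phi -> cdom phi x ->
  (\forall y \near x, P y) <-> (\forall z \near cmap phi x, P (cinv phi z)).
Proof.
move=> aphi xd; split=> H.
  apply: (chart_cinv_continuous aphi xd).
  by rewrite chart_inv.
have H' : \forall y \near x, P (cinv phi (cmap phi y)).
  exact: chart_cmap_continuous aphi xd _ H.
apply: (nearS2 H' (chart_near_dom aphi xd)) => y /= Py yd.
by rewrite -(chart_inv aphi yd).
Qed.

Lemma chart_transition phi psi x : atlas phi -> cdom phi x -> atlas psi -> cdom psi x ->
  derivable (cmap psi \o cinv phi : C -> C) (cmap phi x) 1.
Proof. by move=> aphi xphi apsi xpsi; apply: rs_compat => //; exists x. Qed.

Lemma exists_chart x : exists2 phi : @chart C X, atlas phi & cdom phi x.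
Proof. exact: rs_cover. Qed.

Lemma deriv_change phi psi x f d : atlas phi -> cdom phi x -> atlas psi -> cdom psi x ->
  is_derive (cmap phi x) 1 (f \o cinv phi : C -> C) d ->
  is_derive (cmap psi x) 1 (f \o cinv psi : C -> C)
    (d * chart_deriv psi (cmap phi) x).
Proof.
move=> aphi xphi apsi xpsi df.
have T := is_derive1E (chart_transition apsi xpsi aphi xphi).
have E : (cmap phi \o cinv psi) (cmap psi x) = cmap phi x.
  by rewrite /= chart_inv.
rewrite -E in df.
apply: is_derive1_near (is_derive1_compose T df).
have := proj1 (chart_near _ apsi xpsi) (chart_near_dom aphi xphi).
by apply: filterS => z zd /=; rewrite chart_inv.
Qed.

(** [hol_at] asks for all charts around x; one is enough because the coordinate changes are
    derivable at every point of the overlap. *)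
Lemma hol_at_chart phi x f : atlas phi -> cdom phi x ->
  hol_at x f <-> holomorphic_near (f \o cinv phi : C -> C) (cmap phi x).
Proof.
move=> aphi xphi; split=> [|H psi apsi xpsi]; first exact.
have H1 : \forall y \near x, derivable (f \o cinv phi : C -> C) (cmap phi y) 1.
  apply/(chart_near _ aphi xphi).
  apply: (nearS2 H (chart_near_image aphi xphi)) => z dz [_ ->].
  exact: dz.
have H2 : \forall y \near x, derivable (f \o cinv psi : C -> C) (cmap psi y) 1.
  apply: (nearS3 H1 (chart_near_dom aphi xphi) (chart_near_dom apsi xpsi)) => y dy yphi ypsi.
  exact: is_derive1_derivable (deriv_change aphi yphi apsi ypsi (is_derive1E dy)).
have := proj1 (chart_near _ apsi xpsi) H2.
move=> H3; apply: (nearS2 H3 (chart_near_image apsi xpsi)) => z dz [_ E].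
by rewrite E in dz.
Qed.

Lemma hol_at_near x f : hol_at x f -> \forall y \near x, hol_at y f.
Proof.
move=> hf; have [phi aphi xphi] := exists_chart x.
have /near_join H := hf phi aphi xphi.
apply/(chart_near _ aphi xphi).
apply: (nearS2 H (chart_near_image aphi xphi)) => z dz [zd zE].
by apply/(hol_at_chart f aphi zd); rewrite zE.
Qed.

Lemma hol_at_eq x f g : (\forall y \near x, f y = g y) -> hol_at x f -> hol_at x g.
Proof.
move=> fg hf; have [phi aphi xphi] := exists_chart x.
apply/(hol_at_chart g aphi xphi).
have /near_join H := proj1 (chart_near _ aphi xphi) fg.
apply: (nearS2 H (hf phi aphi xphi)) => z; exact: derivable1_near.
Qed.

Lemma hol_at_derivable x f phi : hol_at x f -> atlas phi -> cdom phi x ->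
  is_derive (cmap phi x) 1 (f \o cinv phi : C -> C) (chart_deriv phi f x).
Proof. move=> hf aphi xphi; apply: is_derive1E.
exact: nbhs_singleton (hf phi aphi xphi). Qed.

Lemma chart_deriv_val phi f x d :
  is_derive (cmap phi x) 1 (f \o cinv phi : C -> C) d -> chart_deriv phi f x = d.
Proof. by move=> /is_derive1_val. Qed.

Lemma chart_deriv_eq phi f g x : atlas phi -> cdom phi x ->
  (\forall y \near x, f y = g y) -> hol_at x f -> chart_deriv phi f x = chart_deriv phi g x.
Proof.
move=> aphi xphi fg hf; apply/esym/chart_deriv_val.
apply: is_derive1_near (hol_at_derivable hf aphi xphi).
exact: proj1 (chart_near _ aphi xphi) fg.
Qed.

Lemma hol_at_cst x (a : C) : hol_at x (fun=> a).
Proof. move=> phi _ _; apply/holomorphic_near_nrm; exists 1; first exact: ltr01.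
by move=> w _; exact: derivable1_cst. Qed.

Lemma hol_at_add x f g : hol_at x f -> hol_at x g -> hol_at x (fun y => f y + g y).
Proof.
by move=> hf hg phi aphi xphi; apply: (nearS2 (hf _ aphi xphi) (hg _ aphi xphi)) => z;
  exact: derivable1D.
Qed.

Lemma hol_at_sub x f g : hol_at x f -> hol_at x g -> hol_at x (fun y => f y - g y).
Proof.
by move=> hf hg phi aphi xphi; apply: (nearS2 (hf _ aphi xphi) (hg _ aphi xphi)) => z;
  exact: derivable1B.
Qed.

Lemma hol_at_mul x f g : hol_at x f -> hol_at x g -> hol_at x (fun y => f y * g y).
Proof.
by move=> hf hg phi aphi xphi; apply: (nearS2 (hf _ aphi xphi) (hg _ aphi xphi)) => z;
  exact: derivable1M.
Qed.

Lemma near_neq0C (f : C -> C) (z : C) : {for z, continuous f} -> f z != 0 ->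
  \forall w \near z, f w != 0.
Proof.
move=> /continuousCP cf f0; have [|r r0 Hr] := cf (nrm (f z)); first by rewrite nrm_gt0.
apply/nearCP; exists r; first exact: r0.
move=> w /Hr; apply: contraTneq => ->.
by rewrite sub0r nrmN ltxx.
Qed.

Lemma hol_at_neq0 x f : hol_at x f -> f x != 0 -> \forall y \near x, f y != 0.
Proof.
move=> hf f0; have [phi aphi xphi] := exists_chart x.
apply/(chart_near _ aphi xphi).
apply: (near_neq0C (f := f \o cinv phi)); last by rewrite /= chart_inv.
exact: is_derive1_continuous (hol_at_derivable hf aphi xphi).
Qed.

Lemma hol_at_inv x f : hol_at x f -> f x != 0 -> hol_at x (fun y => (f y)^-1).
Proof.
move=> hf f0 phi aphi xphi.
have f0' := proj1 (chart_near _ aphi xphi) (hol_at_neq0 hf f0).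
by apply: (nearS2 (hf _ aphi xphi) f0') => z dz nz; exact: derivable1V.
Qed.

Lemma hol_at_div x f g : hol_at x f -> hol_at x g -> g x != 0 ->
  hol_at x (fun y => f y / g y).
Proof. by move=> hf hg g0; exact: hol_at_mul hf (hol_at_inv hg g0). Qed.

Lemma hol_at_cmap x phi : atlas phi -> cdom phi x -> hol_at x (cmap phi).
Proof.
move=> aphi xphi; apply/(hol_at_chart _ aphi xphi).
have /near_join H := chart_near_image aphi xphi.
suff : \forall z \near cmap phi x, derivable (cmap phi \o cinv phi : C -> C) z 1 by [].
apply: (nearS2 H H) => z Hz _.
apply: (@derivable1_near _ (fun w : C => w)); last exact: derivable1_id.
by apply: filterS Hz => w [_] /= ->.
Qed.

Lemma chart_deriv_mul phi f g x : atlas phi -> cdom phi x -> hol_at x f -> hol_at x g ->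
  chart_deriv phi (fun y => f y * g y) x =
  f x * chart_deriv phi g x + g x * chart_deriv phi f x.
Proof.
move=> aphi xphi hf hg; apply: chart_deriv_val.
have := is_derive1M (hol_at_derivable hf aphi xphi) (hol_at_derivable hg aphi xphi).
by rewrite /= chart_inv.
Qed.

Lemma chart_deriv_add phi f g x : atlas phi -> cdom phi x -> hol_at x f -> hol_at x g ->
  chart_deriv phi (fun y => f y + g y) x = chart_deriv phi f x + chart_deriv phi g x.
Proof.
move=> aphi xphi hf hg; apply: chart_deriv_val.
exact: is_derive1D (hol_at_derivable hf aphi xphi) (hol_at_derivable hg aphi xphi).
Qed.

Lemma chart_deriv_sub phi f g x : atlas phi -> cdom phi x -> hol_at x f -> hol_at x g ->
  chart_deriv phi (fun y => f y - g y) x = chart_deriv phi f x - chart_deriv phi g x.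
Proof.
move=> aphi xphi hf hg; apply: chart_deriv_val.
exact: is_derive1B (hol_at_derivable hf aphi xphi) (hol_at_derivable hg aphi xphi).
Qed.

Lemma chart_deriv_cst phi (a : C) x : chart_deriv phi (fun=> a) x = 0.
Proof. by apply: chart_deriv_val; exact: is_derive1_cst. Qed.

Lemma chart_deriv_scale phi (a : C) f x : atlas phi -> cdom phi x -> hol_at x f ->
  chart_deriv phi (fun y => a * f y) x = a * chart_deriv phi f x.
Proof.
move=> aphi xphi hf; rewrite (chart_deriv_mul aphi xphi (@hol_at_cst x a) hf).
by rewrite chart_deriv_cst mulr0 addr0.
Qed.

Lemma chart_deriv_self phi x : atlas phi -> cdom phi x -> chart_deriv phi (cmap phi) x = 1.
Proof.
move=> aphi xphi; apply: chart_deriv_val.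
apply: is_derive1_near (is_derive1_id _).
by apply: filterS (chart_near_image aphi xphi) => w [_] /= ->.
Qed.

Lemma chart_deriv_change phi psi f x : atlas phi -> cdom phi x -> atlas psi -> cdom psi x ->
  hol_at x f -> chart_deriv psi f x = chart_deriv phi f x * chart_deriv psi (cmap phi) x.
Proof.
move=> aphi xphi apsi xpsi hf; apply: chart_deriv_val.
exact: deriv_change (hol_at_derivable hf aphi xphi).
Qed.

Lemma chart_deriv_cmap_neq0 phi psi x : atlas phi -> cdom phi x -> atlas psi -> cdom psi x ->
  chart_deriv phi (cmap psi) x != 0.
Proof.
move=> aphi xphi apsi xpsi; apply/eqP => H.
have := chart_deriv_change apsi xpsi aphi xphi (hol_at_cmap aphi xphi).
by rewrite chart_deriv_self// H mulr0 => /eqP; rewrite oner_eq0.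
Qed.

(** The place where Cauchy's formula enters the geometry, through the holomorphy of derivatives. *)
Lemma hol_at_chart_deriv phi f x : atlas phi -> cdom phi x -> hol_at x f ->
  hol_at x (chart_deriv phi f).
Proof.
move=> aphi xphi hf; apply/(hol_at_chart _ aphi xphi).
have /near_join H := chart_near_image aphi xphi.
apply: (nearS2 H (holomorphic_near_derive (hf _ aphi xphi))) => z Hz.
apply: derivable1_near; apply: filterS Hz => w [_] /=.
by rewrite /chart_deriv => ->.
Qed.

Lemma continuous_near (F : C -> C) (z : C) (P : C -> Prop) : {for z, continuous F} ->
  (\forall w \near F z, P w) -> \forall w \near z, P (F w).
Proof.
move=> /continuousCP cF /nearCP[e e0 He]; have [r r0 Hr] := cF e e0.
apply/nearCP; exists r; first exact: r0.
by move=> w /Hr; exact: He.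
Qed.

Lemma hol_at_compose (F : C -> C) f x : holomorphic_near F (f x) -> hol_at x f ->
  hol_at x (fun y => F (f y)).
Proof.
move=> hF hf phi aphi xphi.
have cf : {for cmap phi x, continuous (f \o cinv phi : C -> C)}.
  exact: is_derive1_continuous (hol_at_derivable hf aphi xphi).
have H : \forall z \near cmap phi x, derivable F (f (cinv phi z)) 1.
  have E : (f \o cinv phi) (cmap phi x) = f x by rewrite /= chart_inv.
  have hF' : \forall w \near (f \o cinv phi) (cmap phi x), derivable F w 1.
    by rewrite E; exact: hF.
  exact: (continuous_near cf hF').
apply: (nearS2 H (hf _ aphi xphi)) => z /is_derive1E dF /is_derive1E df.
exact: is_derive1_derivable (is_derive1_compose df dF).
Qed.

Lemma chart_deriv_compose (F : C -> C) f x phi : atlas phi -> cdom phi x ->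
  derivable F (f x) 1 -> hol_at x f ->
  chart_deriv phi (fun y => F (f y)) x = derive1 F (f x) * chart_deriv phi f x.
Proof.
move=> aphi xphi dF hf; apply: chart_deriv_val.
have D := hol_at_derivable hf aphi xphi.
have dF' : is_derive ((f \o cinv phi) (cmap phi x)) 1 F (derive1 F (f x)).
  have -> : (f \o cinv phi) (cmap phi x) = f x by rewrite /= chart_inv.
  exact: is_derive1E.
exact: is_derive1_compose D dF'.
Qed.

Lemma hol_at_sqrt f x : hol_at x f -> f x != 0 ->
  exists2 m : X -> C, hol_at x m & \forall y \near x, m y ^+ 2 = f y.
Proof.
move=> hf f0; have [phi aphi xphi] := exists_chart x.
have [|m hm mE] := local_sqrt (hf _ aphi xphi); first by rewrite /= chart_inv.
exists (fun y => m (cmap phi y)); first exact: hol_at_compose (hol_at_cmap _ _).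
apply: filterS (chart_near_dom aphi xphi) => y yd.
by rewrite mE /= chart_inv.
Qed.

(** Images of small discs under a chart inverse; [corresponding_connection] speaks of connected open
    sets only. *)
Lemma chart_nbhs_connected x (P : X -> Prop) : (\forall y \near x, P y) ->
  exists V : set X, [/\ open V, connected V, V x & V `<=` P].
Proof.
move=> HP; have [phi aphi xphi] := exists_chart x.
have := proj1 (chart_near _ aphi xphi) HP => HP'.
have : \forall z \near cmap phi x, (cdom phi (cinv phi z) /\ cmap phi (cinv phi z) = z)
    /\ P (cinv phi z) .
  exact: nearS2 (chart_near_image aphi xphi) HP' (fun z a b => conj a b).
move=> /nearCP[r r0 Hr].
pose B := [set w : C | nrm (w - cmap phi x) < r].
exists (cinv phi @` B); split.
- rewrite openE => _ [z zB <-].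
  have [[zd zE] _] := Hr z zB.
  apply/(chart_near _ aphi zd); rewrite zE.
  by have := near_nrm_lt zB; apply: filterS => w wB; exists w.
- apply: connected_continuous_connected; first exact: ball_connected.
  apply: continuous_in_subspaceT => z; rewrite inE => zB.
  have [[zd zE] _] := Hr z zB; rewrite -zE; exact: chart_cinv_continuous.
- by exists (cmap phi x); [rewrite /B /= subrr nrm0|rewrite chart_inv].
- by move=> _ [z zB <-]; have [_] := Hr z zB.
Qed.

Lemma chart_deriv0_near f x phi : atlas phi -> cdom phi x -> hol_at x f ->
  (\forall y \near x, chart_deriv phi f y = 0) -> \forall y \near x, f y = f x.
Proof.
move=> aphi xphi hf H.
apply/(chart_near _ aphi xphi).
have H' := proj1 (chart_near _ aphi xphi) H.
have N : \forall z \near cmap phi x, is_derive (z : C) 1 (f \o cinv phi : C -> C) 0.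
  apply: (nearS3 (hf phi aphi xphi) (chart_near_image aphi xphi) H') => z dz [zd zE] z0.
  by rewrite -z0 /chart_deriv zE; exact: is_derive1E.
move: N => /nearCP[r r0 Hr]; apply/nearCP; exists r; first exact: r0.
by move=> z zr; have := derive0_constant Hr zr; rewrite /= chart_inv.
Qed.

End SurfaceFunctions.

(** * The antiholomorphic involution in charts *)

Section AntiholomorphicInvolution.
Context {R : realType} {X : riemann_surface (cplx R)} (tau : X -> X).
Hypothesis tauP : antiholomorphic_involution tau.
Local Notation C := (cplx R).
Implicit Types (f g h : X -> C) (x y : X) (phi psi : @chart C X).

Lemma tauK x : tau (tau x) = x. Proof. by case: tauP => K _ _; exact: K. Qed.

Lemma tau_near x (P : X -> Prop) : (\forall y \near tau x, P y) ->
  \forall y \near x, P (tau y).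
Proof. by case: tauP => _ c _; exact: c. Qed.

Lemma hol_at_conj_chart x psi : atlas psi -> cdom psi (tau x) ->
  hol_at x (fun y => Num.conj (cmap psi (tau y))).
Proof. by case: tauP => _ _ H; exact: H. Qed.

(** Up to conjugation, the matrix of the conjugate linear differential of tau in the two charts. *)
Definition conj_deriv phi psi x := chart_deriv phi (fun y => Num.conj (cmap psi (tau y))) x.

Lemma conj_tau_compose f x psi : atlas psi -> cdom psi (tau x) ->
  \forall y \near x, Num.conj (f (tau y)) =
    (fun w => Num.conj ((f \o cinv psi) (Num.conj w))) (Num.conj (cmap psi (tau y))).
Proof.
move=> apsi xpsi; apply: filterS (tau_near (chart_near_dom apsi xpsi)) => y yd.
by rewrite conjCK /= chart_inv.
Qed.

Lemma hol_at_conj_tau f x : hol_at (tau x) f -> hol_at x (fun y => Num.conj (f (tau y))).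
Proof.
move=> hf; have [psi apsi xpsi] := exists_chart (tau x).
apply: hol_at_eq (_ : hol_at x (fun y => (fun w => Num.conj ((f \o cinv psi) (Num.conj w)))
    (Num.conj (cmap psi (tau y))))).
  by apply: filterS (conj_tau_compose f apsi xpsi) => y ->.
apply: (hol_at_compose (F := fun w => Num.conj ((f \o cinv psi) (Num.conj w))));
  last exact: hol_at_conj_chart.
apply: holomorphic_near_conj; rewrite conjCK; exact: hf.
Qed.

Lemma chart_deriv_conj_tau f x phi psi : atlas phi -> cdom phi x ->
  atlas psi -> cdom psi (tau x) -> hol_at (tau x) f ->
  chart_deriv phi (fun y => Num.conj (f (tau y))) x =
  Num.conj (chart_deriv psi f (tau x)) * conj_deriv phi psi x.
Proof.
move=> aphi xphi apsi xpsi hf.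
rewrite (chart_deriv_eq aphi xphi (conj_tau_compose f apsi xpsi) (hol_at_conj_tau hf)).
have D := is_derive1_conj (hol_at_derivable hf apsi xpsi).
rewrite (chart_deriv_compose (F := fun w => Num.conj ((f \o cinv psi) (Num.conj w))) aphi xphi).
- by rewrite (is_derive1_val D).
- exact: is_derive1_derivable D.
- exact: hol_at_conj_chart.
Qed.

Lemma conj_deriv_tau x phi psi : atlas phi -> cdom phi x ->
  atlas psi -> cdom psi (tau x) ->
  Num.conj (conj_deriv psi phi (tau x)) * conj_deriv phi psi x = 1.
Proof.
move=> aphi xphi apsi xpsi.
have xphi' : cdom phi (tau (tau x)) by rewrite tauK.
rewrite -(chart_deriv_conj_tau aphi xphi apsi xpsi (hol_at_conj_chart aphi xphi')).
have -> : (fun y => Num.conj (Num.conj (cmap phi (tau (tau y))))) = cmap phi.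
  by apply/funext => y; rewrite conjCK tauK.
exact: chart_deriv_self.
Qed.

Lemma conj_deriv_neq0 x phi psi : atlas phi -> cdom phi x ->
  atlas psi -> cdom psi (tau x) -> conj_deriv phi psi x != 0.
Proof.
move=> aphi xphi apsi xpsi; have := conj_deriv_tau aphi xphi apsi xpsi.
by move=> H; apply/eqP => H0; move/eqP: H; rewrite H0 mulr0 eq_sym oner_eq0.
Qed.

Lemma hol_at_conj_deriv x phi psi : atlas phi -> cdom phi x ->
  atlas psi -> cdom psi (tau x) -> hol_at x (conj_deriv phi psi).
Proof.
by move=> aphi xphi apsi xpsi; apply: hol_at_chart_deriv => //; exact: hol_at_conj_chart.
Qed.

End AntiholomorphicInvolution.

(** * Line bundles and their jets *)

(* Closes goals [hol_at x f] syntactically: trying the hypotheses up to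
   conversion unfolds the definition of the derivative. *)
Ltac hol_at_tac := first
  [ lazymatch goal with H : hol_at ?x ?f |- hol_at ?x ?f => exact H end
  | lazymatch goal with
    | |- hol_at ?x (fun y => @?f y - @?g y) => apply: (@hol_at_sub _ _ x f g); hol_at_tac
    | |- hol_at ?x (fun y => @?f y + @?g y) => apply: (@hol_at_add _ _ x f g); hol_at_tac
    | |- hol_at ?x (fun y => @?f y * @?g y) => apply: (@hol_at_mul _ _ x f g); hol_at_tac
    | |- hol_at ?x (fun _ => ?a) => exact: (@hol_at_cst _ _ x a)
    | H : forall i, hol_at ?x (?c i) |- hol_at ?x (?c ?i) => exact (H i)
    end ].

Section LineBundle.
Context {R : realType} {X : riemann_surface (cplx R)} (L : line_bundle X).
Local Notation C := (cplx R).
Implicit Types (f g h z : X -> C) (x y : X) (phi psi : @chart C X)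
  (s t omega : section L) (e : local_frame 1 L).

Definition smul h s : section L := fun y => h y *: s y.

Lemma exists_frame x : exists2 e, frames L e & fdom e x.
Proof. by case: (lb_holomorphic L) => H _ _ _; exact: H. Qed.

Lemma frame_near e x : frames L e -> fdom e x -> \forall y \near x, fdom e y.
Proof.
by case: (lb_holomorphic L) => _ H _ _ Fe xe; apply: open_nbhs_nbhs; split=> //; exact: H.
Qed.

Lemma frame_coord e x (v : L x) : frames L e -> fdom e x ->
  exists a, v = a *: fvec e ord0 x.
Proof.
case: (lb_holomorphic L) => _ _ H _ Fe xe; have [c [-> _]] := H e x Fe xe v.
by rewrite big_ord1; exists (c ord0).
Qed.

Lemma frame_neq0 e x : frames L e -> fdom e x -> fvec e ord0 x != 0.
Proof.
case: (lb_holomorphic L) => _ _ H _ Fe xe; apply/eqP => e0.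
have [c [_ cu]] := H e x Fe xe 0.
have u (a : C) : c = (fun=> a) by apply: cu; rewrite big_ord1 e0 scaler0.
have := congr1 (fun f : 'I_1 -> C => f ord0) (etrans (esym (u 0)) (u 1)).
by move/eqP; rewrite eq_sym oner_eq0.
Qed.

Lemma frame_inj e x (a b : C) : frames L e -> fdom e x ->
  a *: fvec e ord0 x = b *: fvec e ord0 x -> a = b.
Proof.
move=> Fe xe /eqP; rewrite -subr_eq0 -scalerBl scaler_eq0 (negbTE (frame_neq0 Fe xe)).
by rewrite orbF subr_eq0 => /eqP.
Qed.

Lemma fiber_coord x (u v : L x) : u != 0 -> exists a, v = a *: u.
Proof.
have [e Fe xe] := exists_frame x.
have [a ->] := frame_coord u Fe xe; have [b ->] := frame_coord v Fe xe.
move=> u0; have a0 : a != 0 by apply: contraNneq u0 => ->; rewrite scale0r.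
by exists (b / a); rewrite scalerA divfK.
Qed.

Lemma fiber_inj x (u : L x) (a b : C) : u != 0 -> a *: u = b *: u -> a = b.
Proof.
move=> u0 /eqP; rewrite -subr_eq0 -scalerBl scaler_eq0 (negbTE u0).
by rewrite orbF subr_eq0 => /eqP.
Qed.

Lemma hol_section_frame x s e : hol_section x s -> frames L e -> fdom e x ->
  exists2 c : X -> C, hol_at x c & \forall y \near x, s y = c y *: fvec e ord0 y.
Proof.
move=> hs Fe xe; have [c [hc sc]] := hs e Fe xe; exists (c ord0); first exact: hc.
by apply: filterS sc => y ->; rewrite big_ord1.
Qed.

Lemma hol_section1 x s : (forall e, frames L e -> fdom e x ->
  exists2 c : X -> C, hol_at x c & \forall y \near x, s y = c y *: fvec e ord0 y) ->
  hol_section x s.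
Proof.
move=> H e Fe xe; have [c hc sc] := H e Fe xe; exists (fun=> c); split; first by move=> _.
by apply: filterS sc => y ->; rewrite big_ord1.
Qed.

Lemma hol_section_fvec e x : frames L e -> fdom e x -> hol_section x (fvec e ord0 : section L).
Proof. by case: (lb_holomorphic L) => _ _ _ H Fe xe; exact: H. Qed.

Lemma hol_section_smul x h s : hol_at x h -> hol_section x s -> hol_section x (smul h s).
Proof.
move=> hh hs; apply: hol_section1 => e Fe xe; have [c hc sc] := hol_section_frame hs Fe xe.
exists (fun y => h y * c y); first exact: hol_at_mul.
by apply: filterS sc => y; rewrite /smul => ->; rewrite scalerA.
Qed.

Lemma hol_section_eq x s t : (\forall y \near x, s y = t y) -> hol_section x s ->
  hol_section x t.
Proof.
move=> st hs; apply: hol_section1 => e Fe xe; have [c hc sc] := hol_section_frame hs Fe xe.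
by exists c => //; apply: (nearS2 st sc) => y -> ->.
Qed.

Lemma hol_section_near x s : hol_section x s -> \forall y \near x, hol_section y s.
Proof.
move=> hs; have [e Fe xe] := exists_frame x; have [c hc sc] := hol_section_frame hs Fe xe.
apply: (nearS3 (hol_at_near hc) (near_join sc) (frame_near Fe xe)) => y hcy scy ye.
apply: hol_section_eq (hol_section_smul hcy (hol_section_fvec Fe ye)).
by apply: filterS scy => v ->.
Qed.

Definition local_triv x omega := hol_section x omega /\ omega x != 0.

Lemma local_triv_frame e x : frames L e -> fdom e x -> local_triv x (fvec e ord0).
Proof. by move=> Fe xe; split; [exact: hol_section_fvec|exact: frame_neq0]. Qed.

Lemma exists_local_triv x : exists omega, local_triv x omega.
Proof.
by have [e Fe xe] := exists_frame x; exists (fvec e ord0); exact: local_triv_frame.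
Qed.

Lemma local_triv_frame_coord x omega e : local_triv x omega -> frames L e -> fdom e x ->
  exists d : X -> C, [/\ hol_at x d, d x != 0 &
    \forall y \near x, omega y = d y *: fvec e ord0 y].
Proof.
move=> [ho o0] Fe xe; have [d hd od] := hol_section_frame ho Fe xe; exists d; split => //.
by apply: contraNneq o0 => d0; rewrite (nbhs_singleton od) d0 scale0r.
Qed.

Lemma local_triv_near x omega : local_triv x omega -> \forall y \near x, local_triv y omega.
Proof.
move=> ho; have [e Fe xe] := exists_frame x.
have [d [hd d0 od]] := local_triv_frame_coord ho Fe xe.
have H := nearS3 (hol_section_near (proj1 ho)) (frame_near Fe xe)
  (nearS2 od (hol_at_neq0 hd d0) (fun y a b => conj a b)).
apply: H => y hy ye [E dy]; split => //.
by rewrite E scaler_eq0 negb_or dy frame_neq0.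
Qed.

Lemma local_triv_smul x h omega : hol_at x h -> h x != 0 -> local_triv x omega ->
  local_triv x (smul h omega).
Proof.
move=> hh h0 [ho o0]; split; first exact: hol_section_smul.
by rewrite /smul scaler_eq0 negb_or h0.
Qed.

Lemma triv_coord x omega s : local_triv x omega -> hol_section x s ->
  exists2 h, hol_at x h & \forall y \near x, s y = h y *: omega y.
Proof.
move=> ho hs; have [e Fe xe] := exists_frame x.
have [d [hd d0 od]] := local_triv_frame_coord ho Fe xe.
have [c hc sc] := hol_section_frame hs Fe xe.
exists (fun y => c y / d y); first exact: hol_at_div.
by apply: (nearS3 od sc (hol_at_neq0 hd d0)) => y -> -> dy; rewrite scalerA divfK.
Qed.

Lemma hol_germP x s : reflect (hol_section x s) (s \in hol_germ x).
Proof. exact: asboolP. Qed.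

Lemma jet_lin x s t (a : C) : hol_section x s -> hol_section x t ->
  jet x (fun y => a *: s y + t y : L y) = a *: jet x s + jet x t.
Proof.
move=> hs ht; rewrite /jet.
have -> : insubd (0 : @local_section _ X 1 L x) (fun y => a *: s y + t y : L y) =
   a *: insubd 0 s + insubd 0 t.
  have gs : s \in hol_germ x by apply/hol_germP.
  have gt : t \in hol_germ x by apply/hol_germP.
  have gst : (a *: s + t) \in hol_germ x by apply: rpredD => //; exact: rpredZ.
  apply: val_inj; rewrite /= !insubdK//.
by rewrite quotient_classD quotient_classZ.
Qed.

(** [vanishing_jet] quantifies over all frames and charts. Another frame multiplies the coefficient
    by an invertible function and another chart multiplies its derivative, so one trivialisation and
    one chart decide. *)
Lemma jet_eq0P x omega h s phi : local_triv x omega -> hol_at x h ->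
  (\forall y \near x, s y = h y *: omega y) -> atlas phi -> cdom phi x ->
  jet x s = 0 <-> h x = 0 /\ chart_deriv phi h x = 0.
Proof.
move=> ho hh sh aphi xphi.
have hs : hol_section x s.
  by apply: hol_section_eq (hol_section_smul hh (proj1 ho)); apply: filterS sh => y ->.
have gs : s \in hol_germ x by apply/hol_germP.
have lE : lsec (insubd (0 : @local_section _ X 1 L x) s) = s := insubdK _ gs.
have jE : (jet x s = 0) <-> vanishing_jet (insubd (0 : @local_section _ X 1 L x) s).
  have q0 : quotient_class (@vanishing_jet _ X 1 L x) 0 = 0.
    apply: (@addrI _ (quotient_class (@vanishing_jet _ X 1 L x) 0)).
    by rewrite -quotient_classD !addr0.
  have Q := quotient_classE (@vanishing_jet _ X 1 L x) (insubd 0 s) 0.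
  by rewrite q0 subr0 in Q; exact: Q.
split.
  move=> /jE /asboolP; rewrite lE => H.
  have [e Fe xe] := exists_frame x.
  have [d [hd d0 od]] := local_triv_frame_coord ho Fe xe.
  have [c [hc sc c0]] := H e Fe xe; have [cx dc] := c0 ord0.
  have cE : \forall y \near x, c ord0 y = d y * h y.
    apply: (nearS3 sh sc (nearS2 od (frame_near Fe xe) (fun y a b => conj a b))).
    move=> y E1 E2 [E3 ye]; move: E2.
    rewrite E1 E3 big_ord1 scalerA => /(frame_inj Fe ye) <-.
    by rewrite mulrC.
  have h0 : h x = 0.
    have := nbhs_singleton cE; rewrite cx => /esym/eqP.
    by rewrite mulf_eq0 (negbTE d0) => /eqP.
  split=> //; have := dc phi aphi xphi.
  rewrite (chart_deriv_eq aphi xphi cE (hc ord0)) (chart_deriv_mul aphi xphi hd hh).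
  by rewrite h0 mul0r addr0 => /eqP; rewrite mulf_eq0 (negbTE d0) => /eqP.
move=> [h0 dh0]; apply/jE/asboolP => e Fe xe; rewrite lE.
have [d [hd d0 od]] := local_triv_frame_coord ho Fe xe.
have hc : hol_at x (fun y => d y * h y) by exact: hol_at_mul.
exists (fun=> fun y => d y * h y); split=> [_||_]; first exact: hc.
  by apply: (nearS2 sh od) => y -> ->; rewrite big_ord1 scalerA mulrC.
split; first by rewrite h0 mulr0.
move=> psi apsi xpsi; rewrite (chart_deriv_change aphi xphi apsi xpsi hc).
by rewrite (chart_deriv_mul aphi xphi hd hh) dh0 h0 mulr0 mul0r addr0 mul0r.
Qed.

Lemma jet0 x : jet x (0 : section L) = 0.
Proof.
have [phi aphi xphi] := exists_chart x; have [omega ho] := exists_local_triv x.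
apply/(jet_eq0P ho (@hol_at_cst _ _ x 0) _ aphi xphi).
  by near=> y; rewrite scale0r.
by rewrite chart_deriv_cst.
Unshelve. all: by end_near. Qed.

Lemma hol_section0 x : hol_section x (0 : section L).
Proof.
have [omega ho] := exists_local_triv x.
apply: hol_section_eq (hol_section_smul (@hol_at_cst _ _ x 0) (proj1 ho)).
by near=> y; rewrite /smul scale0r.
Unshelve. all: by end_near. Qed.

Lemma hol_section_lin x s t (a : C) : hol_section x s -> hol_section x t ->
  hol_section x (fun y => a *: s y + t y : L y).
Proof.
move=> hs ht; have [omega ho] := exists_local_triv x.
have [h hh sh] := triv_coord ho hs; have [k hk tk] := triv_coord ho ht.
apply: hol_section_eq (hol_section_smul (hol_at_lin a hh hk) (proj1 ho)).
by apply: (nearS2 sh tk) => y -> ->; rewrite /smul scalerDl scalerA.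
Qed.

Lemma jetZ x s (a : C) : hol_section x s -> jet x (fun y => a *: s y : L y) = a *: jet x s.
Proof.
move=> hs; have := jet_lin a hs (@hol_section0 x); rewrite jet0 addr0 => <-.
by congr jet; apply: functional_extensionality_dep => y; rewrite addr0.
Qed.

Lemma jet_sub x s t : hol_section x s -> hol_section x t ->
  jet x (fun y => s y - t y : L y) = jet x s - jet x t.
Proof.
move=> hs ht; have := jet_lin (-1) ht hs; rewrite scaleN1r addrC => <-.
by congr jet; apply: functional_extensionality_dep => y; rewrite scaleN1r addrC.
Qed.

Lemma jet_eq x s t : hol_section x s -> (\forall y \near x, s y = t y) -> jet x s = jet x t.
Proof.
move=> hs st; have ht := hol_section_eq st hs.
have [phi aphi xphi] := exists_chart x; have [omega ho] := exists_local_triv x.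
apply/eqP; rewrite -subr_eq0 -jet_sub//; apply/eqP.
apply/(jet_eq0P ho (@hol_at_cst _ _ x 0) _ aphi xphi).
  by apply: filterS st => y ->; rewrite subrr scale0r.
by rewrite chart_deriv_cst.
Qed.

Lemma jet_surj x (v : jet_bundle L x) : exists2 s, hol_section x s & v = jet x s.
Proof.
have [s ->] := quotient_class_surj v; have gs := lsecP s.
exists (lsec s); first exact/hol_germP.
by rewrite /jet; congr quotient_class; apply: val_inj; rewrite insubdK.
Qed.

(* The data for which (j^1 omega, j^1 (z omega)) is a frame of J^1(L) near x. *)
Definition proj_frame x z omega := [/\ local_triv x omega, hol_at x z &
  forall phi, atlas phi -> cdom phi x -> chart_deriv phi z x != 0].

Lemma chart_deriv_neq0_change z x phi : hol_at x z -> atlas phi -> cdom phi x ->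
  chart_deriv phi z x != 0 -> forall psi, atlas psi -> cdom psi x -> chart_deriv psi z x != 0.
Proof.
move=> hz aphi xphi z0 psi apsi xpsi.
rewrite (chart_deriv_change aphi xphi apsi xpsi hz).
exact: mulf_neq0 z0 (chart_deriv_cmap_neq0 apsi xpsi aphi xphi).
Qed.

Lemma proj_frame_near x z omega : proj_frame x z omega -> \forall y \near x, proj_frame y z omega.
Proof.
move=> [ho hz z0]; have [phi aphi xphi] := exists_chart x.
have hdz := hol_at_chart_deriv aphi xphi hz.
apply: (nearS3 (local_triv_near ho) (nearS2 (hol_at_near hz) (chart_near_dom aphi xphi)
  (fun y a b => conj a b)) (hol_at_neq0 hdz (z0 _ aphi xphi))) => y hy [hzy yphi] zy.
split; [exact: hy|exact: hzy|exact: chart_deriv_neq0_change zy].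
Qed.

Lemma proj_frame_chart x phi omega : atlas phi -> cdom phi x -> local_triv x omega ->
  proj_frame x (cmap phi) omega.
Proof.
move=> aphi xphi ho; split; [exact: ho|exact: hol_at_cmap|].
by move=> psi apsi xpsi; exact: chart_deriv_cmap_neq0.
Qed.

(** [D] is dh/dz at x, so h and the function D z + A, affine in z, agree to first order at x. *)
Lemma jet_smulE x z omega h phi : proj_frame x z omega -> hol_at x h ->
  atlas phi -> cdom phi x ->
  let D := chart_deriv phi h x / chart_deriv phi z x in
  jet x (smul h omega) = (h x - D * z x) *: jet x omega + D *: jet x (smul z omega).
Proof.
move=> [ho hz z0] hh aphi xphi D; set A := h x - D * z x.
have hw := proj1 ho.
have hzw := hol_section_smul hz hw; have hhw := hol_section_smul hh hw.
have hA := hol_section_lin A hw (@hol_section0 x).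
have hk : hol_at x (fun y => h y - (D * z y + A)).
  by hol_at_tac.
have hDz : hol_at x (fun y => D * z y + A).
  by hol_at_tac.
have hDzA : hol_section x (fun y => D *: smul z omega y + A *: omega y : L y).
  apply: hol_section_eq (hol_section_smul hDz hw).
  by near=> y; rewrite /smul scalerDl scalerA.
have hAw : hol_section x (fun y => A *: omega y : L y).
  apply: hol_section_eq hA; near=> y; exact: addr0.
rewrite -(jetZ A hw) addrC -jet_lin//; apply/eqP; rewrite -subr_eq0 -jet_sub//; apply/eqP.
apply/(jet_eq0P ho hk _ aphi xphi).
  by near=> y; rewrite /smul scalerA -scalerDl -scalerBl.
split; first by rewrite /A; ring.
rewrite (chart_deriv_sub aphi xphi hh hDz) (chart_deriv_lin D aphi xphi hz (hol_at_cst _)).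
by rewrite chart_deriv_cst /D addr0 divfK ?subrr// z0.
Unshelve. all: by end_near. Qed.

Lemma jet_indep x z omega (a b : C) : proj_frame x z omega ->
  a *: jet x omega + b *: jet x (smul z omega) = 0 -> a = 0 /\ b = 0.
Proof.
move=> [ho hz z0]; have [phi aphi xphi] := exists_chart x.
have hw := proj1 ho; have hzw := hol_section_smul hz hw.
have hbz : hol_at x (fun y => b * z y + a) by exact: hol_at_lin (hol_at_cst _).
have hA : hol_section x (fun y => a *: omega y : L y).
  exact: hol_section_smul (@hol_at_cst _ _ x a) hw.
rewrite addrC -(jetZ a hw) -jet_lin//.
move=> /(jet_eq0P ho hbz _ aphi xphi)[].
  by near=> y; rewrite /smul scalerDl scalerA.
move=> E; rewrite (chart_deriv_lin b aphi xphi hz (hol_at_cst _)) chart_deriv_cst addr0.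
move/eqP; rewrite mulf_eq0 (negbTE (z0 _ aphi xphi)) orbF => /eqP b0.
by move: E; rewrite b0 mul0r add0r => ->.
Unshelve. all: by end_near. Qed.

Lemma jet_omega_neq0 x z omega (a b : C) : proj_frame x z omega -> (a, b) != (0, 0) ->
  a *: jet x omega + b *: jet x (smul z omega) != 0.
Proof.
move=> zo; apply: contraNneq => /(jet_indep zo)[-> ->]; exact: eqxx.
Qed.

Lemma jet_coords x z omega s : proj_frame x z omega -> hol_section x s ->
  exists g1 g2 : X -> C, [/\ hol_at x g1, hol_at x g2 &
    \forall y \near x, jet y s = g1 y *: jet y omega + g2 y *: jet y (smul z omega)].
Proof.
move=> zo hs; have [ho hz z0] := zo; have [phi aphi xphi] := exists_chart x.
have [h hh sh] := triv_coord ho hs.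
have hD : hol_at x (fun y => chart_deriv phi h y / chart_deriv phi z y).
  by apply: hol_at_div (z0 _ aphi xphi); exact: hol_at_chart_deriv.
exists (fun y => h y - chart_deriv phi h y / chart_deriv phi z y * z y).
exists (fun y => chart_deriv phi h y / chart_deriv phi z y); split.
- exact: hol_at_sub hh (hol_at_mul hD hz).
- exact: hD.
have H1 := nearS2 (near_join sh) (hol_section_near hs) (fun y a b => conj a b).
have H2 := nearS2 (hol_at_near hh) (chart_near_dom aphi xphi) (fun y a b => conj a b).
apply: (nearS3 H1 H2 (proj_frame_near zo)) => y [shy hsy] [hhy yphi] zoy.
by rewrite -(jet_smulE zoy hhy aphi yphi); exact: jet_eq.
Qed.

Definition jet_frame phi e : local_frame 2 (jet_bundle L) :=
  LocalFrame (cdom phi `&` fdom e) (fun i x =>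
    jet x (if i == 0 then fvec e 0
           else (fun y => cmap phi y *: fvec e 0 y) : section L)).

Lemma jet_frameE (f : local_frame 2 (jet_bundle L)) : frames (jet_bundle L) f ->
  exists phi e, [/\ atlas phi, frames L e & f = jet_frame phi e].
Proof. by []. Qed.

Lemma jet_frame_in phi e : atlas phi -> frames L e -> frames (jet_bundle L) (jet_frame phi e).
Proof. by exists phi, e. Qed.

Lemma jet_frame_sum phi e x (c : 'I_2 -> C) :
  \sum_(i < 2) c i *: fvec (jet_frame phi e) i x =
  c ord0 *: jet x (fvec e ord0 : section L) +
  c ord_max *: jet x (smul (cmap phi) (fvec e ord0)).
Proof.
rewrite big_ord_recl big_ord1 /=; congr (_ + c _ *: _); exact: val_inj.
Qed.

Lemma jet_frame_proj phi e x : atlas phi -> frames L e -> fdom (jet_frame phi e) x ->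
  proj_frame x (cmap phi) (fvec e ord0).
Proof.
by move=> aphi Fe [xphi xe]; apply: (proj_frame_chart aphi xphi); exact: local_triv_frame.
Qed.

Lemma exists_jet_frame x : exists phi e, [/\ atlas phi, frames L e & fdom (jet_frame phi e) x].
Proof.
have [e Fe xe] := exists_frame x; have [phi aphi xphi] := exists_chart x.
by exists phi, e.
Qed.

(** Frees the holomorphic structure of [jet_bundle] from the frames in its definition: any pair (j
    omega, j (z omega)) may be used. *)
Lemma jet_bundle_holP x z omega (t : section (jet_bundle L)) : proj_frame x z omega ->
  hol_section x t <-> exists g1 g2 : X -> C, [/\ hol_at x g1, hol_at x g2 &
    \forall y \near x, t y = g1 y *: jet y omega + g2 y *: jet y (smul z omega)].
Proof.
move=> zo; have [ho hz z0] := zo; split=> [ht|[g1 [g2 [hg1 hg2 tE]]]].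
  have [phi [e [aphi Fe xf]]] := exists_jet_frame x.
  have [c [hc tc]] := ht _ (jet_frame_in aphi Fe) xf.
  have pf := jet_frame_proj aphi Fe xf; have [hl _ _] := pf.
  have [a1 [a2 [ha1 ha2 E1]]] := jet_coords zo (proj1 hl).
  have [b1 [b2 [hb1 hb2 E2]]] := jet_coords zo (hol_section_smul (hol_at_cmap aphi (proj1 xf)) (proj1 hl)).
  exists (fun y => c ord0 y * a1 y + c ord_max y * b1 y).
  exists (fun y => c ord0 y * a2 y + c ord_max y * b2 y); split.
  - exact: hol_at_add (hol_at_mul (hc _) ha1) (hol_at_mul (hc _) hb1).
  - exact: hol_at_add (hol_at_mul (hc _) ha2) (hol_at_mul (hc _) hb2).
  apply: (nearS3 tc E1 E2) => y -> e1 e2.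
  rewrite (jet_frame_sum phi e y (fun i => c i y)) e1 e2 !scalerDr !scalerDl !scalerA.
  by rewrite addrACA.
move=> f /jet_frameE[phi [e [aphi Fe ->]]] xf.
have pf := jet_frame_proj aphi Fe xf.
have [a1 [a2 [ha1 ha2 E1]]] := jet_coords pf (proj1 ho).
have [b1 [b2 [hb1 hb2 E2]]] := jet_coords pf (hol_section_smul hz (proj1 ho)).
exists (fun i => if i == ord0 then (fun y => g1 y * a1 y + g2 y * b1 y)
                 else (fun y => g1 y * a2 y + g2 y * b2 y)); split.
  move=> i; case: (i == ord0).
    exact: hol_at_add (hol_at_mul hg1 ha1) (hol_at_mul hg2 hb1).
  exact: hol_at_add (hol_at_mul hg1 ha2) (hol_at_mul hg2 hb2).
apply: (nearS3 tE E1 E2) => y -> e1 e2.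
rewrite (jet_frame_sum phi e y (fun i => (if i == ord0 then
  (fun y => g1 y * a1 y + g2 y * b1 y) else (fun y => g1 y * a2 y + g2 y * b2 y)) y)) /=.
by rewrite e1 e2 !scalerDr !scalerDl !scalerA addrACA.
Qed.

Lemma jet_hol_section x s : hol_section x s ->
  hol_section x ((fun y => jet y s) : section (jet_bundle L)).
Proof.
move=> hs; have [phi aphi xphi] := exists_chart x; have [omega ho] := exists_local_triv x.
have zo := proj_frame_chart aphi xphi ho.
by apply/(jet_bundle_holP _ zo); exact: jet_coords.
Qed.

End LineBundle.

(** * The canonical lift *)

Section ProjectiveSpaces.
Context {K : fieldType} (V : lmodType K).
Implicit Types (v w : V) (p : pspace V).

Lemma spans_line v p : spans v p -> line p = [set a *: v | a in [set: K]].
Proof.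
case: p => l H; rewrite /spans /= => -[v0 lv]; case: H => u u0 lE; subst l.
case: lv => a _ uv; have a0 : a != 0 by apply: contraNneq v0 => a0; rewrite -uv a0 scale0r.
apply/seteqP; split => [_ [b _ <-]|_ [b _ <-]].
  by exists (b / a) => //; rewrite -uv scalerA divfK.
by exists (b * a) => //; rewrite -uv scalerA.
Qed.

Lemma spans_ex p : exists v, spans v p.
Proof.
by case: p => l H; have [v v0 lE] := H; exists v; split=> //=; rewrite lE; exists 1;
  rewrite ?scale1r.
Qed.

Lemma spans_scale v p (k : K) : k != 0 -> spans v p -> spans (k *: v) p.
Proof.
move=> k0 vp; split; first by rewrite scaler_eq0 negb_or k0; case: vp.
by rewrite (spans_line vp); exists k.
Qed.

Lemma spans_prop v w p : spans v p -> spans w p -> exists2 k, k != 0 & w = k *: v.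
Proof.
move=> vp [w0]; rewrite (spans_line vp) => -[k _ kv]; exists k => //.
by apply: contraNneq w0 => k0; rewrite -kv k0 scale0r.
Qed.

Lemma pspace_eq v p p' : spans v p -> spans v p' -> p = p'.
Proof.
move=> /spans_line e1 /spans_line e2.
case: p p' e1 e2 => l H [l' H'] /= e1 e2.
have ll : l = l' by rewrite e1 e2.
clear e1 e2; destruct ll; have -> : H = H' by exact: Prop_irrelevance.
by [].
Qed.

Definition pline v (v0 : v != 0) : pspace V :=
  PSpace (ex_intro2 _ _ v v0 (erefl [set a *: v | a in [set: K]])).

Lemma spans_pline v (v0 : v != 0) : spans v (pline v0).
Proof. by split=> //; exists 1; rewrite ?scale1r. Qed.

End ProjectiveSpaces.

(** * Components of tangent vectors *)

Section Tangent.
Context {R : realType} {X : riemann_surface (cplx R)}.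
Local Notation C := (cplx R).
Implicit Types (f g h z : X -> C) (x y : X) (phi psi : @chart C X).

Definition tc phi x (v : tangent_bundle x) : C := tcomp (v : tangent_vector x) phi.

Lemma tcZ phi x (a : C) (v : tangent_bundle x) : tc phi (a *: v) = a * tc phi v.
Proof. by []. Qed.

Lemma tc_change phi psi x (v : tangent_bundle x) : atlas phi -> cdom phi x ->
  atlas psi -> cdom psi x -> tc psi v = tc phi v * chart_deriv phi (cmap psi) x.
Proof.
move=> aphi xphi apsi xpsi; have /asboolP[_ H] := tcompP (v : tangent_vector x).
exact: H.
Qed.

Lemma tc_eq0 phi x (v : tangent_bundle x) : atlas phi -> cdom phi x -> tc phi v = 0 -> v = 0.
Proof.
move=> aphi xphi v0; have /asboolP[H1 H2] := tcompP (v : tangent_vector x).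
apply: val_inj; apply/funext => psi /=.
have [[apsi xpsi]|N] := pselect (atlas psi /\ cdom psi x); last by rewrite H1.
rewrite -[LHS]/(tc psi v) (tc_change v aphi xphi apsi xpsi) v0 mul0r; reflexivity.
Qed.

(** The components of d/dphi. The value 0 at charts not around x is what [tangent_family]
    prescribes. *)
Definition coord_comp phi x : @chart C X -> C := fun psi =>
  if `[< atlas phi /\ cdom phi x /\ atlas psi /\ cdom psi x >]
  then chart_deriv phi (cmap psi) x else 0.

Lemma coord_compP phi x : coord_comp phi x \in tangent_family x.
Proof.
apply/asboolP; split.
  by move=> psi N; rewrite /coord_comp; case: asboolP => // -[_ [_ H]].
move=> psi psi' apsi xpsi apsi' xpsi'; rewrite /coord_comp.
case: asboolP => [[aphi [xphi _]]|N]; case: asboolP => [[aphi' [xphi' _]]|N'].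
- rewrite mulrC.
  by rewrite (chart_deriv_change apsi xpsi aphi xphi (hol_at_cmap apsi' xpsi')).
- by case: N'.
- by case: N.
- by rewrite mul0r.
Qed.

Definition coord_frame phi : local_frame 1 (fiber (@tangent_bundle _ X)) :=
  LocalFrame (cdom phi) (fun i x => TangentVector (coord_compP phi x) : tangent_bundle x).

Lemma coord_frame_in phi : atlas phi -> frames (@tangent_bundle _ X) (coord_frame phi).
Proof.
move=> aphi; exists phi => //; split=> // x i xphi /=.
rewrite /coord_comp asboolT; last by [].
exact: chart_deriv_self.
Qed.

Lemma hol_section_tc phi x (V : section (@tangent_bundle _ X)) : atlas phi -> cdom phi x ->
  hol_section x V -> hol_at x (fun y => tc phi (V y)).
Proof.
move=> aphi xphi hV; have [c [hc VE]] := hV _ (coord_frame_in aphi) xphi.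
apply: hol_at_eq (hc ord0).
apply: (nearS2 VE (chart_near_dom aphi xphi)) => y -> yphi.
rewrite big_ord1 tcZ -[LHS]mulr1; congr (_ * _).
rewrite /tc /= /coord_comp asboolT; last by [].
by rewrite chart_deriv_self.
Qed.

End Tangent.

Section Lift.
Context {R : realType} {X : riemann_surface (cplx R)} (tau : X -> X).
Hypothesis tauP : antiholomorphic_involution tau.
Context (L : line_bundle X) (q : tangent_root L).
Local Notation C := (cplx R).
Implicit Types (f g h z : X -> C) (x y : X) (phi psi : @chart C X)
  (s t omega : section L).
Local Notation T := (tsq q).
Local Notation hom := (forall y, conj_pullback tau L y -> L y).

Lemma tsqZ x (a b : C) (u v : L x) : T (a *: u) (b *: v) = (a * b) *: T u v.
Proof.
have Z1 (c : C) w v' : T (c *: w) v' = c *: T w v' :> tangent_bundle x.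
  have := tsq_linl q v' c w 0; rewrite addr0 => ->.
  suff -> : T (0 : L x) v' = 0 :> tangent_bundle x by rewrite addr0.
  have := tsq_linl q v' (-1) 0 0; rewrite scaler0 addr0 => ->.
  by rewrite scaleN1r addNr.
have Z2 (c : C) w v' : T w (c *: v') = c *: T w v' :> tangent_bundle x.
  have := tsq_linr q w c v' 0; rewrite addr0 => ->.
  suff -> : T w (0 : L x) = 0 :> tangent_bundle x by rewrite addr0.
  have := tsq_linr q w (-1) 0 0; rewrite scaler0 addr0 => ->.
  by rewrite scaleN1r addNr.
by rewrite Z1 Z2 scalerA.
Qed.

(** The function t with omega^2 = t d/dphi. *)
Definition tsqc phi omega y : C := tc phi (T (omega y) (omega y)).

Lemma tsqc_hol phi x omega : atlas phi -> cdom phi x -> hol_section x omega ->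
  hol_at x (tsqc phi omega).
Proof.
by move=> aphi xphi ho; apply: (hol_section_tc (V := fun y => T (omega y) (omega y)));
  [exact: aphi|exact: xphi|exact: tsq_hol].
Qed.

Lemma tsqc_neq0 phi x omega : atlas phi -> cdom phi x -> omega x != 0 ->
  tsqc phi omega x != 0.
Proof.
move=> aphi xphi o0; apply: contraNneq (tsq_neq0 q o0 o0) => /(tc_eq0 aphi xphi) ->.
exact: eqxx.
Qed.

Lemma tsqc_scale phi x omega omega' (k : C) : omega' x = k *: omega x ->
  tsqc phi omega' x = k ^+ 2 * tsqc phi omega x.
Proof. by move=> E; rewrite /tsqc E tsqZ tcZ. Qed.

Lemma conj_differentialP x phi psi (v : tangent_bundle x) (w : tangent_bundle (tau x)) :
  atlas phi -> cdom phi x -> atlas psi -> cdom psi (tau x) ->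
  is_conj_differential v w <->
  tc psi w = Num.conj (tc phi v * conj_deriv tau phi psi x).
Proof.
move=> aphi xphi apsi xpsi; split=> [H|E phi' psi' aphi' xphi' apsi' xpsi'].
  exact: H.
rewrite -[LHS]/(tc psi' w) -[tcomp _ phi']/(tc phi' v).
rewrite (tc_change w apsi xpsi apsi' xpsi') E (tc_change v aphi xphi aphi' xphi').
have -> : chart_deriv phi' (fun y => Num.conj (cmap psi' (tau y))) x =
  Num.conj (chart_deriv psi (cmap psi') (tau x)) * conj_deriv tau phi' psi x.
  exact: (chart_deriv_conj_tau tauP aphi' xphi' apsi xpsi (hol_at_cmap apsi' xpsi')).
have -> : conj_deriv tau phi psi x =
    conj_deriv tau phi' psi x * chart_deriv phi (cmap phi') x.
  exact: chart_deriv_change aphi' xphi' aphi xphi (hol_at_conj_chart tauP apsi xpsi).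
move: (tc phi v) (conj_deriv tau phi' psi x) (chart_deriv phi _ x) (chart_deriv psi _ _).
by move=> a k c d; rewrite !rmorphM /= conjCK; ring.
Qed.

Definition ctau z : X -> C := fun y => Num.conj (z (tau y)).

(* conj (s o tau) (x) alpha, in the notation of the canonical lift. *)
Definition transport (alpha : hom) s : section L :=
  fun y => alpha y (pullback_section tau s y).

Lemma pullback_hol x s : hol_section (tau x) s -> hol_section x (pullback_section tau s).
Proof.
move=> hs f [e Fe ->] xe /=.
have [c hc sc] := hol_section_frame hs Fe xe.
exists (fun=> ctau c); split; first by move=> _; exact (hol_at_conj_tau tauP hc).
apply: filterS (tau_near tauP sc) => y E.
(* In [conj_module] the scalar [ctau c y] acts as its conjugate [c (tau y)]. *)
rewrite big_ord1; apply: (etrans E); rewrite -{1}[c (tau y)]conjCK; reflexivity.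
Qed.

Lemma flat_hom_near x (alpha : hom) : flat_hom_at q x alpha ->
  \forall y \near x, flat_hom_at q y alpha.
Proof.
move=> [/near_join H1 /near_join H2 [c c0 /near_join H3]].
by apply: (nearS3 H1 H2 H3) => y h1 h2 h3; split; [exact: h1|exact: h2|exists c].
Qed.

Lemma flat_hom_smul x (alpha : hom) : flat_hom_at q x alpha ->
  \forall y \near x, forall (a : C) (u : L (tau y)), alpha y (a *: u : L (tau y)) =
    Num.conj a *: alpha y u.
Proof.
move=> [H1 _ _]; apply: filterS H1 => y l a u.
have l0 : alpha y 0 = 0.
  have := l (-1) 0 0; rewrite scaler0 addr0 => ->.
  by rewrite scaleN1r addNr.
have := l (Num.conj a) u 0; rewrite l0 !addr0 => <-.
by congr (alpha y _); rewrite -[RHS]/((_)^* *: (u : L (tau y))) conjCK.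
Qed.

Lemma flat_transport_hol x (alpha : hom) s : flat_hom_at q x alpha ->
  hol_section (tau x) s -> hol_section x (transport alpha s).
Proof.
move=> [_ /nbhs_singleton H _] hs; exact: (H (pullback_section tau s) (pullback_hol hs)).
Qed.

(** Flatness as an equation between squares: alpha is only seen through the square of the
    transported section, up to the constant c. *)
Lemma flat_transport_tsqc x (alpha : hom) omega : flat_hom_at q x alpha ->
  exists2 c : C, c != 0 & \forall y \near x, forall phi psi, atlas phi -> cdom phi y ->
    atlas psi -> cdom psi (tau y) ->
    c * tsqc psi omega (tau y) =
    Num.conj (tsqc phi (transport alpha omega) y * conj_deriv tau phi psi y).
Proof.
move=> [_ _ [c c0 H]]; exists c => //; apply: filterS H => y Hy phi psi aphi yphi apsi ypsi.
have /(conj_differentialP _ _ aphi yphi apsi ypsi) := Hy (omega (tau y)) (omega (tau y)).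
by rewrite tcZ.
Qed.

Lemma flat_transport_triv x (alpha : hom) omega : flat_hom_at q x alpha ->
  local_triv (tau x) omega -> local_triv x (transport alpha omega).
Proof.
move=> fa [ho o0]; split; first exact: flat_transport_hol.
have [c c0 /nbhs_singleton H] := flat_transport_tsqc omega fa.
have [phi aphi xphi] := exists_chart x; have [psi apsi xpsi] := exists_chart (tau x).
apply/eqP => b0; have := H phi psi aphi xphi apsi xpsi.
rewrite (@tsqc_scale phi x (transport alpha omega) (transport alpha omega) 0).
  rewrite expr0n mul0r mul0r rmorph0 => /eqP; rewrite mulf_eq0 (negbTE c0).
  by rewrite (negbTE (tsqc_neq0 apsi xpsi o0)).
by rewrite b0 scaler0.
Qed.

Lemma transport_smul x (alpha : hom) omega s h : flat_hom_at q x alpha ->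
  (\forall y \near tau x, s y = h y *: omega y) ->
  \forall y \near x, transport alpha s y = ctau h y *: transport alpha omega y.
Proof.
move=> fa sh; apply: (nearS2 (flat_hom_smul fa) (tau_near tauP sh)) => y H E.
by rewrite /transport /pullback_section E H.
Qed.

Lemma proj_frame_ctau x (alpha : hom) z omega : flat_hom_at q x alpha ->
  proj_frame (tau x) z omega -> proj_frame x (ctau z) (transport alpha omega).
Proof.
move=> fa [ho hz z0]; have [psi apsi xpsi] := exists_chart (tau x).
split; [exact: flat_transport_triv|exact (hol_at_conj_tau tauP hz)|].
move=> phi aphi xphi; rewrite (chart_deriv_conj_tau tauP aphi xphi apsi xpsi hz).
apply: mulf_neq0; last exact: (conj_deriv_neq0 tauP aphi xphi apsi xpsi).
by rewrite conjC_eq0; exact: z0.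
Qed.

(** The lift in coordinates, [a : b] |-> [conj a : conj b]. Transport replaces h and z by conj (h o
    tau) and conj (z o tau), whose derivatives acquire the same factor [conj_deriv]; it cancels in
    dh/dz. *)
Lemma jet_transport x (alpha : hom) z omega s (a b : C) : flat_hom_at q x alpha ->
  proj_frame (tau x) z omega -> hol_section (tau x) s ->
  jet (tau x) s = a *: jet (tau x) omega + b *: jet (tau x) (smul z omega) ->
  jet x (transport alpha s) = Num.conj a *: jet x (transport alpha omega)
    + Num.conj b *: jet x (smul (ctau z) (transport alpha omega)).
Proof.
move=> fa zo hs; have [ho hz z0] := zo; have [h hh sh] := triv_coord ho hs.
have [psi apsi xpsi] := exists_chart (tau x); have [phi aphi xphi] := exists_chart x.
rewrite (jet_eq hs sh) -/(smul h omega) (jet_smulE zo hh apsi xpsi).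
set D := _ / _ => E.
have [Da Db] : h (tau x) - D * z (tau x) - a = 0 /\ D - b = 0.
  apply: (jet_indep zo); rewrite !scalerBl addrACA -opprD -!scalerBl.
  by rewrite [X in X - _]E subrr.
have {Da}-> : a = h (tau x) - D * z (tau x) by apply/eqP; rewrite eq_sym -subr_eq0 Da.
have {Db}-> : b = D by apply/eqP; rewrite eq_sym -subr_eq0 Db.
have hh' := hol_at_conj_tau tauP hh.
have zo' := proj_frame_ctau fa zo.
rewrite (jet_eq (flat_transport_hol fa hs) (transport_smul fa sh)).
rewrite -/(smul (ctau h) _) (jet_smulE zo' hh' aphi xphi).
have -> : chart_deriv phi (ctau h) x / chart_deriv phi (ctau z) x = Num.conj D.
  rewrite /ctau (chart_deriv_conj_tau tauP aphi xphi apsi xpsi hh).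
  rewrite (chart_deriv_conj_tau tauP aphi xphi apsi xpsi hz) /D fmorph_div /=.
  by rewrite -mulf_div divff ?mulr1// (conj_deriv_neq0 tauP aphi xphi apsi xpsi).
by move: D {E} => D; rewrite rmorphB rmorphM.
Qed.

Lemma sq_const_near x (m : X -> C) (k : C) : hol_at x m -> m x != 0 ->
  (\forall y \near x, m y ^+ 2 = k) -> \forall y \near x, m y = m x.
Proof.
move=> hm m0 mk; have [phi aphi xphi] := exists_chart x.
apply: (chart_deriv0_near aphi xphi hm).
have H := nearS2 (hol_at_near hm) (chart_near_dom aphi xphi) (fun y a b => conj a b).
apply: (nearS3 H (hol_at_neq0 hm m0) (near_join mk)) => y [hy yphi] my mky.
have : chart_deriv phi (fun y => m y * m y) y = 0.
  rewrite (@chart_deriv_eq _ _ phi _ (fun=> k) y aphi yphi _ (hol_at_mul hy hy)).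
    exact: chart_deriv_cst.
  by apply: filterS mky => v; rewrite expr2.
rewrite (chart_deriv_mul aphi yphi hy hy) -mulr2n => /eqP.
by rewrite mulrn_eq0 /= mulf_eq0 (negbTE my) => /eqP.
Qed.

(** The quotient m of the two sections has m^2 constant, hence 2 m m' = 0 and m is locally
    constant. *)
Lemma tsqc_ratio x omega omega' phi (k : C) : local_triv x omega -> local_triv x omega' ->
  atlas phi -> cdom phi x ->
  (\forall y \near x, tsqc phi omega' y = k * tsqc phi omega y) ->
  exists2 m : C, m != 0 & \forall y \near x, omega' y = m *: omega y.
Proof.
move=> ho ho' aphi xphi H; have [m hm mE] := triv_coord ho (proj1 ho').
have m0 : m x != 0.
  have [_ +] := ho'; apply: contraNneq => m0.
  by rewrite (nbhs_singleton mE) m0 scale0r.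
exists (m x) => //.
have mc : \forall y \near x, m y = m x.
  apply: (sq_const_near hm m0 (k := k)).
  have H' := nearS2 H (chart_near_dom aphi xphi) (fun y a b => conj a b).
  apply: (nearS3 mE H' (local_triv_near ho)) => y E [+ yphi] [_ o0].
  rewrite (tsqc_scale _ E) => /eqP.
  by rewrite -subr_eq0 -mulrBl mulf_eq0 (negbTE (tsqc_neq0 aphi yphi o0)) orbF subr_eq0 => /eqP.
by apply: (nearS2 mE mc) => y -> ->.
Qed.

Lemma flat_unique x (alpha alpha' : hom) omega : flat_hom_at q x alpha ->
  flat_hom_at q x alpha' -> local_triv (tau x) omega ->
  exists2 m : C, m != 0 & \forall y \near x,
    transport alpha' omega y = m *: transport alpha omega y.
Proof.
move=> fa fa' ho; have [phi aphi xphi] := exists_chart x.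
have [psi apsi xpsi] := exists_chart (tau x).
have [c c0 H] := flat_transport_tsqc omega fa.
have [c' c0' H'] := flat_transport_tsqc omega fa'.
apply: (tsqc_ratio (k := Num.conj (c' / c)) (flat_transport_triv fa ho)
  (flat_transport_triv fa' ho) aphi xphi).
have D := nearS2 (chart_near_dom aphi xphi) (tau_near tauP (chart_near_dom apsi xpsi))
  (fun y a b => conj a b).
apply: (nearS3 H H' D) => y Hy Hy' [yphi ypsi].
have K0 := conj_deriv_neq0 tauP aphi yphi apsi ypsi.
have E := Hy phi psi aphi yphi apsi ypsi; have E' := Hy' phi psi aphi yphi apsi ypsi.
apply: (mulIf K0); apply: (inv_inj (@conjCK C)).
by rewrite -E' -[in RHS]mulrA rmorphM /= conjCK -E mulrA divfK.
Qed.

Definition fiber_coef x (u v : L x) : C := xget 0 [set a | v = a *: u].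

Lemma fiber_coefE x (u v : L x) (a : C) : u != 0 -> v = a *: u -> fiber_coef u v = a.
Proof.
move=> u0 va; rewrite /fiber_coef; case: xgetP => [b _ vb|/(_ a)//].
by apply: (fiber_inj u0); rewrite -vb -va.
Qed.

(** alpha sends the trivialisation [omega'] at tau x to m omega. Flatness with constant c = 1
    becomes m^2 = n / (tsqc phi omega * k), which a local square root solves. *)
Lemma exists_flat x : exists alpha : hom, flat_hom_at q x alpha.
Proof.
have [omega ho] := exists_local_triv L x.
have [omega' ho'] := exists_local_triv L (tau x).
have [phi aphi xphi] := exists_chart x; have [psi apsi xpsi] := exists_chart (tau x).
pose k := conj_deriv tau phi psi.
have hk : hol_at x k := hol_at_conj_deriv tauP aphi xphi apsi xpsi.
have k0 : k x != 0 := conj_deriv_neq0 tauP aphi xphi apsi xpsi.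
pose n := ctau (tsqc psi omega').
have hn : hol_at x n := hol_at_conj_tau tauP (tsqc_hol apsi xpsi (proj1 ho')).
have n0 : n x != 0 by rewrite /n /ctau conjC_eq0; exact: tsqc_neq0 apsi xpsi (proj2 ho').
have ht := tsqc_hol aphi xphi (proj1 ho); have t0 := tsqc_neq0 aphi xphi (proj2 ho).
have hr : hol_at x (fun y => n y / (tsqc phi omega y * k y)).
  by apply: hol_at_div (mulf_neq0 t0 k0); [exact: hn|exact: hol_at_mul].
have [|m hm mE] := hol_at_sqrt hr.
  by rewrite mulf_neq0// invr_neq0// mulf_neq0.
(* The coefficient is conjugated because alpha has to be linear on [conj_module]. Where [omega']
   vanishes the formula has no meaning, but this is away from tau x. *)
pose alpha : hom := fun y u =>
  (Num.conj (fiber_coef (omega' (tau y)) (u : L (tau y))) * m y) *: omega y.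
have o1 := tau_near tauP (local_triv_near ho').
have key : \forall y \near x, forall (a : C),
    alpha y (a *: omega' (tau y) : L (tau y)) = (Num.conj a * m y) *: omega y.
  by apply: filterS o1 => y [_ o0] a; rewrite /alpha (fiber_coefE o0 erefl).
exists alpha; split.
- apply: (nearS2 o1 key) => y [_ o0] ky a u v.
  have [b ub] := fiber_coord (u : L (tau y)) o0; have [c vc] := fiber_coord (v : L (tau y)) o0.
  have -> : (a *: u + v) = (Num.conj a * b + c) *: omega' (tau y) :> L (tau y).
    by rewrite scalerDl -scalerA -ub -vc.
  rewrite ub vc !ky scalerA -scalerDl rmorphD rmorphM /= conjCK.
  by congr (_ *: _); ring.
- have H := nearS2 (local_triv_near ho) (hol_at_near hm) (fun y a b => conj a b).
  apply: (nearS3 H o1 (near_join key)) => y [hoy hmy] hoy' ky t ht'.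
  have [e Fe ye] := exists_frame L (tau y).
  have Ft : frames (conj_pullback tau L) (LocalFrame (tau @^-1` fdom e)
    (fun i x => fvec e i (tau x) : conj_module (L (tau x)))) by exists e.
  have [c [hc tE]] := ht' _ Ft ye.
  have he := local_triv_frame Fe ye.
  have [d hd eE] := triv_coord hoy' (proj1 he).
  apply: hol_section_eq (hol_section_smul (hol_at_mul (hol_at_mul (hc ord0)
    (hol_at_conj_tau tauP hd)) hmy) (proj1 hoy)).
  apply: (nearS3 tE (tau_near tauP eE) ky) => v E1 E2 kv.
  have -> : t v = (Num.conj (c ord0 v) * d (tau v)) *: omega' (tau v) :> L (tau v).
    by rewrite E1 big_ord1 /= -[LHS]/((_)^* *: (fvec e ord0 (tau v))) E2 scalerA.
  by rewrite kv rmorphM /= conjCK.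
exists 1; first exact: oner_neq0.
have D := nearS2 (chart_near_dom aphi xphi) (tau_near tauP (chart_near_dom apsi xpsi))
  (fun y a b => conj a b).
have D2 := nearS2 o1 (local_triv_near ho) (fun y a b => conj a b).
have D3 := nearS2 key mE (fun y a b => conj a b).
have D4 := nearS2 D (hol_at_neq0 hk k0) (fun y a b => conj a b).
apply: (nearS3 D4 D2 D3) => y [[yphi ypsi] ky0] [[_ o0'] [_ o0]] [ky my] u v.
have [b ub] := fiber_coord (u : L (tau y)) o0'; have [c vc] := fiber_coord (v : L (tau y)) o0'.
apply/(conj_differentialP _ _ aphi yphi apsi ypsi).
rewrite ub vc !ky !tsqZ !tcZ mul1r -/(tsqc psi omega' (tau y)) -/(tsqc phi omega y).
rewrite -/(k y).
have tn := tsqc_neq0 aphi yphi o0.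
have -> : tsqc psi omega' (tau y) = Num.conj (m y ^+ 2 * (tsqc phi omega y * k y)).
  by rewrite my divfK ?mulf_neq0// /n /ctau conjCK.
move: (m y) (tsqc phi omega y) (k y) => m1 t1 k1.
by rewrite expr2 !rmorphM /= !conjCK; ring.
Qed.

Local Notation PJ x := (pspace (jet_bundle L x)).

Lemma transport_unique x (alpha alpha' : hom) s : flat_hom_at q x alpha ->
  flat_hom_at q x alpha' -> hol_section (tau x) s ->
  exists2 m : C, m != 0 & jet x (transport alpha' s) = m *: jet x (transport alpha s).
Proof.
move=> fa fa' hs; have [omega ho] := exists_local_triv L (tau x).
have [h hh sh] := triv_coord ho hs.
have [m m0 mE] := flat_unique fa fa' ho; exists m => //.
rewrite -(jetZ m (flat_transport_hol fa hs)).
apply: (jet_eq (flat_transport_hol fa' hs)).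
apply: (nearS3 (transport_smul fa sh) (transport_smul fa' sh) mE) => y -> -> ->.
by rewrite !scalerA mulrC.
Qed.

Lemma transport_neq0 x (alpha : hom) s : flat_hom_at q x alpha -> hol_section (tau x) s ->
  jet (tau x) s != 0 -> jet x (transport alpha s) != 0.
Proof.
move=> fa hs; have [omega ho] := exists_local_triv L (tau x).
have [psi apsi xpsi] := exists_chart (tau x).
have zo := proj_frame_chart apsi xpsi ho.
have [g1 [g2 [_ _ /nbhs_singleton E]]] := jet_coords zo hs.
rewrite (jet_transport fa zo hs E) => s0.
apply: (jet_omega_neq0 (proj_frame_ctau fa zo)).
apply: contraNneq s0 => -[/eqP a0 /eqP b0].
rewrite conjC_eq0 in a0; rewrite conjC_eq0 in b0.
by rewrite E (eqP a0) (eqP b0) !scale0r addr0.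
Qed.

Lemma transport_jetZ x (alpha : hom) s t (k : C) : flat_hom_at q x alpha ->
  hol_section (tau x) s -> hol_section (tau x) t -> jet (tau x) t = k *: jet (tau x) s ->
  jet x (transport alpha t) = Num.conj k *: jet x (transport alpha s).
Proof.
move=> fa hs ht E; have [omega ho] := exists_local_triv L (tau x).
have [psi apsi xpsi] := exists_chart (tau x).
have zo := proj_frame_chart apsi xpsi ho.
have [g1 [g2 [_ _ /nbhs_singleton Es]]] := jet_coords zo hs.
rewrite (jet_transport fa zo hs Es).
move: E; rewrite Es scalerDr !scalerA => /(jet_transport fa zo ht) ->.
by rewrite !rmorphM scalerDr !scalerA.
Qed.

(** The line is defined by one section and one alpha. Another section with jet in p multiplies the
    transported jet by a conjugated scalar, another alpha by a constant, so the line is the same. *)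
Lemma exists_lift x (p : PJ x) : exists p' : PJ (tau x), forall s (alpha : hom),
  hol_section x s -> spans (jet x s : jet_bundle L x) p -> flat_hom_at q (tau x) alpha ->
  spans (jet (tau x) (transport alpha s) : jet_bundle L (tau x)) p'.
Proof.
have [v vp] := spans_ex p; have [s0 hs0 vE] := jet_surj v; rewrite vE in vp.
have [alpha0 fa0] := exists_flat (tau x).
have K := tauK tauP x.
(* The transport lemmas at tau x take their hypotheses at [tau (tau x)]. *)
have hs0' : hol_section (tau (tau x)) s0 by rewrite K.
have s00 : jet (tau (tau x)) s0 != 0 by rewrite K; case: vp.
exists (pline (transport_neq0 fa0 hs0' s00)) => s alpha hs sp fa.
have [k k0 E] := spans_prop vp sp.
have hs' : hol_section (tau (tau x)) s by rewrite K.
have E' : jet (tau (tau x)) s = k *: jet (tau (tau x)) s0 by rewrite K.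
have [m m0 mE] := transport_unique fa0 fa hs'.
rewrite mE (transport_jetZ fa0 hs0' hs' E') scalerA.
by apply: spans_scale; [rewrite mulf_neq0// conjC_eq0|exact: spans_pline].
Qed.

Lemma exists_canonical_lift : exists F : forall x, PJ x -> PJ (tau x),
  unique (canonical_lift q) F.
Proof.
pose F x (p : PJ x) := projT1 (cid (exists_lift p)).
have FP : canonical_lift q F.
  move=> x s alpha p hs sp fa; rewrite /F.
  by case: cid => p' /= H; exact: H hs sp fa.
exists F; split=> // F' FP'.
apply: functional_extensionality_dep => x; apply: functional_extensionality_dep => p.
have [v vp] := spans_ex p; have [s hs vE] := jet_surj v; rewrite vE in vp.
have [alpha fa] := exists_flat (tau x).
exact: pspace_eq (FP _ _ _ _ hs vp fa) (FP' _ _ _ _ hs vp fa).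
Qed.

(** Points over base points that are merely provably equal are compared through the jets of one
    global section, which avoids casts between fibres. *)
Lemma ptotal_eq (P Q : ptotal (jet_bundle L)) s : projT1 P = projT1 Q ->
  spans (jet (projT1 P) s : jet_bundle L _) (projT2 P) ->
  spans (jet (projT1 Q) s : jet_bundle L _) (projT2 Q) -> P = Q.
Proof.
case: P Q => x p [y p'] /= xy; subst y => sp sp'.
by rewrite (pspace_eq sp sp').
Qed.

(** Combining the square equations of both transports, the factors [conj_deriv] at x and at tau x
    cancel by [conj_deriv_tau]; the squares have constant ratio c conj c2, so omega returns to a
    constant multiple of itself. *)
Lemma transport_involution x (alpha alpha2 : hom) s : flat_hom_at q (tau x) alpha ->
  flat_hom_at q (tau (tau x)) alpha2 -> hol_section x s ->
  exists2 m : C, m != 0 &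
    \forall y \near x, transport alpha2 (transport alpha s) y = m *: s y.
Proof.
move=> fa fa2 hs; have K := tauK tauP.
have [omega ho] := exists_local_triv L x; have [h hh sh] := triv_coord ho hs.
have ho1 : local_triv (tau (tau x)) omega by rewrite K.
pose b := transport alpha omega; pose b2 := transport alpha2 b.
have hb : local_triv (tau x) b := flat_transport_triv fa ho1.
have hb' : local_triv (tau (tau (tau x))) b by rewrite [tau (tau (tau x))]K.
have hb2 : local_triv x b2 by have := flat_transport_triv fa2 hb'; rewrite K.
have [c c0 H] := flat_transport_tsqc omega fa.
have [c2 c20 H2] := flat_transport_tsqc b fa2.
rewrite K in H2.
have [phi aphi xphi] := exists_chart x; have [psi apsi xpsi] := exists_chart (tau x).
have [m m0 mE] : exists2 m : C, m != 0 & \forall y \near x, b2 y = m *: omega y.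
  apply: (tsqc_ratio (k := c * Num.conj c2) ho hb2 aphi xphi).
  have D := nearS2 (chart_near_dom aphi xphi) (tau_near tauP (chart_near_dom apsi xpsi))
    (fun y a b => conj a b).
  apply: (nearS3 H2 (tau_near tauP H) D) => y Hy2 Hy [yphi ypsi].
  have yphi' : cdom phi (tau (tau y)) by rewrite K.
  have E2 := Hy2 phi psi aphi yphi apsi ypsi.
  have E1 := Hy psi phi apsi ypsi aphi yphi'.
  rewrite K in E1.
  have KK := conj_deriv_tau tauP aphi yphi apsi ypsi.
  rewrite mulrAC E1 -rmorphM mulrAC [tsqc psi _ _ * c2]mulrC E2 rmorphM /= conjCK.
  by rewrite -mulrA [conj_deriv _ _ _ _ * _]mulrC KK mulr1.
exists m => //.
have sh1 : \forall y \near tau (tau x), s y = h y *: omega y by rewrite K.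
have sh2 := transport_smul fa sh1.
have sh2' : \forall y \near tau (tau (tau x)), transport alpha s y = ctau h y *: b y.
  by rewrite [tau (tau (tau x))]K.
have := transport_smul fa2 sh2'; rewrite K => sh3.
apply: (nearS3 sh3 sh mE) => y -> -> E.
by rewrite -/b2 E /ctau conjCK K !scalerA mulrC.
Qed.

Lemma canonical_lift_involutive (F : forall x, PJ x -> PJ (tau x)) :
  canonical_lift q F -> involutive (total_map F).
Proof.
move=> FP [x p]; have K := tauK tauP.
have [v vp] := spans_ex p; have [s hs vE] := jet_surj v; rewrite vE in vp.
have [alpha fa] := exists_flat (tau x).
have [alpha2 fa2] := exists_flat (tau (tau x)).
have hs' : hol_section (tau (tau x)) s by rewrite K.
have h1 := flat_transport_hol fa hs'.
have sp1 := FP _ _ _ _ hs vp fa.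
have sp2 := FP _ _ _ _ h1 sp1 fa2.
have [m m0 mE] := transport_involution fa fa2 hs.
have h1' : hol_section (tau (tau (tau x))) (transport alpha s) by rewrite [tau (tau (tau x))]K.
have h2 := flat_transport_hol fa2 h1'.
apply: (ptotal_eq (s := transport alpha2 (transport alpha s))) => /=; first exact: K.
  exact: sp2.
have -> : jet x (transport alpha2 (transport alpha s)) = m *: jet x s.
  rewrite -(jetZ m hs); apply: (jet_eq _ mE).
  by rewrite K in h2.
exact: spans_scale.
Qed.

Lemma lift_spans (F : forall x, PJ x -> PJ (tau x)) x (alpha : hom) z omega (a b : C) (p : PJ x) :
  canonical_lift q F -> flat_hom_at q (tau x) alpha -> proj_frame x z omega ->
  spans (a *: jet x omega + b *: jet x (smul z omega) : jet_bundle L x) p ->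
  spans (Num.conj a *: jet (tau x) (transport alpha omega) +
    Num.conj b *: jet (tau x) (smul (ctau z) (transport alpha omega)) : jet_bundle L (tau x))
    (F x p).
Proof.
move=> FP fa zo sp; have [ho hz z0] := zo; have K := tauK tauP.
(* The section (b z + a) omega has the given combination as its jet, so the defining property of the
   lift applies to it. *)
have hab : hol_at x (fun y => b * z y + a) by hol_at_tac.
have hs := hol_section_smul hab (proj1 ho).
have [phi aphi xphi] := exists_chart x.
have E : jet x (smul (fun y => b * z y + a) omega) =
    a *: jet x omega + b *: jet x (smul z omega).
  rewrite (jet_smulE zo hab aphi xphi).
  rewrite (chart_deriv_lin b aphi xphi hz (hol_at_cst _)) chart_deriv_cst addr0.
  by rewrite mulfK ?z0// addrAC subrr add0r.
rewrite -E in sp.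
have := FP _ _ _ _ hs sp fa.
have zo' : proj_frame (tau (tau x)) z omega by rewrite K.
have hs' : hol_section (tau (tau x)) (smul (fun y => b * z y + a) omega) by rewrite K.
have E' : jet (tau (tau x)) (smul (fun y => b * z y + a) omega) =
    a *: jet (tau (tau x)) omega + b *: jet (tau (tau x)) (smul z omega) by rewrite K.
by rewrite -/(transport alpha _) (jet_transport fa zo' hs' E').
Qed.

End Lift.

(** * Projective structures *)

Section Moebius.
Context {R : realType} {X : riemann_surface (cplx R)}.
Local Notation C := (cplx R).
Implicit Types (f g : X -> pspace 'rV[C]_2) (x y : X) (u v : X -> 'rV[C]_2) (z : X -> C).

Definition moebius_near x f g := exists2 A : 'M[C]_2, A \in unitmx &
  \forall y \near x, line (g y) = [set w *m A | w in line (f y)].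

Lemma moebius_near_eq x f g : (\forall y \near x, f y = g y) -> moebius_near x f g.
Proof.
move=> fg; exists 1%:M; first exact: unitmx1.
apply: filterS fg => y ->; apply/seteqP; split=> [w gw|_ [w gw <-]].
  by exists w => //; rewrite mulmx1.
by rewrite mulmx1.
Qed.

Lemma moebius_near_sym x f g : moebius_near x f g -> moebius_near x g f.
Proof.
move=> [A Au H]; exists (invmx A); first by rewrite unitmx_inv.
apply: filterS H => y ->; apply/seteqP; split=> [w fw|_ [_ [w fw <-] <-]].
  by exists (w *m A); [exists w|rewrite mulmxK].
by rewrite mulmxK.
Qed.

Lemma moebius_near_trans x f g h : moebius_near x f g -> moebius_near x g h ->
  moebius_near x f h.
Proof.
move=> [A Au H] [B Bu H']; exists (A *m B); first by rewrite unitmx_mul Au.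
apply: (nearS2 H H') => y fg ->; rewrite fg; apply/seteqP; split.
  by move=> _ [_ [w fw <-] <-]; exists w => //; rewrite mulmxA.
by move=> _ [w fw <-]; exists (w *m A); [exists w|rewrite mulmxA].
Qed.

Lemma moebius_nearP x f g u v : (\forall y \near x, spans (u y) (f y)) ->
  (\forall y \near x, spans (v y) (g y)) ->
  moebius_near x f g <-> exists2 A : 'M[C]_2, A \in unitmx &
    \forall y \near x, exists2 k : C, k != 0 & v y = k *: (u y *m A).
Proof.
move=> uf vg; split=> -[A Au H]; exists A => //.
  apply: (nearS3 uf vg H) => y uy vy E.
  have : line (g y) (v y) by case: vy.
  rewrite E (spans_line uy) => -[_ [k _ <-] kv].
  exists k; last by rewrite -kv -scalemxAl.
  apply: contraTneq (proj1 vy) => k0.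
  by rewrite -kv k0 scale0r mul0mx eqxx.
apply: (nearS3 uf vg H) => y uy vy [k k0 E].
rewrite (spans_line uy) (spans_line vy) E; apply/seteqP; split.
  move=> _ [a _ <-]; exists ((a * k) *: u y); first by exists (a * k).
  by rewrite -scalemxAl scalerA.
move=> _ [_ [a _ <-] <-]; exists (a / k) => //.
by rewrite scalerA divfK// -scalemxAl.
Qed.

Lemma spans_scaled_mulmx (A : 'M[C]_2) (r r' : 'rV[C]_2) (a b : C) p : A \in unitmx ->
  a != 0 -> b != 0 -> a^-1 *: (r *m A) = b^-1 *: (r' *m A) -> spans r' p -> spans r p.
Proof.
move=> Au a0 b0; rewrite !scalemxAl => E; have {}E := can_inj (mulmxK Au) E.
have -> : r = (a / b) *: r' by rewrite -scalerA -E scalerA divff ?scale1r.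
by apply: spans_scale; rewrite mulf_neq0 ?invr_eq0.
Qed.

Definition affine_row z y : 'rV[C]_2 := \row_(i < 2) (if i == 0 then z y else 1).

Lemma affine_row_neq0 z y : affine_row z y != 0.
Proof.
apply/eqP => /rowP/(_ ord_max); rewrite !mxE /= => /eqP; exact/negP/oner_neq0.
Qed.

Definition affine_point z y : pspace 'rV[C]_2 := pline (affine_row_neq0 z y).

Lemma affine_point_spans z y : spans (affine_row z y) (affine_point z y).
Proof. exact: spans_pline. Qed.

Lemma affine_row_eq z z' x y : z x = z' y -> affine_row z x = affine_row z' y.
Proof. by move=> E; apply/rowP => i; rewrite !mxE E. Qed.

Lemma affine_point_inj z z' x y : affine_point z x = affine_point z' y -> z x = z' y.
Proof.
move=> E; have := affine_point_spans z' y; rewrite -E => s'.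
have [k k0 /rowP H] := spans_prop (affine_point_spans z x) s'.
have := H ord0; have := H ord_max; rewrite !mxE /= mulr1 => <-.
by rewrite mul1r => ->.
Qed.

Lemma row2P (a b : 'rV[C]_2) : a 0 ord0 = b 0 ord0 -> a 0 ord_max = b 0 ord_max -> a = b.
Proof.
move=> h0 h1; apply/rowP => -[[|[|//]] i].
- by have -> : Ordinal i = ord0 by exact: val_inj.
- by have -> : Ordinal i = ord_max by exact: val_inj.
Qed.

Lemma affine_row0 z y : affine_row z y 0 ord0 = z y.
Proof. by rewrite mxE. Qed.

Lemma affine_row1 z y : affine_row z y 0 ord_max = 1.
Proof. by rewrite mxE. Qed.

Lemma mulrow2E (a : 'rV[C]_2) (A : 'M[C]_2) i :
  (a *m A) 0 i = a 0 ord0 * A ord0 i + a 0 ord_max * A ord_max i.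
Proof. rewrite mxE big_ord_recl big_ord1; congr (_ + a _ _ * A _ _); exact: val_inj. Qed.

Lemma det2E (A : 'M[C]_2) :
  \det A = A ord0 ord0 * A ord_max ord_max - A ord0 ord_max * A ord_max ord0.
Proof.
rewrite (expand_det_row A ord0) big_ord_recl big_ord1 /cofactor !det_mx11 !mxE /=.
rewrite expr0 expr1 mul1r mulN1r mulrN.
by congr (_ * A _ _ - A _ _ * A _ _); exact: val_inj.
Qed.

Lemma unitmx2E (A : 'M[C]_2) : (A \in unitmx) = (\det A != 0).
Proof. by rewrite unitmxE unitfE. Qed.

(** Cleared of the denominator, which is then nonzero of itself by [moebius_denom_neq0]. *)
Definition moebius_rel x z z' (a b c d : C) := a * d - b * c != 0 /\
  \forall y \near x, z' y * (c * z y + d) = a * z y + b.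

Lemma moebius_denom_neq0 (a b c d z z' : C) : a * d - b * c != 0 ->
  z' * (c * z + d) = a * z + b -> c * z + d != 0.
Proof.
move=> D E; apply: contraNneq D => e0; move: E; rewrite e0 mulr0 => E.
have -> : a * d - b * c = a * (c * z + d) - c * (a * z + b) by ring.
by rewrite e0 -E !mulr0 subr0.
Qed.

Lemma moebius_affineP x z z' : moebius_near x (affine_point z) (affine_point z') <->
  exists a b c d, moebius_rel x z z' a b c d.
Proof.
have S (w : X -> C) : \forall y \near x, spans (affine_row w y) (affine_point w y).
  by near=> y; exact: affine_point_spans.
apply: iff_trans (moebius_nearP (S z) (S z')) _; split.
  (* Matrices act on rows from the right, so (a, b) and (c, d) are the columns of [A]. *)
  move=> [A Au H]; exists (A ord0 ord0), (A ord_max ord0), (A ord0 ord_max), (A ord_max ord_max).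
  split; first by move: Au; rewrite unitmx2E det2E [A ord0 ord_max * _]mulrC.
  apply: filterS H => y [k k0 E].
  have Ei i : affine_row z' y 0 i = k * (z y * A ord0 i + A ord_max i).
    by rewrite E mxE mulrow2E affine_row0 affine_row1 mul1r.
  have := Ei ord0; have := Ei ord_max; rewrite affine_row0 affine_row1 => E1 ->.
  rewrite -[RHS]mul1r E1; ring.
move=> [a [b [c [d [D H]]]]].
pose A : 'M[C]_2 := \matrix_(i, j) (if i == ord0 then if j == ord0 then a else c
                                     else if j == ord0 then b else d).
exists A; first by rewrite unitmx2E det2E !mxE /= [c * b]mulrC.
apply: filterS H => y E; have n0 := moebius_denom_neq0 D E.
exists (c * z y + d)^-1; first by rewrite invr_eq0.
apply: row2P; rewrite [RHS]mxE mulrow2E !affine_row0 !affine_row1 !mxE /=.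
  by rewrite mul1r [z y * a]mulrC -E mulrC mulfK.
by rewrite mul1r [z y * c]mulrC mulVf.
Unshelve. all: by end_near. Qed.

End Moebius.

(** * Projective coordinates with values in the affine line *)

Section ProjectiveCoordinates.
Context {R : realType} {X : riemann_surface (cplx R)} (S : projective_structure X).
Local Notation C := (cplx R).
Implicit Types (f g : X -> pspace 'rV[C]_2) (x y : X) (u v : @coordinate C X) (z : X -> C)
  (U V : set X).

Lemma moebius_compatible_sym u v : moebius_compatible u v -> moebius_compatible v u.
Proof. by move=> H x vx ux; exact: moebius_near_sym (H x ux vx). Qed.

Lemma moebius_compatible_refl u : moebius_compatible u u.
Proof. by move=> x ux _; apply: moebius_near_eq; near=> y. Unshelve. all: by end_near. Qed.

Lemma exists_atlas : exists P : set (@coordinate C X), [/\ projective_atlas P,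
  forall u, P u -> projective_coordinate S u &
  forall v, projective_coordinate S v <->
    hol_coordinate v /\ forall u, P u -> moebius_compatible u v].
Proof.
have [P PA SE] := ps_classP S; have [Ph Pc Pm] := PA; exists P.
have main v : projective_coordinate S v <->
    hol_coordinate v /\ forall u, P u -> moebius_compatible u v.
  rewrite /projective_coordinate SE; split=> [[Q [[Qh _ _] [_ _ PQm]] Qv]|[hv vP]].
    split; first exact: Qh.
    by move=> u Pu; apply: PQm; [left|right].
  have Vm u w : (P u \/ u = v) -> (P w \/ w = v) -> moebius_compatible u w.
    move=> [Pu|->] [Pw|->]; [exact: Pm|exact: vP|exact: moebius_compatible_sym (vP _ _)|].
    exact: moebius_compatible_refl.
  have Vh u : P u \/ u = v -> hol_coordinate u by move=> [/Ph//|->].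
  exists (P `|` [set v]); last by right.
  split; split.
  - by move=> u [Pu|->]; [exact: Ph|].
  - by move=> x; have [u Pu ux] := Pc x; exists u => //; left.
  - by move=> u w uP wP; apply: Vm.
  - by move=> u [Pu|uP]; [exact: Ph|exact: Vh].
  - by move=> x; have [u Pu ux] := Pc x; exists u => //; left.
  - have E (u : @coordinate C X) : (P `|` (P `|` [set v])) u -> P u \/ u = v.
      by move=> [Pu|//]; left.
    by move=> u w /E uP /E wP; apply: Vm.
by split=> // u Pu; apply/main; split; [exact: Ph|move=> w Pw; exact: Pm].
Qed.

Lemma projective_coordinate_hol v : projective_coordinate S v -> hol_coordinate v.
Proof. by have [P [_ _ H]] := exists_atlas; move=> /H[]. Qed.

Lemma projective_coordinate_compatible u v : projective_coordinate S u ->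
  projective_coordinate S v -> moebius_compatible u v.
Proof.
have [P [[_ Pc _] _ H]] := exists_atlas; move=> /H[_ Hu] /H[_ Hv] x ux vx.
have [w Pw wx] := Pc x.
exact: moebius_near_trans (moebius_near_sym (Hu w Pw x wx ux)) (Hv w Pw x wx vx).
Qed.

(** Makes membership a local matter: near each point, comparison with a single projective coordinate
    is enough. *)
Lemma projective_coordinateP v : projective_coordinate S v <-> hol_coordinate v /\
  forall x, v.1 x -> exists u, [/\ projective_coordinate S u, u.1 x & moebius_near x u.2 v.2].
Proof.
have [P [[Ph Pc Pm] HP H]] := exists_atlas; split=> [Sv|[hv vH]].
  split; first exact: projective_coordinate_hol.
  move=> x vx; have [u Pu ux] := Pc x; exists u; split=> //; first exact: HP.
  exact: (projective_coordinate_compatible (HP _ Pu) Sv).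
apply/H; split=> // u Pu x ux vx; have [w [Sw wx wv]] := vH x vx.
apply: moebius_near_trans wv; exact: (projective_coordinate_compatible (HP _ Pu) Sw).
Qed.

Lemma open_near U x : open U -> U x -> \forall y \near x, U y.
Proof. by move=> oU Ux; apply: open_nbhs_nbhs; split. Qed.

Lemma affine_coordinateP U z : affine_coordinate S U z <->
  projective_coordinate S (U, affine_point z).
Proof.
split=> [[phi Sphi H]|Sz]; last by exists (affine_point z) => // x _; exact: affine_point_spans.
have E x : U x -> phi x = affine_point z x.
  by move=> Ux; exact: pspace_eq (H x Ux) (affine_point_spans _ _).
have [[oU iU hU] vH] := proj1 (projective_coordinateP _) Sphi.
apply/projective_coordinateP; split.
  split; [exact: oU| |].
    move=> x y Ux Uy; rewrite /= -!E; [exact: (iU x y Ux Uy)|by rewrite inE in Uy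
      |by rewrite inE in Ux].
  move=> x Ux; have [f hf fs] := hU x Ux; exists f => //.
  by apply: (nearS2 fs (open_near oU Ux)) => y + Uy; rewrite -/(affine_point z y) /= -E.
move=> x Ux; have [u [Su ux uv]] := vH x Ux; exists u; split=> //.
apply: moebius_near_trans uv (moebius_near_eq _).
by apply: filterS (open_near oU Ux) => y Uy; exact: E.
Qed.

Lemma affine_coordinate_open U z : affine_coordinate S U z -> open U.
Proof. by move=> /affine_coordinateP/projective_coordinate_hol[]. Qed.

Lemma affine_coordinate_hol U z x : affine_coordinate S U z -> U x -> hol_at x z.
Proof.
move=> /affine_coordinateP/projective_coordinate_hol[oU _ hU] Ux.
have [f hf fs] := hU x Ux.
have E : \forall y \near x, f y 0 ord_max != 0 /\ z y = f y 0 ord0 / f y 0 ord_max.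
  apply: filterS fs => y fy; have [k k0 E] := spans_prop fy (affine_point_spans z y).
  have := congr1 (fun r : 'rV[C]_2 => r 0 ord0) E.
  have := congr1 (fun r : 'rV[C]_2 => r 0 ord_max) E.
  rewrite affine_row0 affine_row1 !mxE => e1 ->.
  have n0 : f y 0 ord_max != 0.
    by apply/eqP => f0; move/eqP: e1; rewrite f0 mulr0 oner_eq0.
  by split=> //; apply: (mulIf n0); rewrite divfK// mulrAC -e1 mul1r.
apply: hol_at_eq (hol_at_div (hf ord0) (hf ord_max) (proj1 (nbhs_singleton E))).
by apply: filterS E => y [_ ->].
Qed.

Lemma affine_coordinate_inj U z : affine_coordinate S U z -> set_inj U z.
Proof.
move=> /affine_coordinateP/projective_coordinate_hol[_ iU _] x y Ux Uy E.
apply: (iU x y Ux Uy); apply: pspace_eq (affine_point_spans z x) _.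
rewrite (affine_row_eq E); exact: affine_point_spans.
Qed.

Lemma affine_point_hol_coordinate U z : open U -> set_inj U z ->
  (forall x, U x -> hol_at x z) -> hol_coordinate (U, affine_point z).
Proof.
move=> oU iU hU; split.
- exact: oU.
- by move=> x y Ux Uy /affine_point_inj; exact: iU.
move=> x Ux; exists (affine_row z); last by near=> y; exact: affine_point_spans.
move=> i; have [i0|i0] := eqVneq i 0.
  by apply: hol_at_eq (hU x Ux); near=> y; rewrite mxE i0.
by apply: hol_at_eq (@hol_at_cst _ _ x 1); near=> y; rewrite mxE (negbTE i0).
Unshelve. all: by end_near. Qed.

Lemma affine_coordinate_neq0 U z x phi : affine_coordinate S U z -> U x ->
  atlas phi -> cdom phi x -> chart_deriv phi z x != 0.
Proof.
move=> Sz Ux aphi xphi; have oU := affine_coordinate_open Sz.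
have hz := affine_coordinate_hol Sz Ux.
have N := nearS3 (hz _ aphi xphi) (chart_near_image aphi xphi)
  (proj1 (chart_near _ aphi xphi) (open_near oU Ux)) (fun w a b c => conj (conj a b) c).
move: N => /nearCP[r r0 Hr].
apply: (@injective_derive_neq0 _ _ _ r r0) => [w wr|w w' wr wr' /= E].
  (* What remains is injectivity in the chart, which comes from that of the projective
     coordinate. *)
  by have [[]] := Hr w wr.
have [[_ [wd wE]] wU] := Hr w wr; have [[_ [wd' wE']] wU'] := Hr w' wr'.
rewrite -wE -wE'; congr (cmap phi _); apply: (affine_coordinate_inj Sz); by rewrite ?inE.
Qed.

Lemma affine_coordinate_restrict U V z : affine_coordinate S U z -> open V -> V `<=` U ->
  affine_coordinate S V z.
Proof.
move=> /affine_coordinateP/projective_coordinateP[[oU iU hU] H] oV VU.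
apply/affine_coordinateP/projective_coordinateP; split.
  split; [exact: oV| |].
    by move=> x y; rewrite !inE => /VU Vx /VU Vy; apply: (iU x y); rewrite inE.
  by move=> x /VU; exact: hU.
by move=> x /VU; exact: H.
Qed.

Lemma affine_coordinate_moebius U U' z z' x : affine_coordinate S U z ->
  affine_coordinate S U' z' -> U x -> U' x -> exists a b c d, moebius_rel x z z' a b c d.
Proof.
move=> /affine_coordinateP Sz /affine_coordinateP Sz' Ux Ux'.
by apply/moebius_affineP; exact: (projective_coordinate_compatible Sz Sz').
Qed.

Lemma exists_affine_coordinate x : exists U z, affine_coordinate S U z /\ U x.
Proof.
have [P [[_ Pc _] HP _]] := exists_atlas; have [u Pu ux] := Pc x.
have Su := HP u Pu; have [oU iU hU] := projective_coordinate_hol Su.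
have [f hf fs] := hU x ux.
(* If the coordinate takes the value infinity at x, the homogeneous coordinates are interchanged. *)
have [A Au A0] : exists2 A : 'M[C]_2, A \in unitmx & (f x *m A) 0 ord_max != 0.
  have [f0|f0] := eqVneq (f x 0 ord_max) 0.
    pose A : 'M[C]_2 := \matrix_(i, j) (i != j)%:R; exists A.
      by rewrite unitmx2E det2E !mxE /= mulr0 mulr1 sub0r oppr_eq0 oner_eq0.
    rewrite mulrow2E !mxE /= f0 mul0r addr0 mulr1.
    apply: contraNneq (proj1 (nbhs_singleton fs)) => f1.
    by apply/eqP; apply: row2P; rewrite ?f0 ?f1 mxE.
  by exists 1%:M; [exact: unitmx1|rewrite mulmx1].
pose F (i : 'I_2) (y : X) : C := (f y *m A) 0 i.
have hF i : hol_at x (F i).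
  apply: hol_at_eq (hol_at_add (hol_at_mul (hf ord0) (@hol_at_cst _ _ x (A ord0 i)))
    (hol_at_mul (hf ord_max) (@hol_at_cst _ _ x (A ord_max i)))).
  by near=> y; rewrite /F mulrow2E.
pose z y := F ord0 y / F ord_max y.
have G := nearS3 fs (hol_at_neq0 (hF ord_max) A0) (open_near oU ux)
  (fun y a b c => conj a (conj b c)).
have hz : hol_at x z := hol_at_div (hF ord0) (hF ord_max) A0.
have [V [oV cV Vx VP]] := chart_nbhs_connected (nearS2 G (hol_at_near hz)
  (fun y a b => conj a b)).
have zE y : V y -> affine_row z y = (F ord_max y)^-1 *: (f y *m A).
  move=> /VP[[_ [n0 _]] _]; apply: row2P; rewrite ?affine_row0 ?affine_row1 mxE.
    by rewrite mulrC.
  by rewrite mulVf.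
exists V, z; split; last exact: Vx.
apply/affine_coordinateP/projective_coordinateP; split.
  apply: affine_point_hol_coordinate; first exact: oV; last by move=> y /VP[_].
  move=> y y'; rewrite !inE => Vy Vy' E.
  have [[sy [n0 uy]] _] := VP y Vy; have [[sy' [n0' uy']] _] := VP y' Vy'.
  apply: iU; rewrite ?inE; [exact: uy|exact: uy'|apply: pspace_eq sy _].
  have E2 : affine_row z y = affine_row z y' := affine_row_eq E.
  rewrite (zE y Vy) (zE y' Vy') in E2.
  exact (spans_scaled_mulmx Au n0 n0' E2 sy').
move=> y Vy; exists u; have [[_ [_ uy]] _] := VP y Vy; split=> //.
have Vn := open_near oV Vy.
apply/(@moebius_nearP _ _ y _ _ f (affine_row z)).
- by apply: filterS Vn => y' /VP[[]].
- by near=> y'; exact: affine_point_spans.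
exists A => //; apply: filterS Vn => y' Vy'; exists (F ord_max y')^-1; last exact: zE.
by rewrite invr_eq0; have [[_ []]] := VP y' Vy'.
Unshelve. all: by end_near. Qed.

End ProjectiveCoordinates.

(** * The connection of a projective structure *)

Section Connectedness.

Lemma connected_locally_constant (T : topologicalType) (V : set T) (Q : T -> Prop) (x0 : T) :
  connected V -> open V -> V x0 ->
  (forall x, V x -> \forall y \near x, Q y <-> Q x) -> Q x0 -> forall x, V x -> Q x.
Proof.
move=> cV oV Vx0 H Qx0.
have oA (P : T -> Prop) : (forall x, V x -> P x -> \forall y \near x, P y) ->
    open (V `&` [set y | P y]).
  move=> HP; rewrite openE => x [Vx Px].
  by apply: filterI; [apply: open_nbhs_nbhs; split|exact: HP].
suff E : V `&` [set y | Q y] = V by move=> x Vx; have [] : (V `&` [set y | Q y]) x by rewrite E.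
apply: cV; first by exists x0.
  exists (V `&` [set y | Q y]); last by rewrite setIA setIid.
  by apply: oA => x Vx Qx; apply: filterS (H x Vx) => y [_]; exact.
exists (~` (V `&` [set y | ~ Q y])).
  apply: open_closedC; apply: oA => x Vx Qx.
  by apply: filterS (H x Vx) => y [h _] /h.
apply/seteqP; split=> x [Vx Qx]; split=> //; first by move=> [].
by apply: contrapT => nQ; apply: Qx.
Qed.

End Connectedness.

(** * Flat frames of the jet bundle attached to a projective structure *)

Section AffineFrames.
Context {R : realType} {X : riemann_surface (cplx R)} (L : line_bundle X)
  (q : tangent_root L) (S : projective_structure X).
Local Notation C := (cplx R).
Local Notation T := (tsq q).
Implicit Types (f g h z : X -> C) (x y : X) (phi psi : @chart C X) (U V : set X)
  (s t omega : section L).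

Lemma is_coord_vectorP x z omega phi : hol_at x z -> atlas phi -> cdom phi x ->
  is_coord_vector z (T (omega x) (omega x)) <-> tsqc q phi omega x * chart_deriv phi z x = 1.
Proof.
move=> hz aphi xphi; split=> [H|E psi apsi xpsi]; first exact: H.
rewrite -[tcomp _ _]/(tc psi _) (tc_change _ aphi xphi apsi xpsi).
rewrite (chart_deriv_change apsi xpsi aphi xphi hz) in E.
rewrite -[RHS]E /tsqc; move: (tc phi _) (chart_deriv psi z x) (chart_deriv phi _ x).
by move=> a b c; ring.
Qed.

(* A projective coordinate z together with omega such that omega^2 = d/dz. *)
Definition affine_frame x z omega := exists U, [/\ affine_coordinate S U z, U x,
  forall y, U y -> local_triv y omega &
  forall y, U y -> is_coord_vector z (T (omega y) (omega y))].

Lemma affine_frame_near x z omega : affine_frame x z omega ->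
  \forall y \near x, affine_frame y z omega.
Proof.
move=> [U [Sz Ux hU cU]]; apply: filterS (open_near (affine_coordinate_open Sz) Ux) => y Uy.
by exists U.
Qed.

Lemma affine_frame_proj x z omega : affine_frame x z omega -> proj_frame x z omega.
Proof.
move=> [U [Sz Ux hU _]]; split; [exact: hU|exact (affine_coordinate_hol Sz Ux)|].
by move=> phi aphi xphi; exact (affine_coordinate_neq0 Sz Ux aphi xphi).
Qed.

(** The nonvanishing of omega need not be assumed: it follows from dz(omega^2) = 1. *)
Lemma affine_frame_intro U z omega x : affine_coordinate S U z -> U x ->
  (forall y, U y -> hol_section y omega) ->
  (forall y, U y -> is_coord_vector z (T (omega y) (omega y))) -> affine_frame x z omega.
Proof.
move=> Sz Ux hU cU; exists U; split => // y Uy; split; first exact: hU.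
have [phi aphi yphi] := exists_chart y.
have hz := affine_coordinate_hol Sz Uy.
have := proj1 (is_coord_vectorP omega hz aphi yphi) (cU y Uy).
move=> E; apply/eqP => o0; move/eqP: E.
rewrite (@tsqc_scale _ _ _ q phi y omega omega 0); last by rewrite o0 scaler0.
by rewrite expr0n !mul0r eq_sym oner_eq0.
Qed.

Lemma affine_frame_shrink U z omega x : affine_coordinate S U z -> U x ->
  (\forall y \near x, hol_section y omega) ->
  (\forall y \near x, is_coord_vector z (T (omega y) (omega y))) -> affine_frame x z omega.
Proof.
move=> Sz Ux H1 H2; have oU := affine_coordinate_open Sz.
have [V [oV _ Vx VP]] := chart_nbhs_connected (nearS3 (open_near oU Ux) H1 H2
  (fun y a b c => conj a (conj b c))).
apply: (@affine_frame_intro V).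
- by apply: (affine_coordinate_restrict Sz oV) => y /VP[].
- exact: Vx.
- by move=> y /VP[_ []].
- by move=> y /VP[_ []].
Qed.

Lemma exists_affine_frame_over U z x : affine_coordinate S U z -> U x ->
  exists omega, affine_frame x z omega.
Proof.
move=> Sz Ux; have hz := affine_coordinate_hol Sz Ux.
have [phi aphi xphi] := exists_chart x; have [omega ho] := exists_local_triv L x.
have z0 := affine_coordinate_neq0 Sz Ux aphi xphi.
have hz' := hol_at_chart_deriv aphi xphi hz.
have ht := tsqc_hol q aphi xphi (proj1 ho); have t0 := tsqc_neq0 q aphi xphi (proj2 ho).
have htz := hol_at_mul ht hz'; have tz0 := mulf_neq0 t0 z0.
(* (m omega)^2 = d/dz means that m^2 is inverse to dz(omega^2). *)
have [m hm mE] := hol_at_sqrt (hol_at_inv htz tz0) (invr_neq0 tz0).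
exists (smul m omega); apply: (affine_frame_shrink Sz Ux).
  exact: hol_section_near (hol_section_smul hm (proj1 ho)).
apply: (nearS3 mE (hol_at_neq0 htz tz0) (nearS2 (hol_at_near hz) (chart_near_dom aphi xphi)
  (fun y a b => conj a b))) => y my ty0 [hzy yphi].
apply/(is_coord_vectorP _ hzy aphi yphi).
rewrite (@tsqc_scale _ _ _ q phi y omega (smul m omega) (m y) erefl).
by rewrite my -mulrA mulVf.
Qed.

Lemma exists_affine_frame x : exists z omega, affine_frame x z omega.
Proof.
have [U [z [Sz Ux]]] := exists_affine_coordinate S x; exists z.
exact: exists_affine_frame_over Sz Ux.
Qed.

Lemma moebius_rel_deriv x z z' (a b c d : C) phi :
  (\forall y \near x, z' y * (c * z y + d) = a * z y + b) -> hol_at x z -> hol_at x z' ->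
    atlas phi -> cdom phi x ->
  chart_deriv phi z' x * (c * z x + d) ^+ 2 = (a * d - b * c) * chart_deriv phi z x.
Proof.
move=> H hz hz' aphi xphi; have E0 := nbhs_singleton H.
have h1 : hol_at x (fun y => c * z y + d) by hol_at_tac.
have h2 : hol_at x (fun y => z' y * (c * z y + d)) by hol_at_tac.
have := chart_deriv_eq aphi xphi H h2.
rewrite (chart_deriv_mul aphi xphi hz' h1) (chart_deriv_lin c aphi xphi hz (hol_at_cst _)).
rewrite (chart_deriv_lin a aphi xphi hz (hol_at_cst _)) !chart_deriv_cst !addr0.
move: E0; move: (chart_deriv phi z x) (chart_deriv phi z' x) (z x) (z' x).
move=> Z' W' Z W E0 E.
have -> : W' * (c * Z + d) ^+ 2 = ((c * Z + d) * W') * (c * Z + d) by ring.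
have -> : (c * Z + d) * W' = a * Z' - W * (c * Z') by rewrite -E; ring.
rewrite mulrBl; have -> : W * (c * Z') * (c * Z + d) = (W * (c * Z + d)) * (c * Z') by ring.
by rewrite E0; ring.
Qed.

(** Since dz' = (a d - b c) / (c z + d)^2 dz, the squares of omega' and (c z + d) omega have
    constant ratio, and [tsqc_ratio] applies. *)
Lemma affine_frame_change x z omega z' omega' : affine_frame x z omega ->
  affine_frame x z' omega' -> exists a b c d k : C, [/\ moebius_rel x z z' a b c d, k != 0 &
    \forall y \near x, omega' y = (k * (c * z y + d)) *: omega y].
Proof.
move=> F F'; have [U [Sz Ux hU cU]] := F; have [U' [Sz' Ux' hU' cU']] := F'.
have [a [b [c [d M]]]] := affine_coordinate_moebius Sz Sz' Ux Ux'.
have [D H] := M; have [phi aphi xphi] := exists_chart x.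
have hz := affine_coordinate_hol Sz Ux; have hz' := affine_coordinate_hol Sz' Ux'.
pose l y := c * z y + d.
have hl : hol_at x l by rewrite /l; hol_at_tac.
have l0 : l x != 0 := moebius_denom_neq0 D (nbhs_singleton H).
have [|k k0 kE] := tsqc_ratio (q := q) (k := (a * d - b * c)^-1) (local_triv_smul hl l0 (hU _ Ux))
  (hU' _ Ux') aphi xphi; last first.
  exists a, b, c, d, k; split=> //.
  by apply: filterS kE => y ->; rewrite /smul scalerA.
have N := nearS3 (open_near (affine_coordinate_open Sz) Ux)
  (open_near (affine_coordinate_open Sz') Ux') (chart_near_dom aphi xphi)
  (fun y a b c => conj a (conj b c)).
apply: (nearS3 N (near_join H) (hol_at_neq0 hl l0)) => y [Uy [Uy' yphi]] Hy ly.
have hzy := affine_coordinate_hol Sz Uy; have hzy' := affine_coordinate_hol Sz' Uy'.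
have E := proj1 (is_coord_vectorP omega hzy aphi yphi) (cU y Uy).
have E' := proj1 (is_coord_vectorP omega' hzy' aphi yphi) (cU' y Uy').
have Ed := moebius_rel_deriv Hy hzy hzy' aphi yphi; rewrite -/(l y) in Ed.
have z0' := affine_coordinate_neq0 Sz' Uy' aphi yphi.
rewrite (@tsqc_scale _ _ _ q phi y omega (smul l omega) (l y) erefl).
move: E E' Ed z0' ly; move: (tsqc q phi omega y) (tsqc q phi omega' y).
move: (chart_deriv phi z y) (chart_deriv phi z' y) (l y) => Z' W' l1 t t' E E' Ed W0 l10.
apply: (mulIf W0); rewrite E'; move: Ed; move: D; set Q := a * d - b * c; clearbody Q.
move=> Q0 Ed; have -> : Q^-1 * (l1 ^+ 2 * t) * W' = Q^-1 * t * (W' * l1 ^+ 2) by ring.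
rewrite Ed; have -> : Q^-1 * t * (Q * Z') = (Q^-1 * Q) * (t * Z') by ring.
by rewrite mulVf// E mulr1.
Qed.

Lemma jet_affine x z omega (a b : C) : hol_at x z -> hol_section x omega ->
  jet x (fun y => (a * z y + b) *: omega y : L y) = b *: jet x omega + a *: jet x (smul z omega).
Proof.
move=> hz ho; rewrite addrC -(jetZ b ho).
have hb : hol_section x (fun y => b *: omega y : L y).
  exact: hol_section_smul (@hol_at_cst _ _ x b) ho.
rewrite -(jet_lin a (hol_section_smul hz ho) hb); congr jet.
by apply: functional_extensionality_dep => y; rewrite /smul scalerDl scalerA.
Qed.

Lemma affine_frame_jet x z omega z' omega' : affine_frame x z omega ->
  affine_frame x z' omega' -> exists a b c d k : C, [/\ a * d - b * c != 0, k != 0 &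
    \forall y \near x, jet y omega' = (k * d) *: jet y omega + (k * c) *: jet y (smul z omega) /\
      jet y (smul z' omega') = (k * b) *: jet y omega + (k * a) *: jet y (smul z omega)].
Proof.
move=> F F'; have [a [b [c [d [k [[D M] k0 E]]]]]] := affine_frame_change F F'.
exists a, b, c, d, k; split=> //.
have N := nearS2 (affine_frame_near F) (affine_frame_near F') (fun y a b => conj a b).
apply: (nearS3 N (near_join M) (near_join E)) => y [Fy Fy'] My Ey.
have [hoy hzy _] := affine_frame_proj Fy; have [hoy' hzy' _] := affine_frame_proj Fy'.
split.
  rewrite -(jet_affine (k * c) (k * d) hzy (proj1 hoy)).
  apply: (jet_eq (proj1 hoy')); apply: filterS Ey => v ->.
  by congr (_ *: _); ring.
rewrite -(jet_affine (k * a) (k * b) hzy (proj1 hoy)).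
apply: (jet_eq (hol_section_smul hzy' (proj1 hoy'))).
apply: (nearS2 Ey My) => v Ev Mv; rewrite /smul Ev scalerA; congr (_ *: _).
have -> : z' v * (k * (c * z v + d)) = k * (z' v * (c * z v + d)) by ring.
by rewrite Mv; ring.
Qed.


Definition wronskian phi g1 g2 x : C :=
  g1 x * chart_deriv phi g2 x - g2 x * chart_deriv phi g1 x.

Lemma wronskian_change phi psi g1 g2 x : hol_at x g1 -> hol_at x g2 ->
  atlas phi -> cdom phi x -> atlas psi -> cdom psi x ->
  wronskian psi g1 g2 x = wronskian phi g1 g2 x * chart_deriv psi (cmap phi) x.
Proof.
move=> h1 h2 aphi xphi apsi xpsi; rewrite /wronskian.
rewrite (chart_deriv_change aphi xphi apsi xpsi h1) (chart_deriv_change aphi xphi apsi xpsi h2).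
by rewrite mulrBl !mulrA.
Qed.

(** Vanishing of the Wronskian depends only on the point [g1 : g2]. *)
Lemma wronskian_proportional phi g1 g2 h1 h2 x : hol_at x g1 -> hol_at x g2 ->
  hol_at x h1 -> hol_at x h2 -> atlas phi -> cdom phi x ->
  (\forall y \near x, h1 y * g2 y = h2 y * g1 y) -> (g1 x, g2 x) != (0, 0) ->
  wronskian phi g1 g2 x = 0 -> wronskian phi h1 h2 x = 0.
Proof.
move=> hg1 hg2 hh1 hh2 aphi xphi H; have E0 := nbhs_singleton H.
have hl : hol_at x (fun y => h1 y * g2 y) by hol_at_tac.
have := chart_deriv_eq aphi xphi H hl.
rewrite (chart_deriv_mul aphi xphi hh1 hg2) (chart_deriv_mul aphi xphi hh2 hg1) /wronskian.
move: E0; move: (chart_deriv phi g1 x) (chart_deriv phi g2 x) (chart_deriv phi h1 x)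
  (chart_deriv phi h2 x) (g1 x) (g2 x) (h1 x) (h2 x) => G1 G2 H1 H2 a1 a2 b1 b2 E0 E n0 W.
(* It is not known which of a1, a2 is nonzero, so the Wronskian of h is shown to be annihilated by
   both squares. *)
have e1 : a1 ^+ 2 * (b1 * H2 - b2 * H1) = 0.
  have -> : a1 ^+ 2 * (b1 * H2 - b2 * H1) = b1 * a1 * (b2 * G1 + a1 * H2) - b1 * (b2 * a1) * G1
     - (b2 * a1) * a1 * H1 by ring.
  rewrite -E -E0; have -> : b1 * a1 * (b1 * G2 + a2 * H1) - b1 * (b1 * a2) * G1 -
    b1 * a2 * a1 * H1 = b1 ^+ 2 * (a1 * G2 - a2 * G1) by ring.
  by rewrite W mulr0.
have e2 : a2 ^+ 2 * (b1 * H2 - b2 * H1) = 0.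
  have -> : a2 ^+ 2 * (b1 * H2 - b2 * H1) = (b1 * a2) * a2 * H2 - b2 * a2 * (b1 * G2 + a2 * H1)
     + b2 * (b1 * a2) * G2 by ring.
  rewrite E E0; have -> : b2 * a1 * a2 * H2 - b2 * a2 * (b2 * G1 + a1 * H2) +
    b2 * (b2 * a1) * G2 = b2 ^+ 2 * (a1 * G2 - a2 * G1) by ring.
  by rewrite W mulr0.
apply/eqP; move: n0; apply: contraNT => W0.
move/eqP: e1; move/eqP: e2; rewrite !mulf_eq0 (negbTE W0) !orbF !orbb.
by move=> /eqP-> /eqP->.
Qed.

Local Notation PS := (psection (jet_bundle L)).

Definition jet_comb z omega x (a b : C) : jet_bundle L x :=
  a *: jet x omega + b *: jet x (smul z omega).

Lemma jet_comb_eq x z omega (a b a' b' : C) : proj_frame x z omega ->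
  jet_comb z omega x a b = jet_comb z omega x a' b' -> a = a' /\ b = b'.
Proof.
move=> zo /eqP; rewrite -subr_eq0 /jet_comb opprD addrACA -!scalerBl => /eqP.
by move=> /(jet_indep zo)[/eqP + /eqP]; rewrite !subr_eq0 => /eqP -> /eqP ->.
Qed.

Lemma jet_comb_neq0 x z omega (a b : C) : jet_comb z omega x a b != 0 -> (a, b) != (0, 0).
Proof. by apply: contraNneq => -[-> ->]; rewrite /jet_comb !scale0r addr0. Qed.

Lemma jet_combZ x z omega (k a b : C) :
  k *: jet_comb z omega x a b = jet_comb z omega x (k * a) (k * b).
Proof. by rewrite /jet_comb scalerDr !scalerA. Qed.

Lemma jet_comb_change y z omega z' omega' (a b c d k u v : C) :
  jet y omega' = jet_comb z omega y (k * d) (k * c) ->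
  jet y (smul z' omega') = jet_comb z omega y (k * b) (k * a) ->
  jet_comb z' omega' y u v = jet_comb z omega y (k * (d * u + b * v)) (k * (c * u + a * v)).
Proof.
move=> e1 e2; rewrite {1}/jet_comb e1 e2 !jet_combZ /jet_comb addrACA -!scalerDl.
by congr (_ *: _ + _ *: _); ring.
Qed.

(* The 1-jet at x of sigma is horizontal for the connection of the structure: the
   point [g1 : g2] of P^1 given by the coefficients in the flat frame
   (j omega, j (z omega)) has zero derivative at x. *)
Definition flat_at x (sigma : PS) := exists z omega g1 g2, [/\ affine_frame x z omega,
  hol_at x g1, hol_at x g2,
  \forall y \near x, spans (jet_comb z omega y (g1 y) (g2 y)) (sigma y) &
  forall phi, atlas phi -> cdom phi x -> wronskian phi g1 g2 x = 0].

(** [flat_at] asks for some frame and representatives; any others will do, because a constant change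
    of frame multiplies the Wronskian by k^2 (a d - b c) != 0. *)
Lemma flat_atP x sigma z omega g1 g2 phi : affine_frame x z omega -> hol_at x g1 ->
  hol_at x g2 -> (\forall y \near x, spans (jet_comb z omega y (g1 y) (g2 y)) (sigma y)) ->
  atlas phi -> cdom phi x -> flat_at x sigma <-> wronskian phi g1 g2 x = 0.
Proof.
move=> F hg1 hg2 sg aphi xphi; split; last first.
  move=> W; exists z, omega, g1, g2; split; [exact: F|exact: hg1|exact: hg2|exact: sg|].
  move=> psi apsi xpsi.
  by rewrite (wronskian_change hg1 hg2 aphi xphi apsi xpsi) W mul0r.
move=> [z' [omega' [h1 [h2 [F' hh1 hh2 sh W]]]]].
have [a [b [c [d [k [D k0 H]]]]]] := affine_frame_jet F' F.
pose G1 y := k * (d * g1 y + b * g2 y); pose G2 y := k * (c * g1 y + a * g2 y).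
have hG1 : hol_at x G1 by rewrite /G1; hol_at_tac.
have hG2 : hol_at x G2 by rewrite /G2; hol_at_tac.
have E : \forall y \near x, G1 y * h2 y = G2 y * h1 y.
  apply: (nearS3 (nearS2 sg sh (fun y a b => conj a b)) H (affine_frame_near F')).
  move=> y [sgy shy] [e1 e2] Fy.
  have [m m0] := spans_prop shy sgy; rewrite jet_combZ (jet_comb_change _ _ e1 e2).
  move=> /(jet_comb_eq (affine_frame_proj Fy))[E1 E2].
  by rewrite /G1 /G2 E1 E2; ring.
have n0 := jet_comb_neq0 (proj1 (nbhs_singleton sh)).
have W' := wronskian_proportional hh1 hh2 hG1 hG2 aphi xphi E n0 (W _ aphi xphi).
have hs1 : hol_at x (fun y => d * g1 y + b * g2 y) by hol_at_tac.
have hs2 : hol_at x (fun y => c * g1 y + a * g2 y) by hol_at_tac.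
have Z (u v : C) : chart_deriv phi (fun y => u * g1 y + v * g2 y) x =
   u * chart_deriv phi g1 x + v * chart_deriv phi g2 x.
  have hvg : hol_at x (fun y => v * g2 y) by hol_at_tac.
  by rewrite (chart_deriv_lin u aphi xphi hg1 hvg) (chart_deriv_scale v aphi xphi hg2).
move: W'; rewrite /wronskian /G1 /G2.
rewrite (chart_deriv_scale k aphi xphi hs1) (chart_deriv_scale k aphi xphi hs2) !Z.
move: (chart_deriv phi g1 x) (chart_deriv phi g2 x) (g1 x) (g2 x) => A1 A2 a1 a2.
set lhs := (X in X = 0 -> _); have -> : lhs = (k ^+ 2 * (a * d - b * c)) * (a1 * A2 - a2 * A1).
  by rewrite /lhs; ring.
move=> /eqP; rewrite mulf_eq0 => /orP[|/eqP//].
by rewrite mulf_eq0 (negbTE D) orbF expf_eq0 (negbTE k0).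
Qed.

Lemma flat_at_frame x sigma z omega phi : affine_frame x z omega -> atlas phi ->
  cdom phi x -> flat_at x sigma -> exists g1 g2, [/\ hol_at x g1, hol_at x g2,
  \forall y \near x, spans (jet_comb z omega y (g1 y) (g2 y)) (sigma y) &
  wronskian phi g1 g2 x = 0].
Proof.
move=> F aphi xphi Fs; have [z' [omega' [h1 [h2 [F' hh1 hh2 sh W]]]]] := Fs.
have [a [b [c [d [k [D k0 H]]]]]] := affine_frame_jet F F'.
pose G1 y := k * (d * h1 y + b * h2 y); pose G2 y := k * (c * h1 y + a * h2 y).
have hG1 : hol_at x G1 by rewrite /G1; hol_at_tac.
have hG2 : hol_at x G2 by rewrite /G2; hol_at_tac.
have sG : \forall y \near x, spans (jet_comb z omega y (G1 y) (G2 y)) (sigma y).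
  by apply: (nearS2 sh H) => y + [e1 e2]; rewrite (jet_comb_change _ _ e1 e2).
exists G1, G2; split; [exact: hG1|exact: hG2|exact: sG|].
exact: (proj1 (flat_atP F hG1 hG2 sG aphi xphi) Fs).
Qed.

Lemma flat_at_hol x sigma : flat_at x sigma -> hol_psection x sigma.
Proof.
move=> [z [omega [g1 [g2 [F h1 h2 sg _]]]]].
exists (fun y => jet_comb z omega y (g1 y) (g2 y)); last exact: sg.
apply/(jet_bundle_holP _ (affine_frame_proj F)); exists g1, g2.
split; [exact: h1|exact: h2|by near=> y].
Unshelve. all: by end_near. Qed.

End AffineFrames.

(** * Holomorphic matrices of size 2 *)

Section MatrixFunctions.
Context {R : realType} {X : riemann_surface (cplx R)}.
Local Notation C := (cplx R).
Implicit Types (x y : X) (phi psi : @chart C X).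

Lemma ord2P (i : 'I_2) : i = ord0 \/ i = ord_max.
Proof. by case: i => -[|[|//]] h; [left|right]; exact: val_inj. Qed.

Definition hol_mx m n x (F : X -> 'M[C]_(m, n)) := forall i j, hol_at x (fun y => F y i j).

Definition deriv_mx m n phi (F : X -> 'M[C]_(m, n)) x : 'M[C]_(m, n) :=
  \matrix_(i, j) chart_deriv phi (fun y => F y i j) x.

Lemma mulmx2E m n (A : 'M[C]_(m, 2)) (B : 'M[C]_(2, n)) i j :
  (A *m B) i j = A i ord0 * B ord0 j + A i ord_max * B ord_max j.
Proof. rewrite mxE big_ord_recl big_ord1; congr (_ + A _ _ * B _ _); exact: val_inj. Qed.

Lemma hol_mx_cst m n x (A : 'M[C]_(m, n)) : hol_mx x (fun=> A).
Proof. move=> i j; exact: (@hol_at_cst _ _ x (A i j)). Qed.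

Lemma hol_mx_eq m n x (F G : X -> 'M[C]_(m, n)) : (\forall y \near x, F y = G y) ->
  hol_mx x F -> hol_mx x G.
Proof. by move=> FG hF i j; apply: hol_at_eq (hF i j); apply: filterS FG => y ->. Qed.

Lemma hol_mx_mul m n x (F : X -> 'M[C]_(m, 2)) (G : X -> 'M[C]_(2, n)) :
  hol_mx x F -> hol_mx x G -> hol_mx x (fun y => F y *m G y).
Proof.
move=> hF hG i j; apply: hol_at_eq (hol_at_add (hol_at_mul (hF i ord0) (hG ord0 j))
  (hol_at_mul (hF i ord_max) (hG ord_max j))).
by near=> y; rewrite mulmx2E.
Unshelve. all: by end_near. Qed.

Lemma hol_mx_opp m n x (F : X -> 'M[C]_(m, n)) : hol_mx x F -> hol_mx x (fun y => - F y).
Proof.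
move=> hF i j; apply: hol_at_eq (hol_at_mul (@hol_at_cst _ _ x (-1)) (hF i j)).
by near=> y; rewrite mxE mulN1r.
Unshelve. all: by end_near. Qed.

Lemma hol_mx_deriv m n x phi (F : X -> 'M[C]_(m, n)) : atlas phi -> cdom phi x ->
  hol_mx x F -> hol_mx x (deriv_mx phi F).
Proof.
move=> aphi xphi hF i j; apply: hol_at_eq (hol_at_chart_deriv aphi xphi (hF i j)).
by near=> y; rewrite mxE.
Unshelve. all: by end_near. Qed.

Lemma hol_mx_near m n x (F : X -> 'M[C]_(m, n)) : hol_mx x F -> \forall y \near x, hol_mx y F.
Proof.
move=> hF; have H (i : 'I_m) (j : 'I_n) := hol_at_near (hF i j).
have : \forall y \near x, forall ij : 'I_m * 'I_n, hol_at y (fun v => F v ij.1 ij.2).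
  by apply: filter_forall => -[i j]; exact: H.
by apply: filterS => y Hy i j; exact: (Hy (i, j)).
Qed.

Lemma invmx2E (A : 'M[C]_2) : A \in unitmx ->
  invmx A = (\det A)^-1 *: \matrix_(i, j)
    (if i == ord0 then if j == ord0 then A ord_max ord_max else - A ord0 ord_max
     else if j == ord0 then - A ord_max ord0 else A ord0 ord0).
Proof.
move=> Au; rewrite -[RHS]mulmx1 -(mulmxV Au) mulmxA; set N := _ *: _.
suff -> : N *m A = 1%:M by rewrite mul1mx.
have D0 : \det A != 0 by rewrite -unitmx2E.
rewrite /N -scalemxAl; apply/matrixP => i j; rewrite mxE mulmx2E !mxE.
apply: (mulfI D0); rewrite mulrA divff// mul1r det2E.
by case: (ord2P i) (ord2P j) => -> [] -> /=; rewrite ?mulr1n ?mulr0n ?mulr1 ?mulr0; ring.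
Qed.

Lemma hol_mx_inv x (F : X -> 'M[C]_2) : hol_mx x F ->
  (\forall y \near x, F y \in unitmx) -> hol_mx x (fun y => invmx (F y)).
Proof.
move=> hF uF.
have hD : hol_at x (fun y => F y ord0 ord0 * F y ord_max ord_max
    - F y ord0 ord_max * F y ord_max ord0).
  by apply: hol_at_sub; apply: hol_at_mul; exact: hF.
have D0 : F x ord0 ord0 * F x ord_max ord_max - F x ord0 ord_max * F x ord_max ord0 != 0.
  by rewrite -det2E -unitmx2E; exact: nbhs_singleton uF.
have hN (a b : 'I_2) := hol_at_mul (@hol_at_cst _ _ x (-1)) (hF a b).
move=> i j; pose G y := if i == ord0 then if j == ord0 then F y ord_max ord_max
  else -1 * F y ord0 ord_max else if j == ord0 then -1 * F y ord_max ord0 else F y ord0 ord0.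
have hG : hol_at x G.
  rewrite /G; case: (i == ord0); case: (j == ord0); [exact: hF|exact: hN|exact: hN|exact: hF].
apply: hol_at_eq (hol_at_mul (hol_at_inv hD D0) hG).
by apply: filterS uF => y uy; rewrite invmx2E// !mxE det2E /G !mulN1r.
Qed.

Lemma deriv_mx_eq m n phi x (F G : X -> 'M[C]_(m, n)) : atlas phi -> cdom phi x ->
  (\forall y \near x, F y = G y) -> hol_mx x F -> deriv_mx phi F x = deriv_mx phi G x.
Proof.
move=> aphi xphi FG hF; apply/matrixP => i j; rewrite [LHS]mxE [RHS]mxE.
by apply: (chart_deriv_eq aphi xphi _ (hF i j)); apply: filterS FG => y ->.
Qed.

Lemma deriv_mx_cst m n phi x (A : 'M[C]_(m, n)) : deriv_mx phi (fun=> A) x = 0.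
Proof. by apply/matrixP => i j; rewrite !mxE chart_deriv_cst. Qed.

Lemma deriv_mx_mul m n phi x (F : X -> 'M[C]_(m, 2)) (G : X -> 'M[C]_(2, n)) :
  atlas phi -> cdom phi x -> hol_mx x F -> hol_mx x G ->
  deriv_mx phi (fun y => F y *m G y) x = deriv_mx phi F x *m G x + F x *m deriv_mx phi G x.
Proof.
move=> aphi xphi hF hG; apply/matrixP => i j.
rewrite [LHS]mxE [RHS]mxE !mulmx2E !mxE.
have h1 := hol_at_mul (hF i ord0) (hG ord0 j); have h2 := hol_at_mul (hF i ord_max) (hG ord_max j).
have -> : (fun y => (F y *m G y) i j) =
    (fun y => F y i ord0 * G y ord0 j + F y i ord_max * G y ord_max j).
  by apply/funext => y; rewrite mulmx2E.
rewrite (chart_deriv_add aphi xphi h1 h2) (chart_deriv_mul aphi xphi (hF i ord0) (hG ord0 j)).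
rewrite (chart_deriv_mul aphi xphi (hF i ord_max) (hG ord_max j)).
move: (chart_deriv phi _ x) (chart_deriv phi _ x) (chart_deriv phi _ x) (chart_deriv phi _ x).
by move=> a b c d; ring.
Qed.

Lemma mulmx_colP m n (A B : 'M[C]_(m, n)) : (forall v : 'cV_n, A *m v = B *m v) -> A = B.
Proof. by move=> H; apply/matrixP => i j; have := H (delta_mx j 0); rewrite -!colE => /colP/(_ i);
  rewrite !mxE. Qed.

Lemma unitmx_colP (A : 'M[C]_2) : (forall v : 'cV_2, A *m v = 0 -> v = 0) -> A \in unitmx.
Proof.
move=> H; rewrite unitmx2E -det_tr; apply/det0P => -[v v0 vA].
have : v^T = 0 by apply: H; rewrite -[A]trmxK -trmx_mul vA trmx0.
by move/(congr1 trmx); rewrite trmxK trmx0 => v00; rewrite v00 eqxx in v0.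
Qed.

(** The basis vectors make Q diagonal, and their sum makes the two entries equal. *)
Lemma eigen_scalar_mx (Q : 'M[C]_2) :
  (forall v : 'cV_2, v != 0 -> exists a, Q *m v = a *: v) -> exists a, Q = a%:M.
Proof.
move=> H.
have HQ (u v : C) : (u, v) != (0, 0) -> exists a,
    Q ord0 ord0 * u + Q ord0 ord_max * v = a * u /\
    Q ord_max ord0 * u + Q ord_max ord_max * v = a * v.
  move=> uv; pose w : 'cV[C]_2 := \col_(i < 2) if i == ord0 then u else v.
  have w0 : w ord0 0 = u by rewrite mxE.
  have w1 : w ord_max 0 = v by rewrite mxE.
  have [|a E] := H w.
    by apply: contraNneq uv => E; rewrite -w0 -w1 E !mxE.
  exists a; rewrite -w0 -w1 -!mulmx2E E; split; by rewrite [LHS]mxE.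
have [|a [e1 e2]] := HQ 1 0; first by rewrite xpair_eqE oner_eq0.
have [|b [e3 e4]] := HQ 0 1; first by rewrite xpair_eqE oner_eq0 andbF.
have [|c [e5 e6]] := HQ 1 1; first by rewrite xpair_eqE oner_eq0.
rewrite !mulr1 ?mulr0 ?addr0 ?add0r in e1 e2 e3 e4 e5 e6.
exists a; apply/matrixP => i j; rewrite [RHS]mxE.
case: (ord2P i) (ord2P j) => -> [] -> /=; rewrite ?mulr1n ?mulr0n.
- exact: e1.
- exact: e3.
- exact: e2.
by move: e5 e6; rewrite e1 e2 e3 addr0 add0r => -> ->.
Qed.

Lemma eigen_scalar (M N : 'M[C]_2) : N \in unitmx ->
  (forall v : 'cV_2, v != 0 -> exists a, M *m v = a *: (N *m v)) ->
  exists a, M = a *: N.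
Proof.
move=> Nu H; have [|a E] := @eigen_scalar_mx (invmx N *m M).
  by move=> v /H[a E]; exists a; rewrite -mulmxA E -scalemxAr mulKmx.
by exists a; rewrite -[M](mulKVmx Nu) E mul_mx_scalar.
Qed.

(** Links the Wronskian to the condition of [horizontal_local], that the covariant derivative be a
    multiple of the vector. *)
Lemma wronskianP phi x (g : X -> 'cV[C]_2) : g x != 0 ->
  wronskian phi (fun y => g y ord0 0) (fun y => g y ord_max 0) x = 0 <->
  exists a, deriv_mx phi g x = a *: g x.
Proof.
move=> g0; rewrite /wronskian; split=> [W|[a E]]; last first.
  have := congr1 (fun v : 'cV_2 => v ord0 0) E; have := congr1 (fun v : 'cV_2 => v ord_max 0) E.
  by rewrite !mxE => -> ->; ring.
have [a0|a0] := eqVneq (g x ord0 0) 0.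
  have b0 : g x ord_max 0 != 0.
    apply: contraNneq g0 => b0; apply/eqP/colP => i; rewrite mxE.
    by case: (ord2P i) => ->.
  exists (chart_deriv phi (fun y => g y ord_max 0) x / g x ord_max 0).
  apply/colP => i; rewrite !mxE; case: (ord2P i) => ->; last by rewrite divfK.
  rewrite a0 mulr0; move/eqP: W; rewrite a0 mul0r sub0r oppr_eq0 mulf_eq0 (negbTE b0).
  by move/eqP.
exists (chart_deriv phi (fun y => g y ord0 0) x / g x ord0 0).
apply/colP => i; rewrite !mxE; case: (ord2P i) => ->; first by rewrite divfK.
apply: (mulfI a0); move/eqP: W; rewrite subr_eq0 => /eqP ->.
by rewrite mulrA [g x ord0 0 * _]mulrC divfK// mulrC.
Qed.

End MatrixFunctions.

(** * Existence and uniqueness of the corresponding connection *)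

Section Connection.
Context {R : realType} {X : riemann_surface (cplx R)} (L : line_bundle X)
  (q : tangent_root L) (S : projective_structure X).
Local Notation C := (cplx R).
Local Notation T := (tsq q).
Local Notation J := (jet_bundle L).
Local Notation PS := (psection (jet_bundle L)).
Local Notation affine_frame := (affine_frame q S).
Local Notation flat_at := (flat_at q S).
Implicit Types (g h z : X -> C) (x y : X) (phi psi : @chart C X) (U V : set X)
  (s t omega : section L) (f : local_frame 2 J) (sigma : PS).

Definition frame_sum f x (c : 'cV[C]_2) : J x := \sum_(i < 2) c i 0 *: fvec f i x.

Lemma frame_sumB f x (c c' : 'cV[C]_2) : frame_sum f x (c - c') =
  frame_sum f x c - frame_sum f x c'.
Proof.
by rewrite /frame_sum -sumrB; apply: eq_bigr => i _; rewrite !mxE scalerBl.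
Qed.

Lemma frame_sum_inj f x (c c' : 'cV[C]_2) : frames J f -> fdom f x ->
  frame_sum f x c = frame_sum f x c' -> c = c'.
Proof.
move=> /jet_frameE[phi [e [aphi Fe ->]]] xf /eqP.
rewrite -subr_eq0 -frame_sumB /frame_sum (jet_frame_sum phi e x (fun i => (c - c') i 0)).
move=> /eqP/(jet_indep (jet_frame_proj aphi Fe xf))[e0 e1].
apply/eqP; rewrite -subr_eq0; apply/eqP/colP => i; rewrite [RHS]mxE.
by case: (ord2P i) => ->.
Qed.

Lemma frame_near2 f x : frames J f -> fdom f x -> \forall y \near x, fdom f y.
Proof.
move=> /jet_frameE[phi [e [aphi Fe ->]]] [xphi xe] /=.
exact: nearS2 (chart_near_dom aphi xphi) (frame_near Fe xe) (fun y a b => conj a b).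
Qed.

Lemma hol_section_frame_sum f x (t : section J) : frames J f -> fdom f x ->
  hol_section x t -> exists2 c : X -> 'cV[C]_2, hol_mx x c &
    \forall y \near x, t y = frame_sum f y (c y).
Proof.
move=> Ff xf ht; have [c [hc tc]] := ht f Ff xf.
exists (fun y => \col_i c i y).
  move=> i j; apply: hol_at_eq (hc i); near=> y; by rewrite mxE.
by apply: filterS tc => y ->; apply: eq_bigr => i _; rewrite mxE.
Unshelve. all: by end_near. Qed.

(** The columns of [B] are the coordinates of j omega and j (z omega) in the frame [f]. *)
Definition frame_mx z omega f x (B : X -> 'M[C]_2) := hol_mx x B /\
  \forall y \near x, forall v : 'cV[C]_2,
    jet_comb z omega y (v ord0 0) (v ord_max 0) = frame_sum f y (B y *m v).

Lemma exists_frame_mx x z omega f : proj_frame x z omega -> frames J f -> fdom f x ->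
  exists B, frame_mx z omega f x B.
Proof.
move=> zo Ff xf; have [[ho _] hz _] := zo.
have [c hc cE] := hol_section_frame_sum Ff xf (jet_hol_section ho).
have [d hd dE] := hol_section_frame_sum Ff xf (jet_hol_section (hol_section_smul hz ho)).
exists (fun y => \matrix_(i, j) if j == ord0 then c y i 0 else d y i 0); split.
  move=> i j; case: (ord2P j) => ->.
    by apply: hol_at_eq (hc i 0); near=> y; rewrite mxE.
  by apply: hol_at_eq (hd i 0); near=> y; rewrite mxE.
apply: (nearS2 cE dE) => y e1 e2 v.
rewrite /jet_comb e1 e2 /frame_sum !scaler_sumr -big_split; apply: eq_bigr => i _.
rewrite mulmx2E !mxE [c y i 0 * _]mulrC [d y i 0 * _]mulrC scalerDl -!scalerA; reflexivity.
Unshelve. all: by end_near. Qed.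

Lemma frame_mx_near x z omega f B : frame_mx z omega f x B ->
  \forall y \near x, frame_mx z omega f y B.
Proof.
move=> [hB /near_join BE]; apply: (nearS2 (hol_mx_near hB) BE) => y h1 h2.
by split.
Qed.

Lemma frame_mx_unit x z omega f B : proj_frame x z omega -> frame_mx z omega f x B ->
  B x \in unitmx.
Proof.
move=> zo [_ /nbhs_singleton BE]; apply: unitmx_colP => v Bv.
have := BE v; rewrite Bv /frame_sum big1; last by move=> i _; rewrite mxE scale0r.
move=> /(jet_indep zo)[e0 e1]; apply/colP => i; rewrite [RHS]mxE.
by case: (ord2P i) => ->.
Qed.

Lemma frame_mx_unit_near x z omega f B : proj_frame x z omega -> frame_mx z omega f x B ->
  \forall y \near x, B y \in unitmx.
Proof.
move=> zo FB; apply: (nearS2 (proj_frame_near zo) (frame_mx_near FB)) => y.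
exact: frame_mx_unit.
Qed.

(** Requires the flat frames to be parallel exactly and not merely up to scalars. This normalisation
    makes the matrix unique, which is what lets local choices fit together. *)
Definition parallel phi f x (A : 'M[C]_2) := forall z omega B, affine_frame x z omega ->
  frame_mx z omega f x B -> deriv_mx phi B x + A *m B x = 0.

(** Another flat frame has matrix B M with M constant, and the equation is just multiplied by M. *)
Lemma parallel_frame x z omega f B phi (A : 'M[C]_2) : affine_frame x z omega ->
  frame_mx z omega f x B -> frames J f -> fdom f x -> atlas phi -> cdom phi x ->
  deriv_mx phi B x + A *m B x = 0 -> parallel phi f x A.
Proof.
move=> F FB Ff xf aphi xphi E z' omega' B' F' FB'.
have [a [b [c [d [k [D k0 H]]]]]] := affine_frame_jet F F'.
pose M : 'M[C]_2 := \matrix_(i, j) if i == ord0 then if j == ord0 then k * d else k * b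
  else if j == ord0 then k * c else k * a.
have [hB BE] := FB; have [hB' BE'] := FB'.
have BM : \forall y \near x, B' y = B y *m M.
  apply: (nearS3 (nearS2 BE BE' (fun y a b => conj a b)) H (frame_near2 Ff xf)).
  move=> y [Ey Ey'] [j1 j2] yf; apply: mulmx_colP => v.
  apply: (frame_sum_inj Ff yf); rewrite -Ey' (jet_comb_change _ _ j1 j2) -mulmxA -Ey.
  by rewrite !mulmx2E !mxE /=; congr jet_comb; ring.
rewrite (nbhs_singleton BM) (deriv_mx_eq aphi xphi BM hB').
rewrite (deriv_mx_mul aphi xphi hB (@hol_mx_cst _ _ _ _ x M)) deriv_mx_cst mulmx0 addr0.
by rewrite mulmxA -mulmxDl E mul0mx.
Qed.

Lemma parallel_unique phi f x (A A' : 'M[C]_2) : frames J f -> fdom f x ->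
  parallel phi f x A -> parallel phi f x A' -> A = A'.
Proof.
move=> Ff xf H H'; have [z [omega F]] := exists_affine_frame q S x.
have zo := affine_frame_proj F; have [B FB] := exists_frame_mx zo Ff xf.
have := H' _ _ _ F FB; rewrite -(H _ _ _ F FB) => /addrI.
by move/(can_inj (mulmxK (frame_mx_unit zo FB))).
Qed.

(** Pointwise choice suffices: by uniqueness the chosen matrix equals -B' B^-1 near x, so it is
    holomorphic. *)
Lemma exists_parallel phi f : atlas phi -> frames J f -> exists A : X -> 'M[C]_2,
  forall x, cdom phi x -> fdom f x -> hol_mx x A /\ parallel phi f x (A x).
Proof.
move=> aphi Ff; exists (fun x => xget 0 [set A | parallel phi f x A]) => x xphi xf.
have [z [omega F]] := exists_affine_frame q S x.
have zo := affine_frame_proj F; have [B FB] := exists_frame_mx zo Ff xf.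
pose A y := - (deriv_mx phi B y *m invmx (B y)).
have PA : \forall y \near x, parallel phi f y (A y).
  have N := nearS2 (frame_near2 Ff xf) (chart_near_dom aphi xphi) (fun y a b => conj a b).
  apply: (nearS3 (affine_frame_near F) (frame_mx_near FB) N) => y Fy FBy [yf yphi].
  apply: (parallel_frame Fy FBy Ff yf aphi yphi).
  by rewrite /A mulNmx mulmxKV ?subrr// (frame_mx_unit (affine_frame_proj Fy) FBy).
have E : \forall y \near x, A y = xget 0 [set A | parallel phi f y A].
  apply: (nearS2 PA (frame_near2 Ff xf)) => y Py yf.
  apply: (parallel_unique Ff yf Py); case: xgetP => [A' _ //|N].
  by case: (N (A y)).
split; last by rewrite -(nbhs_singleton E); exact: nbhs_singleton PA.
apply: hol_mx_eq E _; apply: hol_mx_opp; apply: hol_mx_mul.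
  by apply: hol_mx_deriv; [exact: aphi|exact: xphi|exact (proj1 FB)].
by apply: hol_mx_inv; [exact (proj1 FB)|exact: frame_mx_unit_near FB].
Qed.

(* The scalar k is there because the connection only determines A modulo scalars. *)
Lemma flat_at_mx x z omega f B phi (A : 'M[C]_2) (k : C) (c : X -> 'cV[C]_2) sigma :
  affine_frame x z omega -> frame_mx z omega f x B -> atlas phi -> cdom phi x ->
  deriv_mx phi B x + A *m B x = k *: B x -> hol_mx x c ->
  (\forall y \near x, spans (frame_sum f y (c y)) (sigma y)) ->
  flat_at x sigma <-> exists a, deriv_mx phi c x + A *m c x = a *: c x.
Proof.
move=> F FB aphi xphi E hc cs; have zo := affine_frame_proj F; have [hB BE] := FB.
have Bu := frame_mx_unit_near zo FB; have Bx := nbhs_singleton Bu.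
pose g y := invmx (B y) *m c y.
have hg : hol_mx x g := hol_mx_mul (hol_mx_inv hB Bu) hc.
have cE : \forall y \near x, c y = B y *m g y.
  by apply: filterS Bu => y By; rewrite mulKVmx.
have gs : \forall y \near x, spans (jet_comb z omega y (g y ord0 0) (g y ord_max 0)) (sigma y).
  by apply: (nearS3 BE cs cE) => y -> sy <-.
have g0 : g x != 0.
  apply: contraNneq (proj1 (nbhs_singleton gs)) => ->.
  by rewrite /jet_comb !mxE !scale0r addr0.
apply: iff_trans (flat_atP F (hg ord0 0) (hg ord_max 0) gs aphi xphi) _.
apply: iff_trans (wronskianP phi g0) _.
rewrite (deriv_mx_eq aphi xphi cE hc) (deriv_mx_mul aphi xphi hB hg) (nbhs_singleton cE).
move: (deriv_mx phi g x) (deriv_mx phi B x) E (g x) => G' B' E gx.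
have -> : B' *m gx + B x *m G' + A *m (B x *m gx) = B x *m (k *: gx + G').
  by rewrite addrAC mulmxA -mulmxDl E mulmxDr -scalemxAl scalemxAr.
split=> [[a ->]|[a]].
  by exists (k + a); rewrite -scalerDl -scalemxAr.
rewrite scalemxAr => /(congr1 (mulmx (invmx (B x)))); rewrite !mulKmx// => Ea.
by exists (a - k); rewrite scalerBl -Ea addrC addKr.
Qed.

Lemma col_mx_deriv phi (c : X -> 'cV[C]_2) x :
  \col_i chart_deriv phi (fun y => c y i 0) x = deriv_mx phi c x.
Proof. by apply/matrixP => i j; rewrite [LHS]mxE [RHS]mxE [j]ord1. Qed.

Lemma exists_structure_connection : exists D : hol_connection J,
  forall x sigma, horizontal D x sigma <-> flat_at x sigma.
Proof.
unshelve eexists.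
  refine (@HolConnection _ _ _ _ (fun x sigma => flat_at x sigma) _ _).
    exact: flat_at_hol.
  move=> phi f aphi Ff; have [A HA] := exists_parallel aphi Ff.
  exists A => x xphi xf; have [hA PA] := HA x xphi xf; split; first exact: hA.
  move=> c sigma hc cs.
  have [z [omega F]] := exists_affine_frame q S x.
  have zo := affine_frame_proj F; have [B FB] := exists_frame_mx zo Ff xf.
  rewrite col_mx_deriv; apply: (flat_at_mx (k := 0) F FB aphi xphi); last exact: cs.
    by rewrite scale0r; exact: (PA _ _ _ F FB).
  by move=> i j; rewrite [j]ord1; exact: (hc i).
by [].
Qed.

Lemma flat_at_const x z omega sigma (a b : C) : affine_frame x z omega ->
  (\forall y \near x, spans (jet_comb z omega y b a) (sigma y)) -> flat_at x sigma.
Proof.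
move=> F sg; have [phi aphi xphi] := exists_chart x.
apply/(flat_atP (g1 := fun=> b) (g2 := fun=> a) F (hol_at_cst _) (hol_at_cst _) sg aphi xphi).
by rewrite /wronskian !chart_deriv_cst !mulr0 subrr.
Qed.

(** The derivative of g2 / g1 is the Wronskian divided by g1^2. *)
Lemma ratio_const_near x g1 g2 phi : hol_at x g1 -> hol_at x g2 -> g1 x != 0 -> atlas phi ->
  cdom phi x ->
  (\forall y \near x, wronskian phi g1 g2 y = 0) ->
  \forall y \near x, g2 y = g2 x / g1 x * g1 y.
Proof.
move=> h1 h2 n0 aphi xphi W; have hq := hol_at_div h2 h1 n0.
have H : \forall y \near x, chart_deriv phi (fun v => g2 v / g1 v) y = 0.
  have N := nearS3 (hol_at_neq0 h1 n0) W (chart_near_dom aphi xphi)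
    (fun y a b c => conj a (conj b c)).
  have N' := nearS3 (hol_at_near h1) (hol_at_near h2) (hol_at_near hq)
    (fun y a b c => conj a (conj b c)).
  apply: (nearS3 N N' (near_join (hol_at_neq0 h1 n0))) => y [ny [Wy yphi]] [h1y [h2y hqy]] nn.
  have E : \forall v \near y, g2 v = (g2 v / g1 v) * g1 v.
    by apply: filterS nn => v nv; rewrite divfK.
  have := chart_deriv_eq aphi yphi E h2y; rewrite (chart_deriv_mul aphi yphi hqy h1y) => E2.
  move: Wy; rewrite /wronskian E2; move: (chart_deriv phi _ y) (chart_deriv phi g1 y) => q' G1.
  have -> : g1 y * (g2 y / g1 y * G1 + g1 y * q') - g2 y * G1 =
    g1 y * g1 y * q' + (g2 y / g1 y * g1 y) * G1 - g2 y * G1 by ring.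
  rewrite divfK// addrK => /eqP; rewrite !mulf_eq0 (negbTE ny) /= => /eqP //.
apply: (nearS2 (chart_deriv0_near aphi xphi hq H) (hol_at_neq0 h1 n0)) => y E ny.
by rewrite -E divfK.
Qed.

Lemma spans_jet_comb_scale1 z omega y (a b r : C) p : a != 0 -> b = r * a ->
  spans (jet_comb z omega y a b) p -> spans (jet_comb z omega y 1 r) p.
Proof.
move=> a0 -> sp; have := spans_scale (invr_neq0 a0) sp.
by rewrite jet_combZ mulVf// [_^-1 * _]mulrC mulfK.
Qed.

Lemma spans_jet_comb_scale2 z omega y (a b r : C) p : b != 0 -> a = r * b ->
  spans (jet_comb z omega y a b) p -> spans (jet_comb z omega y r 1) p.
Proof.
move=> b0 -> sp; have := spans_scale (invr_neq0 b0) sp.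
by rewrite jet_combZ mulVf// [_^-1 * _]mulrC mulfK.
Qed.

Lemma flat_at_near_const x z omega sigma : affine_frame x z omega ->
  (\forall y \near x, flat_at y sigma) -> exists a b : C, (a, b) != (0, 0) /\
  \forall y \near x, spans (jet_comb z omega y b a) (sigma y).
Proof.
move=> F Fs; have [phi aphi xphi] := exists_chart x.
have [g1 [g2 [h1 h2 sg _]]] := flat_at_frame F aphi xphi (nbhs_singleton Fs).
have W : \forall y \near x, wronskian phi g1 g2 y = 0.
  have N := nearS3 (hol_at_near h1) (hol_at_near h2) (chart_near_dom aphi xphi)
    (fun y a b c => conj a (conj b c)).
  have N' := nearS2 (affine_frame_near F) Fs (fun y a b => conj a b).
  apply: (nearS3 N N' (near_join sg)) => y [h1y [h2y yphi]] [Fy Fsy] sgy.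
  exact: (proj1 (flat_atP Fy h1y h2y sgy aphi yphi)).
have key (g g' : X -> C) (n0 : g x != 0) (k : C) :
    (\forall y \near x, g' y = k * g y) -> hol_at x g ->
    \forall y \near x, g y != 0 /\ g' y = k * g y.
  by move=> E hg; apply: (nearS2 (hol_at_neq0 hg n0) E) => y.
have [n1|n1] := eqVneq (g1 x) 0; last first.
  (* The pair is ordered as in (a z + b) omega, whereas [jet_comb] takes the coefficient b of j
     omega first. *)
  exists (g2 x / g1 x), 1; split; first by rewrite xpair_eqE oner_eq0 andbF.
  have E := key g1 g2 n1 _ (ratio_const_near h1 h2 n1 aphi xphi W) h1.
  apply: (nearS2 E sg) => y [ny e] sy.
  exact: spans_jet_comb_scale1 ny e sy.
have n2 : g2 x != 0.
  apply: contraTneq (jet_comb_neq0 (proj1 (nbhs_singleton sg))) => ->.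
  by rewrite n1 eqxx.
have W' : \forall y \near x, wronskian phi g2 g1 y = 0.
  by apply: filterS W => y; rewrite /wronskian => /eqP; rewrite subr_eq0 => /eqP ->; rewrite subrr.
exists 1, (g1 x / g2 x); split; first by rewrite xpair_eqE oner_eq0.
have E := key g2 g1 n2 _ (ratio_const_near h2 h1 n2 aphi xphi W') h2.
apply: (nearS2 E sg) => y [ny e] sy.
exact: spans_jet_comb_scale2 ny e sy.
Qed.

(** A [psection] is defined on all of X; where the combination vanishes an arbitrary line fills
    in. *)
Lemma exists_psection_comb z omega (a b : C) : exists sigma, forall y,
  jet_comb z omega y b a != 0 -> spans (jet_comb z omega y b a) (sigma y).
Proof.
have H y : exists p : pspace (J y), jet_comb z omega y b a != 0 ->
    spans (jet_comb z omega y b a) p.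
  have [v0|v0] := eqVneq (jet_comb z omega y b a) 0; last first.
    by exists (pline v0) => _; exact: spans_pline.
  have [w [eta Fy]] := exists_affine_frame q S y.
  have n0 : jet_comb w eta y 1 0 != 0.
    by apply: (jet_omega_neq0 (affine_frame_proj Fy)); rewrite xpair_eqE oner_eq0.
  by exists (pline n0).
by exists (fun y => projT1 (cid (H y))) => y; case: cid.
Qed.

Lemma affine_frame_of U z omega : affine_coordinate S U z ->
  (forall x, U x -> hol_section x omega) ->
  (forall x, U x -> is_coord_vector z (T (omega x) (omega x))) ->
  forall x, U x -> affine_frame x z omega.
Proof. by move=> Sz hU cU x Ux; exact: affine_frame_intro Sz Ux hU cU. Qed.

Lemma jet_affine_comb x z omega (a b : C) : affine_frame x z omega ->
  jet x (fun y => (a * z y + b) *: omega y : L y) = jet_comb z omega x b a.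
Proof. by move=> /affine_frame_proj[[ho _] hz _]; exact: jet_affine. Qed.

Lemma flat_connection_corresponding (D : hol_connection J) :
  (forall x sigma, horizontal D x sigma <-> flat_at x sigma) ->
  corresponding_connection q S D.
Proof.
move=> HD U z omega Sz hU cU V sigma oV cV VU.
have F x (Vx : V x) := affine_frame_of Sz hU cU (VU x Vx).
have NV x (Vx : V x) := open_near oV Vx.
split=> [Ds|[a [b [ab H]]] x Vx]; last first.
  apply/HD; apply: (flat_at_const (a := a) (b := b) (F x Vx)).
  apply: filterS (NV x Vx) => y Vy.
  by rewrite -(jet_affine_comb a b (F y Vy)); exact: H.
have fl x (Vx : V x) : \forall y \near x, flat_at y sigma.
  by apply: filterS (NV x Vx) => y Vy; apply/HD; exact: Ds.
have [[x0 Vx0]|N] := pselect (V !=set0); last first.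
  exists 1, 0; split; first by rewrite xpair_eqE oner_eq0.
  by move=> x Vx; case: N; exists x.
have [a [b [ab H0]]] := flat_at_near_const (F x0 Vx0) (fl x0 Vx0).
exists a, b; split=> // x Vx; rewrite (jet_affine_comb a b (F x Vx)).
(* Near each y the section is given by constants (a', b'), and [Q] holds there exactly when (a, b)
   is a nonzero multiple of them; so [Q] is locally constant. *)
pose Q y := spans (jet_comb z omega y b a) (sigma y).
suff : forall y, V y -> Q y by apply.
apply: (connected_locally_constant cV oV Vx0); last exact: nbhs_singleton H0.
move=> y Vy; have [a' [b' [ab' Hy]]] := flat_at_near_const (F y Vy) (fl y Vy).
have QE v : V v -> spans (jet_comb z omega v b' a') (sigma v) ->
    Q v <-> exists2 m : C, m != 0 & b = m * b' /\ a = m * a'.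
  move=> Vv sv; split=> [Qv|[m m0 [e1 e2]]].
    have [m m0] := spans_prop sv Qv; rewrite jet_combZ.
    by move=> /(jet_comb_eq (affine_frame_proj (F v Vv)))[-> ->]; exists m.
  by rewrite /Q e1 e2 -jet_combZ; exact: spans_scale.
apply: (nearS2 (NV y Vy) Hy) => v Vv sv.
by apply: iff_trans (QE v Vv sv) (iff_sym (QE y Vy (nbhs_singleton Hy))).
Qed.

Lemma corresponding_connection_flat (D : hol_connection J) :
  corresponding_connection q S D ->
  forall x sigma, horizontal D x sigma <-> flat_at x sigma.
Proof.
move=> HD x sigma; have [z [omega F]] := exists_affine_frame q S x.
have [phi aphi xphi] := exists_chart x.
have [psi [e [apsi Fe xf]]] := exists_jet_frame L x.
have Ff := jet_frame_in apsi Fe; set f := jet_frame psi e in xf Ff.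
have [A HA] := horizontal_local D aphi Ff; have [hA PA] := HA x xphi xf.
have zo := affine_frame_proj F; have [B FB] := exists_frame_mx zo Ff xf.
have [hB BE] := FB.
have [U [Sz Ux tU cU]] := F.
have [V [oV cV Vx VU]] := chart_nbhs_connected (open_near (affine_coordinate_open Sz) Ux).
have hU y (Uy : U y) := proj1 (tU y Uy).
(* For every constant v the section B v is flat for [D] by correspondence, so (B' + A B) v is a
   multiple of B v; hence B' + A B = k B. *)
have [|k E] := eigen_scalar (M := deriv_mx phi B x + A x *m B x) (frame_mx_unit zo FB).
  move=> v v0; have [sg sgE] := exists_psection_comb z omega (v ord_max 0) (v ord0 0).
  have vv : (v ord_max 0, v ord0 0) != (0, 0) :> C * C.
    apply: contraNneq v0 => -[e1 e0]; apply/eqP/colP => i; rewrite [RHS]mxE.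
    by case: (ord2P i) => ->.
  have vv' : (v ord0 0, v ord_max 0) != (0, 0) :> C * C by rewrite xpair_eqE andbC -xpair_eqE.
  have sV y : V y -> spans (jet_comb z omega y (v ord0 0) (v ord_max 0)) (sg y).
    move=> Vy; apply: sgE; apply: jet_omega_neq0 vv'.
    exact: affine_frame_proj (affine_frame_of Sz hU cU (VU y Vy)).
  have fl : flat_on D V sg.
    apply/(HD U z omega Sz hU cU V sg oV cV VU); exists (v ord_max 0), (v ord0 0).
    split=> // y Vy; rewrite (jet_affine_comb _ _ (affine_frame_of Sz hU cU (VU y Vy))).
    exact: sV.
  have hc : hol_mx x (fun y => B y *m v) := hol_mx_mul hB (@hol_mx_cst _ _ _ _ x v).
  have cs : \forall y \near x, spans (frame_sum f y (B y *m v)) (sg y).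
    by apply: (nearS2 BE (open_near oV Vx)) => y <- Vy; exact: sV.
  have [a] := proj1 (PA _ sg (fun i => hc i 0) cs) (fl x Vx).
  rewrite col_mx_deriv (deriv_mx_mul aphi xphi hB (@hol_mx_cst _ _ _ _ x v)).
  by rewrite deriv_mx_cst mulmx0 addr0 mulmxA -mulmxDl => Ea; exists a.
(* Either side implies holomorphy, and the matrix condition only speaks of holomorphic sections. *)
suff main : hol_psection x sigma -> horizontal D x sigma <-> flat_at x sigma.
  split=> H; apply/main => //; [exact: horizontal_hol H|exact: flat_at_hol H].
move=> [t ht ts]; have [c hc tc] := hol_section_frame_sum Ff xf ht.
have cs : \forall y \near x, spans (frame_sum f y (c y)) (sigma y).
  by apply: (nearS2 ts tc) => y + <-.
apply: iff_trans (PA c sigma (fun i => hc i 0) cs) _.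
by rewrite col_mx_deriv; apply: iff_sym; exact: flat_at_mx F FB aphi xphi E hc cs.
Qed.

Lemma hol_connection_eq (D D' : hol_connection J) :
  (forall x sigma, horizontal D x sigma <-> horizontal D' x sigma) -> D = D'.
Proof.
case: D => h1 p1 l1; case: D' => h2 p2 l2 /= H.
have E : h1 = h2.
  by apply/funext => x; apply/funext => sigma; apply/propext; exact: H.
subst h2; have -> : p1 = p2 by exact: Prop_irrelevance.
by have -> : l1 = l2 by exact: Prop_irrelevance.
Qed.

Lemma exists_corresponding_connection : exists D : hol_connection J,
  unique (corresponding_connection q S) D /\
  forall x sigma, horizontal D x sigma <-> flat_at x sigma.
Proof.
have [D HD] := exists_structure_connection; exists D; split=> //.
split; first exact: flat_connection_corresponding.
move=> D' HD'; apply: hol_connection_eq => x sigma.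
by apply: iff_trans (HD x sigma) (iff_sym (corresponding_connection_flat HD' x sigma)).
Qed.

End Connection.

(** * Reality *)

Section ConjugatePoints.
Context {R : realType} {X : riemann_surface (cplx R)} (tau : X -> X).
Hypothesis tauP : antiholomorphic_involution tau.
Local Notation C := (cplx R).
Implicit Types (x y : X) (z : X -> C).

Lemma conj_point_spans (v : 'rV[C]_2) p : spans v p -> spans (map_mx Num.conj v) (conj_point p).
Proof.
case: p => l H [v0 lv]; split; first by rewrite map_mx_eq0.
by exists v.
Qed.

Lemma map_conjK m n (v : 'M[C]_(m, n)) : map_mx Num.conj (map_mx Num.conj v) = v.
Proof. by apply/matrixP => i j; rewrite !mxE conjCK. Qed.

Lemma conj_pointK (p : pspace 'rV[C]_2) : conj_point (conj_point p) = p.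
Proof.
have [v vp] := spans_ex p.
have := conj_point_spans (conj_point_spans vp); rewrite map_conjK => s.
exact: pspace_eq s vp.
Qed.

Lemma conj_affine_point z y : conj_point (affine_point z (tau y)) = affine_point (ctau tau z) y.
Proof.
apply: pspace_eq (conj_point_spans (affine_point_spans z (tau y))) _.
have -> : map_mx Num.conj (affine_row z (tau y)) = affine_row (ctau tau z) y.
  by apply: row2P; rewrite mxE ?affine_row0 ?affine_row1 ?rmorph1.
exact: affine_point_spans.
Qed.

Lemma near_tau x (P : X -> Prop) : (\forall y \near x, P (tau y)) ->
  \forall y \near tau x, P y.
Proof.
move=> H; have := tau_near tauP (x := tau x) (P := fun y => P (tau y)).
rewrite (tauK tauP) => /(_ H); apply: filterS => y; by rewrite (tauK tauP).
Qed.

Lemma moebius_near_conj x (f g : X -> pspace 'rV[C]_2) : moebius_near (tau x) f g ->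
  moebius_near x (fun y => conj_point (f (tau y))) (fun y => conj_point (g (tau y))).
Proof.
move=> [A Au H]; exists (map_mx Num.conj A); first by rewrite map_unitmx.
have LE (p : pspace 'rV[C]_2) : line (conj_point p) = [set map_mx Num.conj v | v in line p].
  by case: p.
apply: filterS (tau_near tauP H) => y E; rewrite !LE E; apply/seteqP; split.
  move=> _ [_ [w fw <-] <-]; exists (map_mx Num.conj w); first by exists w.
  by rewrite -map_mxM.
move=> _ [_ [w fw <-] <-]; exists (w *m A); first by exists w.
by rewrite map_mxM.
Qed.

Lemma conj_hol_coordinate (u : @coordinate C X) : hol_coordinate u ->
  hol_coordinate (tau @^-1` u.1, fun y => conj_point (u.2 (tau y))).
Proof.
move=> [oU iU hU]; split.
- rewrite openE => x Ux; exact (tau_near tauP (open_near oU Ux)).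
- move=> x y; rewrite !inE => Ux Uy /(can_inj conj_pointK) E.
  by rewrite -(tauK tauP x) -(tauK tauP y); congr tau; apply: iU E; rewrite inE.
move=> x Ux; have [f hf fs] := hU _ Ux.
exists (fun y => map_mx Num.conj (f (tau y))).
  move=> i; apply: hol_at_eq (hol_at_conj_tau tauP (hf i)).
  by near=> y; rewrite mxE.
by apply: filterS (tau_near tauP fs) => y; exact: conj_point_spans.
Unshelve. all: by end_near. Qed.

End ConjugatePoints.

Section Reality.
Context {R : realType} {X : riemann_surface (cplx R)} (tau : X -> X).
Hypothesis tauP : antiholomorphic_involution tau.
Context (L : line_bundle X) (q : tangent_root L) (S : projective_structure X).
Local Notation C := (cplx R).
Local Notation J := (jet_bundle L).
Local Notation PS := (psection (jet_bundle L)).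
Local Notation affine_frame := (affine_frame q S).
Local Notation flat_at := (flat_at q S).
Local Notation ctau := (ctau tau).
Local Notation hom := (forall y, conj_pullback tau L y -> L y).
Implicit Types (g h z : X -> C) (x y : X) (phi psi : @chart C X) (s t omega : section L)
  (alpha : hom).
Context (F : forall x, pspace (J x) -> pspace (J (tau x))).
Hypothesis FP : canonical_lift q F.

Lemma jet_bundle_comb x z omega (v : J x) : proj_frame x z omega ->
  exists a b, v = jet_comb z omega x a b.
Proof.
move=> zo; have [s hs ->] := jet_surj v; have [g1 [g2 [_ _ /nbhs_singleton E]]] := jet_coords zo hs.
by exists (g1 x), (g2 x).
Qed.

(** The converse holds because [a : b] |-> [conj a : conj b] is injective. *)
Lemma lift_spansP x alpha z omega (a b : C) (p : pspace (J x)) :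
  flat_hom_at q (tau x) alpha -> proj_frame x z omega ->
  spans (jet_comb z omega x a b) p <->
  spans (jet_comb (ctau z) (transport alpha omega) (tau x) (Num.conj a) (Num.conj b)) (F p).
Proof.
move=> fa zo; have H (u v : C) : spans (jet_comb z omega x u v) p ->
    spans (jet_comb (ctau z) (transport alpha omega) (tau x) (Num.conj u) (Num.conj v)) (F p).
  exact: (lift_spans tauP FP fa zo).
split=> [|sF]; first exact: H.
have [v vp] := spans_ex p; have [a0 [b0 E]] := jet_bundle_comb v zo; rewrite E in vp.
have [k k0] := spans_prop (H _ _ vp) sF; rewrite jet_combZ.
have zo1 : proj_frame (tau (tau x)) z omega by rewrite (tauK tauP).
move=> /(jet_comb_eq (proj_frame_ctau tauP fa zo1))[e1 e2].
have -> : a = Num.conj k * a0 by rewrite -[a]conjCK e1 rmorphM /= conjCK.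
have -> : b = Num.conj k * b0 by rewrite -[b]conjCK e2 rmorphM /= conjCK.
by rewrite -jet_combZ; apply: spans_scale vp; rewrite conjC_eq0.
Qed.

Lemma lift_section_spans x alpha z omega g1 g2 (sigma sigma' : PS) :
  flat_hom_at q (tau x) alpha -> proj_frame x z omega ->
  (\forall y \near x, sigma' (tau y) = F (sigma y)) ->
  (\forall y \near x, spans (jet_comb z omega y (g1 y) (g2 y)) (sigma y)) <->
  (\forall y \near tau x, spans (jet_comb (ctau z) (transport alpha omega) y
     (ctau g1 y) (ctau g2 y)) (sigma' y)).
Proof.
move=> fa zo sF.
have N := nearS3 (tau_near tauP (flat_hom_near fa)) (proj_frame_near zo) sF
  (fun y a b c => conj a (conj b c)).
have cE g y : ctau g (tau y) = Num.conj (g y) by rewrite /ctau (tauK tauP).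
split=> H.
  apply: (near_tau tauP); apply: (nearS2 N H) => y [fy [zy E]].
  by rewrite E !cE => /(lift_spansP _ _ _ fy zy).
apply: (nearS2 N (tau_near tauP H)) => y [fy [zy E]].
by rewrite E !cE => sp; apply/(lift_spansP _ _ _ fy zy).
Qed.

Lemma real_affine_coordinate U z : real_structure tau S -> affine_coordinate S U z ->
  affine_coordinate S (tau @^-1` U) (ctau z).
Proof.
move=> rS /affine_coordinateP/rS /= H; apply/affine_coordinateP.
have -> : affine_point (ctau z) = (fun y => conj_point (affine_point z (tau y))).
  by apply/funext => y; rewrite conj_affine_point.
exact: H.
Qed.

Lemma hol_section_cst x (m : C) s : hol_section x s -> hol_section x (smul (fun=> m) s).
Proof. by move=> hs; exact: hol_section_smul (@hol_at_cst _ _ x m) hs. Qed.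

Lemma jet_comb_smul x z s (m a b : C) : hol_at x z -> hol_section x s ->
  jet_comb z (smul (fun=> m) s) x a b = m *: jet_comb z s x a b.
Proof.
move=> hz hs; rewrite /jet_comb scalerDr !scalerA [m * a]mulrC [m * b]mulrC -!scalerA.
rewrite -(jetZ m hs) -(jetZ m (hol_section_smul hz hs)).
by congr (_ + _ *: jet x _); apply: functional_extensionality_dep => y;
  rewrite /smul !scalerA mulrC.
Qed.

Lemma real_affine_frame x alpha z omega : real_structure tau S -> affine_frame x z omega ->
  flat_hom_at q (tau x) alpha ->
  exists2 m : C, m != 0 &
    affine_frame (tau x) (ctau z) (smul (fun=> m) (transport alpha omega)).
Proof.
move=> rS Fr fa; have [U [Sz Ux tU cU]] := Fr.
have SU := real_affine_coordinate rS Sz.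
have Ux' : (tau @^-1` U) (tau x) by rewrite /= (tauK tauP).
have [c c0 H] := flat_transport_tsqc tauP omega fa.
(* Reality makes conj (z o tau) a projective coordinate; m corrects the square of the transported
   section, which otherwise is conj c times its coordinate field. *)
have [m mm] : exists m : C, m ^+ 2 = (Num.conj c)^-1.
  by exists (sqrtC (Num.conj c)^-1); rewrite sqrtCK.
have m0 : m != 0.
  apply: contraNneq c0 => m0; move/eqP: mm.
  by rewrite m0 expr0n /= eq_sym invr_eq0 conjC_eq0.
exists m; first exact: m0.
apply: (affine_frame_shrink SU Ux').
  have ho : hol_section (tau (tau x)) omega by rewrite (tauK tauP); case: (tU x Ux).
  exact: hol_section_near (hol_section_cst m (flat_transport_hol tauP fa ho)).
apply: (nearS2 H (open_near (affine_coordinate_open SU) Ux')) => y Hy Uy.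
have [phi aphi yphi] := exists_chart y; have [psi apsi ypsi] := exists_chart (tau y).
have hz := affine_coordinate_hol Sz Uy.
have hz1 := affine_coordinate_hol SU Uy.
have CV := is_coord_vectorP q (smul (fun=> m) (transport alpha omega)) hz1 aphi yphi.
apply: (proj2 CV).
rewrite (@tsqc_scale _ _ _ q phi y (transport alpha omega) _ m erefl).
rewrite (chart_deriv_conj_tau tauP aphi yphi apsi ypsi hz).
have E1 := Hy phi psi aphi yphi apsi ypsi.
have E2 := proj1 (is_coord_vectorP q omega hz apsi ypsi) (cU _ Uy).
move: E1 E2; move: (tsqc q phi _ y) (tsqc q psi _ _) (chart_deriv psi z _) (conj_deriv _ _ _ y).
move=> t t' Z K E1 E2; rewrite mm.
have -> : (Num.conj c)^-1 * t * (Num.conj Z * K) = (Num.conj c)^-1 * (t * K) * Num.conj Z by ring.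
have -> : t * K = Num.conj (c * t') by rewrite E1 conjCK.
rewrite rmorphM /= mulrA mulVf ?conjC_eq0// mul1r -rmorphM E2; exact: rmorph1.
Qed.

Lemma wronskian_conj x phi psi g1 g2 : atlas phi -> cdom phi (tau x) -> atlas psi ->
  cdom psi x -> hol_at x g1 -> hol_at x g2 ->
  wronskian phi (ctau g1) (ctau g2) (tau x) = 0 <-> wronskian psi g1 g2 x = 0.
Proof.
move=> aphi xphi apsi xpsi h1 h2; have xpsi' : cdom psi (tau (tau x)) by rewrite (tauK tauP).
have h1' : hol_at (tau (tau x)) g1 by rewrite (tauK tauP).
have h2' : hol_at (tau (tau x)) g2 by rewrite (tauK tauP).
have K0 := conj_deriv_neq0 tauP aphi xphi apsi xpsi'.
rewrite /wronskian /ctau (chart_deriv_conj_tau tauP aphi xphi apsi xpsi' h1').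
rewrite (chart_deriv_conj_tau tauP aphi xphi apsi xpsi' h2') (tauK tauP).
move: (conj_deriv _ _ _ _) K0 => K K0.
move: (chart_deriv psi g1 x) (chart_deriv psi g2 x) (g1 x) (g2 x) => A1 A2 a1 a2.
rewrite !mulrA -!rmorphM -mulrBl -rmorphB; split=> [/eqP|->]; last by rewrite rmorph0 mul0r.
by rewrite mulf_eq0 (negbTE K0) orbF conjC_eq0 => /eqP.
Qed.

Lemma ctauK g : ctau (ctau g) = g.
Proof. by apply/funext => y; rewrite /ctau conjCK (tauK tauP). Qed.

(** In the transported frame, rescaled by m, the coefficients are the conjugates of the old ones,
    and so the Wronskian vanishes at tau x exactly when it does at x. *)
Lemma real_preserves_flat x (sigma sigma' : PS) : real_structure tau S ->
  (\forall y \near x, sigma' (tau y) = F (sigma y)) ->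
  flat_at x sigma <-> flat_at (tau x) sigma'.
Proof.
move=> rS sF; have [z [omega Fr]] := exists_affine_frame q S x.
have zo := affine_frame_proj Fr.
have [alpha fa] := exists_flat tauP q (tau x).
have [m m0 Fr'] := real_affine_frame rS Fr fa.
have [psi apsi xpsi] := exists_chart x; have [phi aphi xphi] := exists_chart (tau x).
have zo1 : proj_frame (tau (tau x)) z omega by rewrite (tauK tauP).
have zo' := proj_frame_ctau tauP fa zo1.
have K g1 g2 : (\forall y \near x, spans (jet_comb z omega y (g1 y) (g2 y)) (sigma y)) <->
    (\forall y \near tau x, spans (jet_comb (ctau z) (smul (fun=> m) (transport alpha omega)) y
     (ctau g1 y) (ctau g2 y)) (sigma' y)).
  apply: iff_trans (lift_section_spans _ _ fa zo sF) _.
  have E : \forall y \near tau x, forall a b, jet_comb (ctau z)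
      (smul (fun=> m) (transport alpha omega)) y a b =
      m *: jet_comb (ctau z) (transport alpha omega) y a b.
    apply: filterS (proj_frame_near zo') => y [[hoy _] hzy _] a b.
    exact: jet_comb_smul.
  split=> H; apply: (nearS2 E H) => y ey.
    by rewrite ey; exact: spans_scale.
  rewrite ey => sp; have := spans_scale (invr_neq0 m0) sp.
  by rewrite scalerA mulVf// scale1r.
split=> [Fl|Fl].
  have [g1 [g2 [h1 h2 sg W]]] := flat_at_frame Fr apsi xpsi Fl.
  have h1' : hol_at (tau (tau x)) g1 by rewrite (tauK tauP).
  have h2' : hol_at (tau (tau x)) g2 by rewrite (tauK tauP).
  apply/(flat_atP Fr' (hol_at_conj_tau tauP h1') (hol_at_conj_tau tauP h2') _ aphi xphi).
    exact: (proj1 (K g1 g2) sg).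
  exact: (proj2 (wronskian_conj aphi xphi apsi xpsi h1 h2) W).
have [g1 [g2 [h1 h2 sg W]]] := flat_at_frame Fr' aphi xphi Fl.
have h1' : hol_at x (ctau g1) := hol_at_conj_tau tauP h1.
have h2' : hol_at x (ctau g2) := hol_at_conj_tau tauP h2.
apply/(flat_atP Fr h1' h2' _ apsi xpsi); first by apply/K; rewrite !ctauK.
have W' : wronskian phi (ctau (ctau g1)) (ctau (ctau g2)) (tau x) = 0 by rewrite !ctauK; exact W.
exact (proj1 (wronskian_conj aphi xphi apsi xpsi h1' h2') W').
Qed.


Lemma flat_smul_affine x w eta h (sigma : PS) : affine_frame x w eta -> hol_at x h ->
  h x != 0 -> (\forall y \near x, spans (jet y (smul h eta) : J y) (sigma y)) ->
  (\forall y \near x, flat_at y sigma) ->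
  exists a b : C, \forall y \near x, h y = a * w y + b.
Proof.
move=> Fr hh h0 sh Fl; have [phi aphi xphi] := exists_chart x.
have [_ hw w0] := affine_frame_proj Fr.
have hD : hol_at x (fun y => chart_deriv phi h y / chart_deriv phi w y).
  by apply: hol_at_div (w0 _ aphi xphi); exact: hol_at_chart_deriv.
set D := (fun y => _) in hD.
have N1 := nearS3 (hol_at_near hh) (hol_at_near hw) (hol_at_near hD)
  (fun y a b c => conj a (conj b c)).
have N2 := nearS3 (affine_frame_near Fr) (chart_near_dom aphi xphi) (hol_at_neq0 hh h0)
  (fun y a b c => conj a (conj b c)).
have DE : \forall y \near x, chart_deriv phi h y = D y * chart_deriv phi w y.
  apply: filterS N2 => y [Fy [yphi _]].
  by have [_ _ wy] := affine_frame_proj Fy; rewrite /D divfK// wy.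
have sg : \forall y \near x, spans (jet_comb w eta y (h y - D y * w y) (D y)) (sigma y).
  apply: (nearS3 N1 N2 sh) => y [hy _] [Fy [yphi _]].
  by rewrite (jet_smulE (affine_frame_proj Fy) hy aphi yphi).
(* [D] is dh/dw. The Wronskian of (h - D w, D) is h D', and h has no zeros near x. *)
have D0 : \forall y \near x, chart_deriv phi D y = 0.
  have N3 := nearS2 Fl (near_join sg) (fun y a b => conj a b).
  apply: (nearS3 (nearS2 N1 DE (fun y a b => conj a b)) N2 N3).
  move=> y [[hy [wy Dy]] Ey] [Fy [yphi ny]] [Fly sgy].
  have hDw : hol_at y (fun v => D v * w v) := hol_at_mul Dy wy.
  have hg : hol_at y (fun v => h v - D v * w v) := hol_at_sub hy hDw.
  have := proj1 (flat_atP Fy hg Dy sgy aphi yphi) Fly.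
  rewrite /wronskian (chart_deriv_sub aphi yphi hy hDw) (chart_deriv_mul aphi yphi Dy wy) Ey.
  move: (chart_deriv phi D y) (chart_deriv phi w y) (D y) (h y) ny (w y) => D' W' d e e0 v.
  have -> : (e - d * v) * D' - d * (d * W' - (d * W' + v * D')) = e * D' by ring.
  by move=> /eqP; rewrite mulf_eq0 (negbTE e0) => /eqP.
have Dc := chart_deriv0_near aphi xphi hD D0.
exists (D x), (h x - D x * w x).
have hk : hol_at x (fun y => h y - D x * w y).
  exact (hol_at_sub hh (hol_at_mul (@hol_at_cst _ _ x (D x)) hw)).
have K : \forall y \near x, chart_deriv phi (fun v => h v - D x * w v) y = 0.
  apply: (nearS3 (nearS2 N1 DE (fun y a b => conj a b)) N2 Dc).
  move=> y [[hy [wy _]] Ey] [_ [yphi _]] Dy.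
  have hDw : hol_at y (fun v => D x * w v) := hol_at_mul (@hol_at_cst _ _ y (D x)) wy.
  rewrite (chart_deriv_sub aphi yphi hy hDw) (chart_deriv_scale _ aphi yphi wy) Ey Dy.
  exact: subrr.
by apply: filterS (chart_deriv0_near aphi xphi hk K) => y <-; rewrite addrC subrK.
Qed.

Lemma preserves_flat_moebius x z omega w eta :
  (forall y (sigma sigma' : PS), (\forall v \near y, sigma' (tau v) = F (sigma v)) ->
    flat_at y sigma <-> flat_at (tau y) sigma') ->
  affine_frame x z omega -> affine_frame (tau x) w eta ->
  exists a b c d, moebius_rel (tau x) w (ctau z) a b c d.
Proof.
move=> PF Fz Fw; have zo := affine_frame_proj Fz.
have [alpha fa] := exists_flat tauP q (tau x).
have zo1 : proj_frame (tau (tau x)) z omega by rewrite (tauK tauP).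
have zo' := proj_frame_ctau tauP fa zo1.
have [hb hz' z0'] := zo'; have [heta hw w0] := affine_frame_proj Fw.
set beta := transport alpha omega in hb zo'.
have [k hk bE] := triv_coord heta (proj1 hb).
have k0 : k (tau x) != 0.
  apply: contraNneq (proj2 hb) => k0.
  by rewrite (nbhs_singleton bE) k0 scale0r.
(* The jet of (a conj (z o tau) + b) beta spans the lift of a flat section, hence a flat one; its
   coefficient along [eta] is therefore affine in w. *)
have key (a b : C) : a * ctau z (tau x) + b != 0 -> exists a' b' : C,
    \forall y \near tau x, (a * ctau z y + b) * k y = a' * w y + b'.
  move=> ab0; have ab : (b, a) != (0, 0).
    by apply: contraNneq ab0 => -[-> ->]; rewrite mul0r addr0.
  have ab' : (Num.conj b, Num.conj a) != (0, 0).
    by apply: contraNneq ab => -[/eqP + /eqP]; rewrite !conjC_eq0 => /eqP -> /eqP ->.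
  have [sigma sigmaE] := exists_psection_comb q S z omega (Num.conj a) (Num.conj b).
  have [sigma' sigmaE'] := exists_psection_comb q S (ctau z) beta a b.
  have s1 : \forall y \near x, spans (jet_comb z omega y (Num.conj b) (Num.conj a)) (sigma y).
    by apply: filterS (proj_frame_near zo) => y zy; apply: sigmaE; exact: jet_omega_neq0 zy ab'.
  have s2 : \forall y \near tau x, spans (jet_comb (ctau z) beta y b a) (sigma' y).
    by apply: filterS (proj_frame_near zo') => y zy; apply: sigmaE'; exact: jet_omega_neq0 zy ab.
  have E : \forall y \near x, sigma' (tau y) = F (sigma y).
    have N := nearS2 (tau_near tauP (flat_hom_near fa)) (proj_frame_near zo)
      (fun y a b => conj a b).
    apply: (nearS3 N s1 (tau_near tauP s2)) => y [fy zy] sy sy'.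
    apply: pspace_eq sy' _; have := proj1 (lift_spansP _ _ _ fy zy) sy.
    by rewrite !conjCK.
  have Fl : \forall y \near x, flat_at y sigma.
    by apply: (nearS2 (affine_frame_near Fz) (near_join s1)) => y; exact: flat_at_const.
  have Fl' : \forall y \near tau x, flat_at y sigma'.
    apply: (near_tau tauP); apply: (nearS2 Fl (near_join E)) => y fy Ey.
    exact: (proj1 (PF y sigma sigma' Ey) fy).
  have hab : hol_at (tau x) (fun y => a * ctau z y + b) by hol_at_tac.
  have hh : hol_at (tau x) (fun y => (a * ctau z y + b) * k y) := hol_at_mul hab hk.
  apply: (flat_smul_affine Fw hh _ _ Fl'); first exact: mulf_neq0.
  have N := nearS2 (hol_at_near hab) (near_join bE) (fun y a b => conj a b).
  apply: (nearS3 N (proj_frame_near zo') s2) => y [haby bEy] [[hby _] hzy _].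
  have -> : jet_comb (ctau z) beta y b a = jet y (fun v => (a * ctau z v + b) *: beta v : L v).
    by rewrite (jet_affine a b hzy hby).
  have hs : hol_section y (fun v => (a * ctau z v + b) *: beta v : L v).
    exact: hol_section_smul haby hby.
  rewrite (jet_eq (t := smul (fun v => (a * ctau z v + b) * k v) eta) hs); first by [].
  by apply: filterS bEy => v ->; rewrite /smul scalerA.
have [|c [d kE]] := key 0 1; first by rewrite mul0r add0r oner_eq0.
(* [key] needs a function that is nonzero at the point. Adding b0 gives it the value 1, and b0 k is
   subtracted again in [H]. *)
pose b0 := 1 - ctau z (tau x).
have [|a [b zE]] := key 1 b0; first by rewrite mul1r addrC subrK oner_eq0.
have H : \forall y \near tau x, ctau z y * (c * w y + d) = (a - b0 * c) * w y + (b - b0 * d).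
  apply: (nearS2 kE zE) => y; rewrite mul0r add0r mul1r => e1; rewrite mul1r e1 => e2.
  have -> : (a - b0 * c) * w y + (b - b0 * d) = (a * w y + b) - b0 * (c * w y + d) by ring.
  by rewrite -e2; ring.
exists (a - b0 * c), (b - b0 * d), c, d; split; last exact: H.
(* A vanishing determinant would make the derivative of conj (z o tau) vanish. *)
have [phi aphi xphi] := exists_chart (tau x).
have E := moebius_rel_deriv H hw hz' aphi xphi.
have cw0 : c * w (tau x) + d != 0.
  by have := nbhs_singleton kE; rewrite mul0r add0r mul1r => <-.
apply/eqP => D0; move/eqP: E; rewrite D0 mul0r mulf_eq0 (negbTE (z0' _ aphi xphi)) /=.
by rewrite expf_eq0 (negbTE cw0).
Qed.

(** Near x, conj (u o tau) is a Moebius transform of conj (z o tau) because u and z are both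
    projective near tau x, and the latter is one of a projective coordinate w near x. *)
Lemma preserves_flat_real :
  (forall y (sigma sigma' : PS), (\forall v \near y, sigma' (tau v) = F (sigma v)) ->
    flat_at y sigma <-> flat_at (tau y) sigma') -> real_structure tau S.
Proof.
move=> PF u Su; apply/projective_coordinateP; split.
  exact (conj_hol_coordinate tauP (projective_coordinate_hol Su)).
move=> x ux; have [z [omega Fz]] := exists_affine_frame q S (tau x).
have [w [eta Fw]] := exists_affine_frame q S (tau (tau x)).
have M := preserves_flat_moebius PF Fz Fw; rewrite (tauK tauP) in Fw M.
have [U [Sz Uz _ _]] := Fz; have [V [Sw Vx _ _]] := Fw.
exists (V, affine_point w); split; [exact/affine_coordinateP|exact: Vx|].
apply: (moebius_near_trans (proj2 (moebius_affineP _ _ _) M)).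
have -> : affine_point (ctau z) = (fun y => conj_point (affine_point z (tau y))).
  by apply/funext => y; rewrite conj_affine_point.
apply: (moebius_near_conj tauP (g := u.2)).
exact (projective_coordinate_compatible (proj1 (affine_coordinateP _ _ _) Sz) Su Uz ux).
Qed.

Lemma real_iff_preserves (D : hol_connection J) :
  (forall x sigma, horizontal D x sigma <-> flat_at x sigma) ->
  real_structure tau S <-> preserves_connection F D.
Proof.
move=> HD; split=> [rS x sigma sigma' E|PD].
  apply: iff_trans (HD _ _) (iff_trans _ (iff_sym (HD _ _))).
  exact: real_preserves_flat.
apply: preserves_flat_real => y sigma sigma' E.
apply: iff_trans (iff_sym (HD _ _)) (iff_trans _ (HD _ _)).
exact: PD.
Qed.

End Reality.

(** * Smoothness of the lift *)

Section Differentiability.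
Context {R : realType}.

Lemma is_diff_eps (U W : normedModType R) (f : U -> W) (df : {linear U -> W}) (x : U) :
  continuous df -> (forall e : R, 0 < e -> \forall h \near (0 : U),
    `|f (h + x) - f x - df h| <= e * `|h|) -> differentiable f x /\ 'd f x = df :> (U -> W).
Proof.
move=> cdf H; have E : f \o shift x = cst (f x) + df +o_ (0 : U) id.
  apply/eqaddoP => e e0; apply: filterS (H e e0) => h.
  by rewrite -[(_ - _ : U -> W) h]/(f (h + x) - (f x + df h)) opprD addrA.
have D := diff_unique cdf E; split=> //.
by apply/diff_locallyP; rewrite D.
Qed.

Lemma near_eq_differentiable (U W : normedModType R) (f g : U -> W) (x : U) :
  (\forall y \near x, f y = g y) -> differentiable f x -> differentiable g x.
Proof.
move=> fg df; have [cd /eqaddoP E] := proj1 (diff_locallyP _ _) df.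
suff : differentiable g x /\ 'd g x = 'd f x :> (U -> W) by case.
apply: is_diff_eps => [|e e0]; first exact: cd.
have fg0 : \forall h \near (0 : U), f (h + x) = g (h + x).
  move: fg => /nbhs_ballP[r /= r0 Hr]; apply/nbhs_ballP; exists r => // h.
  rewrite -!ball_normE /= sub0r => hr; apply: Hr; rewrite -ball_normE /=.
  by rewrite opprD addrCA subrr addr0.
apply: (nearS2 (E e e0) fg0) => h; rewrite -(nbhs_singleton fg) => + <-.
by rewrite -[(_ - _ : U -> W) h]/(f (h + x) - (f x + 'd f x h)) opprD addrA.
Qed.

(* Coinduction: a class of differentiable functions closed under directional
   derivatives consists of smooth functions. *)
Lemma Ck_on_class (U W : normedModType R) (A : set U) (P : (U -> W) -> Prop) : open A ->
  (forall f, P f -> forall x, A x -> differentiable f x) ->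
  (forall f v, P f -> exists2 f', P f' & forall x, A x -> 'D_v f x = f' x) ->
  forall k f, P f -> Ck_on A k f.
Proof.
move=> oA Pd PD k f Pf.
(* Generalised to functions that agree with a member of the class on [A], since derivatives are
   identified there only. *)
suff H g : (forall x, A x -> f x = g x) -> Ck_on A k g by exact: H.
elim: k f Pf g => [|k IH] f Pf g fg.
all: have fgn x (Ax : A x) : \forall y \near x, f y = g y by
  apply: filterS (fg) _; apply: open_nbhs_nbhs; split.
  move=> x Ax; apply: differentiable_continuous.
  exact: near_eq_differentiable (fgn x Ax) (Pd f Pf x Ax).
split=> [x Ax|v]; first exact: near_eq_differentiable (fgn x Ax) (Pd f Pf x Ax).
have [f' Pf' fE] := PD f v Pf; apply: (IH f' Pf') => x Ax.
by rewrite -fE//; apply: near_eq_derive (fgn x Ax).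
Qed.

End Differentiability.

(** * A class of smooth functions of four real variables *)

Section SmoothFunctions.
Context {R : realType}.
Local Notation C := (cplx R).
Local Notation U := ('rV[R]_4).
Implicit Types (v x : U) (A : set U).

Definition base_coord v : C := (v 0 0 +i* v 0 1)%C.

Definition base_linear (a b : R) v : R := a * v 0 0 + b * v 0 1.

Fact base_linear_linear a b : linear (base_linear a b).
Proof. by move=> k u v; rewrite /base_linear !mxE -[k *: _]/(k * _); ring. Qed.

HB.instance Definition _ a b := GRing.isLinear.Build R U R _ (base_linear a b)
  (base_linear_linear a b).

Lemma base_linear_continuous a b : continuous (base_linear a b).
Proof.
move=> v; apply: (@continuousD _ _ _ (fun v : U => a * v 0 0) (fun v : U => b * v 0 1)).
  by apply: continuousM; [exact: cst_continuous|exact: coord_continuous].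
by apply: continuousM; [exact: cst_continuous|exact: coord_continuous].
Qed.

Lemma coord_le_norm v (i : 'I_4) : `|v 0 i| <= `|v|.
Proof.
rewrite /Num.norm/= mx_normrE.
have := @le_bigmax _ _ _ 0 (fun i : 'I_1 * 'I_4 => `|v i.1 i.2|) (ord0, i).
by rewrite /=; exact.
Qed.

Lemma base_coordD v x : base_coord (v + x) = base_coord v + base_coord x.
Proof. by rewrite /base_coord !mxE. Qed.

Lemma nrm_base_coord v : nrm (base_coord v) <= 2 * `|v|.
Proof.
apply: le_trans (nrm_le_ReIm _) _; rewrite /= mulr2n mulrDl mul1r.
by apply: lerD; exact: coord_le_norm.
Qed.

Lemma base_coord_near x (P : C -> Prop) : (\forall z \near base_coord x, P z) ->
  \forall v \near x, P (base_coord v).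
Proof.
move=> /nearCP[r r0 Hr]; apply/nbhs_ballP; exists (r / 2); first by rewrite /= divr_gt0.
move=> v; rewrite -ball_normE /= => xv; apply: Hr.
have -> : base_coord v - base_coord x = base_coord (v - x).
  by apply/eqP; rewrite subr_eq -base_coordD subrK.
apply: le_lt_trans (nrm_base_coord _) _.
by rewrite -normrN opprB mulrC -ltr_pdivlMr.
Qed.

(** T is the real or the imaginary part; a and b are the coefficients given by the Cauchy-Riemann
    equations. *)
Lemma is_diff_base (T : C -> R) (h : C -> C) x (d : C) (a b : R) :
  {morph T : z w / z - w} -> (forall z, `|T z| <= nrm z) ->
    (forall v, T (d * base_coord v) = base_linear a b v) ->
  is_derive (base_coord x) 1 h d ->
  differentiable (fun v => T (h (base_coord v))) x /\
  forall v, 'D_v (fun v => T (h (base_coord v))) x = base_linear a b v.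
Proof.
move=> TB Tn Td /is_derive1P H.
have [|e e0|dd dE] := @is_diff_eps _ _ _ (fun v => T (h (base_coord v))) (base_linear a b) x.
- exact: base_linear_continuous.
- have e2 : 0 < (e / 2)%:C%C :> C by rewrite ltcR divr_gt0.
  have B0 : base_coord 0 = 0 by rewrite /base_coord !mxE.
  have H' := H _ e2; rewrite -B0 in H'.
  apply: filterS (base_coord_near H') => v.
  rewrite !nrmE -rmorphM lecR => Hv; rewrite -[X in _ - X]/(base_linear a b v) -Td -!TB.
  rewrite base_coordD [base_coord v + _]addrC.
  apply: le_trans (Tn _) (le_trans Hv _).
  rewrite -mulrA ler_pM2l// mulrC -ler_pdivlMr ?invr_gt0// invrK mulrC.
  exact: nrm_base_coord.
split=> // v; rewrite deriveE// dE //.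
Qed.


(** Just large enough to contain the coordinates of the lift, and closed under directional
    derivatives because the derivative of a holomorphic h is again holomorphic. *)
Inductive smooth_fun A : (U -> R) -> Prop :=
| SmoothCst c : smooth_fun A (fun=> c)
| SmoothCoord i : smooth_fun A (fun v => v 0 i)
| SmoothRe h : (forall x, A x -> holomorphic_near h (base_coord x)) ->
    smooth_fun A (fun v => complex.Re (h (base_coord v) : R[i]))
| SmoothIm h : (forall x, A x -> holomorphic_near h (base_coord x)) ->
    smooth_fun A (fun v => complex.Im (h (base_coord v) : R[i]))
| SmoothAdd f g : smooth_fun A f -> smooth_fun A g -> smooth_fun A (fun v => f v + g v)
| SmoothMul f g : smooth_fun A f -> smooth_fun A g -> smooth_fun A (fun v => f v * g v)
| SmoothInv f : (forall x, A x -> f x != 0) -> smooth_fun A f ->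
    smooth_fun A (fun v => (f v)^-1).

Lemma smooth_fun_deriv A f : smooth_fun A f -> (forall x, A x -> differentiable f x) /\
  forall v, exists2 f', smooth_fun A f' & forall x, A x -> 'D_v f x = f' x.
Proof.
have holD h x : holomorphic_near h (base_coord x) ->
    is_derive (base_coord x) 1 h (derive1 h (base_coord x)).
  by move=> /nbhs_singleton; exact: is_derive1E.
elim=> {f} [c|i|h hh|h hh|f g sf [df Df] sg [dg Dg]|f g sf [df Df] sg [dg Dg]|f n0 sf [df Df]].
- split=> [x _|v]; first exact: differentiable_cst.
  by exists (fun=> 0) => [|x _]; [exact: SmoothCst|exact: derive_cst].
- split=> [x _|v]; first exact: differentiable_coord.
  exists (fun=> v 0 i) => [|x _]; first exact: SmoothCst.
  apply/lim_near_cst => //=; near=> h; rewrite !mxE addrK -[LHS]/(_ * _) mulrA mulVf ?mul1r//.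
  by near: h; exact: nbhs_dnbhs_neq.
- have H x (Ax : A x) := @is_diff_base (fun z : C => complex.Re (z : R[i])) h x _
    (complex.Re (derive1 h (base_coord x) : R[i]))
    (- complex.Im (derive1 h (base_coord x) : R[i]))
    (@complexReB R) (@Re_le_nrm R) _ (holD h x (hh x Ax)).
  have Td x v : complex.Re ((derive1 h (base_coord x) * base_coord v : C) : R[i]) =
     base_linear (complex.Re (derive1 h (base_coord x) : R[i]))
       (- complex.Im (derive1 h (base_coord x) : R[i])) v.
    by rewrite complexReM /base_linear /= mulNr.
  split=> [x Ax|v]; first by have [] := H Td x Ax.
  exists (fun x => complex.Re (derive1 h (base_coord x) : R[i]) * v 0 0 +
    (-1 * complex.Im (derive1 h (base_coord x) : R[i])) * v 0 1).
    apply: SmoothAdd; apply: SmoothMul; try exact: SmoothCst.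
      by apply: SmoothRe => x Ax; exact: holomorphic_near_derive (hh x Ax).
    apply: SmoothMul; first exact: SmoothCst.
    by apply: SmoothIm => x Ax; exact: holomorphic_near_derive (hh x Ax).
  by move=> x Ax; have [_ ->] := H Td x Ax; rewrite /base_linear mulN1r.
- have H x (Ax : A x) := @is_diff_base (fun z : C => complex.Im (z : R[i])) h x _
    (complex.Im (derive1 h (base_coord x) : R[i]))
    (complex.Re (derive1 h (base_coord x) : R[i]))
    (@complexImB R) (@Im_le_nrm R) _ (holD h x (hh x Ax)).
  have Td x v : complex.Im ((derive1 h (base_coord x) * base_coord v : C) : R[i]) =
     base_linear (complex.Im (derive1 h (base_coord x) : R[i]))
       (complex.Re (derive1 h (base_coord x) : R[i])) v.
    by rewrite complexImM /base_linear /= addrC.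
  split=> [x Ax|v]; first by have [] := H Td x Ax.
  exists (fun x => complex.Im (derive1 h (base_coord x) : R[i]) * v 0 0 +
    complex.Re (derive1 h (base_coord x) : R[i]) * v 0 1).
    apply: SmoothAdd; apply: SmoothMul; try exact: SmoothCst.
      by apply: SmoothIm => x Ax; exact: holomorphic_near_derive (hh x Ax).
    by apply: SmoothRe => x Ax; exact: holomorphic_near_derive (hh x Ax).
  by move=> x Ax; have [_ ->] := H Td x Ax.
- split=> [x Ax|v]; first exact: differentiableD (df x Ax) (dg x Ax).
  have [f' sf' fE] := Df v; have [g' sg' gE] := Dg v.
  exists (fun x => f' x + g' x) => [|x Ax]; first exact: SmoothAdd.
  rewrite -fE// -gE//; apply: deriveD; apply: diff_derivable; [exact: df|exact: dg].
- split=> [x Ax|v]; first exact: differentiableM (df x Ax) (dg x Ax).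
  have [f' sf' fE] := Df v; have [g' sg' gE] := Dg v.
  exists (fun x => f x * g' x + g x * f' x) => [|x Ax].
    by apply: SmoothAdd; exact: SmoothMul.
  rewrite -fE// -gE//; apply: deriveM; apply: diff_derivable; [exact: df|exact: dg].
split=> [x Ax|v]; first exact: differentiableV (df x Ax) (n0 x Ax).
have [f' sf' fE] := Df v.
exists (fun x => (-1 * ((f x)^-1 * (f x)^-1)) * f' x) => [|x Ax].
  by apply: SmoothMul => //; apply: SmoothMul; [exact: SmoothCst|apply: SmoothMul;
    exact: SmoothInv].
rewrite -fE// (deriveV (n0 x Ax) (diff_derivable (df x Ax))) mulN1r expr2 invfM; reflexivity.
Unshelve. all: by end_near. Qed.

Definition smooth_row A (g : U -> U) := exists2 f : 'I_4 -> U -> R,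
  forall i, smooth_fun A (f i) & g = fun v => \row_i f i v.

Lemma smooth_row_deriv A g : smooth_row A g -> (forall x, A x -> differentiable g x) /\
  forall v, exists2 g', smooth_row A g' & forall x, A x -> 'D_v g x = g' x.
Proof.
move=> [f sf ->].
have E : (fun v => \row_i f i v : U) = \sum_(i < 4) (fun v => f i v *: (delta_mx 0 i : U)).
  apply/funext => v; rewrite fct_sumE [LHS]row_sum_delta; apply: eq_bigr => i _.
  by rewrite mxE.
have dz i x (Ax : A x) : differentiable (fun v => f i v *: (delta_mx 0 i : U)) x.
  by apply: differentiableZl; have [d _] := smooth_fun_deriv (sf i); exact: d.
split=> [x Ax|v].
  by rewrite E; apply: differentiable_sum => i; exact: dz.
have [f' sf' fE] : exists2 f' : 'I_4 -> U -> R, forall i, smooth_fun A (f' i) &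
    forall i x, A x -> 'D_v (f i) x = f' i x.
  have H i := cid2 (proj2 (smooth_fun_deriv (sf i)) v).
  by exists (fun i => s2val (H i)) => i; [exact (s2valP (H i))|exact (s2valP' (H i))].
exists (fun v => \row_i f' i v); first by exists f'.
move=> x Ax; rewrite E.
have D i : is_derive x v (fun w => f i w *: (delta_mx 0 i : U)) (f' i x *: delta_mx 0 i).
  have df : differentiable (f i) x by have [d _] := smooth_fun_deriv (sf i); exact: d.
  split; first by apply: diff_derivable; exact: dz.
  by rewrite deriveE; [rewrite diffZl// -fE// deriveE|exact: dz].
have := is_derive_sum D; case=> _ ->.
rewrite [RHS]row_sum_delta; apply: eq_bigr => i _; by rewrite mxE.
Qed.

Lemma smooth_row_Ck A g : open A -> smooth_row A g -> forall k, Ck_on A k g.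
Proof.
move=> oA sg k; apply: (Ck_on_class (P := smooth_row A)) => // f.
  by move=> /smooth_row_deriv[].
by move=> v /smooth_row_deriv[_]; exact.
Qed.

Definition smooth_cfun A (f : U -> C) := smooth_fun A (fun v => complex.Re (f v : R[i])) /\
  smooth_fun A (fun v => complex.Im (f v : R[i])).

Lemma smooth_fun_eq A f g : f =1 g -> smooth_fun A f -> smooth_fun A g.
Proof. by move=> /funext ->. Qed.

Lemma smooth_cfun_hol A h : (forall x, A x -> holomorphic_near h (base_coord x)) ->
  smooth_cfun A (fun v => h (base_coord v)).
Proof. by move=> hh; split; [exact: SmoothRe|exact: SmoothIm]. Qed.

Lemma smooth_cfun_add A f g : smooth_cfun A f -> smooth_cfun A g ->
  smooth_cfun A (fun v => f v + g v).
Proof.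
move=> [f1 f2] [g1 g2]; split.
  by apply: smooth_fun_eq (SmoothAdd f1 g1) => v; rewrite complexReD.
by apply: smooth_fun_eq (SmoothAdd f2 g2) => v; rewrite complexImD.
Qed.

Lemma smooth_cfun_mul A f g : smooth_cfun A f -> smooth_cfun A g ->
  smooth_cfun A (fun v => f v * g v).
Proof.
move=> [f1 f2] [g1 g2]; split.
  apply: smooth_fun_eq (SmoothAdd (SmoothMul f1 g1)
    (SmoothMul (SmoothCst A (-1)) (SmoothMul f2 g2))) => v.
  by rewrite complexReM mulN1r.
by apply: smooth_fun_eq (SmoothAdd (SmoothMul f1 g2) (SmoothMul f2 g1)) => v; rewrite complexImM.
Qed.

Lemma complex_ReIm_neq0 (z : C) : z != 0 ->
  complex.Re (z : R[i]) * complex.Re (z : R[i]) +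
    complex.Im (z : R[i]) * complex.Im (z : R[i]) != 0.
Proof.
case: z => a b /=; apply: contraNneq => /eqP.
rewrite -!expr2 paddr_eq0 ?sqr_ge0// !sqrf_eq0 => /andP[/eqP -> /eqP ->]; exact: eqxx.
Qed.

Lemma smooth_cfun_inv A f : (forall x, A x -> f x != 0) -> smooth_cfun A f ->
  smooth_cfun A (fun v => (f v)^-1).
Proof.
move=> n0 [f1 f2].
have sN := SmoothInv (fun x Ax => complex_ReIm_neq0 (n0 x Ax))
  (SmoothAdd (SmoothMul f1 f1) (SmoothMul f2 f2)).
split.
  apply: smooth_fun_eq (SmoothMul f1 sN) => v.
  by case: (f v) => a b /=; rewrite !expr2.
apply: smooth_fun_eq (SmoothMul (SmoothMul (SmoothCst A (-1)) f2) sN) => v.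
by case: (f v) => a b /=; rewrite !expr2 mulN1r mulNr.
Qed.

Lemma smooth_cfun_conj A f : smooth_cfun A f -> smooth_cfun A (fun v => Num.conj (f v)).
Proof.
move=> [f1 f2]; split.
  by apply: smooth_fun_eq f1 => v; case: (f v).
apply: smooth_fun_eq (SmoothMul (SmoothCst A (-1)) f2) => v.
by rewrite mulN1r; case: (f v).
Qed.

End SmoothFunctions.

(** * The lift in coordinates *)

Section LiftSmooth.
Context {R : realType} {X : riemann_surface (cplx R)} (tau : X -> X).
Hypothesis tauP : antiholomorphic_involution tau.
Context (L : line_bundle X) (q : tangent_root L).
Local Notation C := (cplx R).
Local Notation J := (jet_bundle L).
Local Notation U := ('rV[R]_4).
Context (F : forall x, pspace (J x) -> pspace (J (tau x))).
Hypothesis FP : canonical_lift q F.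
Implicit Types (x y : X) (phi psi : @chart C X) (e : local_frame 2 J) (v : U).

(** In frames the lift is c |-> conj (M c). Writing the conjugation outside makes M, the conjugate
    of a holomorphic matrix composed with tau, holomorphic itself. *)
Lemma lift_frame x e e' : frames J e -> fdom e x -> frames J e' -> fdom e' (tau x) ->
  exists2 M : X -> 'M[C]_2, hol_mx x M & \forall y \near x, forall (c : 'cV[C]_2) p,
    spans (frame_sum e y c) p ->
    spans (frame_sum e' (tau y) (map_mx Num.conj (M y *m c))) (F p).
Proof.
move=> /jet_frameE[psi [e0 [apsi Fe0 ->]]] xe Fe' xe'.
have zo := jet_frame_proj apsi Fe0 xe.
have [alpha fa] := exists_flat tauP q (tau x).
have zo1 : proj_frame (tau (tau x)) (cmap psi) (fvec e0 ord0) by rewrite (tauK tauP).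
have zo' := proj_frame_ctau tauP fa zo1.
have [B [hB BE]] := exists_frame_mx zo' Fe' xe'.
exists (fun y => map_mx Num.conj (B (tau y))).
  move=> i j; apply: hol_at_eq (hol_at_conj_tau tauP (hB i j)).
  by near=> y; rewrite mxE.
have N := nearS2 (tau_near tauP (flat_hom_near fa)) (proj_frame_near zo)
  (fun y a b => conj a b).
apply: (nearS2 N (tau_near tauP BE)) => y [fy zy] By c p.
rewrite /frame_sum (jet_frame_sum psi e0 y (fun i => c i 0)) => sp.
have := proj1 (lift_spansP tauP FP _ _ _ fy zy) sp.
have -> : map_mx Num.conj (map_mx Num.conj (B (tau y)) *m c) =
    B (tau y) *m map_mx Num.conj c.
  by rewrite map_mxM map_conjK.
have := By (map_mx Num.conj c); rewrite /frame_sum => <-.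
by rewrite !mxE.
Unshelve. all: by end_near. Qed.

Definition coord_col (i : 'I_2) (w : C) : 'cV[C]_2 := \col_j if j == i then 1 else w.

Lemma rev_ord2 (i : 'I_2) : rev_ord i != i.
Proof. by case: (ord2P i) => ->. Qed.

Lemma sum_ord2 (V : nmodType) (f : 'I_2 -> V) (i : 'I_2) :
  \sum_(j < 2) f j = f i + f (rev_ord i).
Proof.
rewrite (bigD1 i) //=; congr (_ + _); rewrite (bigD1 (rev_ord i)) ?rev_ord2 //=.
rewrite big1 ?addr0// => j /andP[].
by case: (ord2P i) (ord2P j) => -> [] ->; rewrite -!val_eqE.
Qed.

Lemma frame_sum_coord e y i (w : C) :
  frame_sum e y (coord_col i w) = fvec e i y + w *: fvec e (rev_ord i) y.
Proof.
rewrite /frame_sum (sum_ord2 _ i) !mxE eqxx (negbTE (rev_ord2 i)) scale1r; reflexivity.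
Qed.

Lemma frame_sumZ e y (k : C) (c : 'cV[C]_2) : frame_sum e y (k *: c) = k *: frame_sum e y c.
Proof.
rewrite /frame_sum scaler_sumr; apply: eq_bigr => j _; rewrite mxE -scalerA; reflexivity.
Qed.

Lemma mul_coord_col (M : 'M[C]_2) i j (w : C) :
  (M *m coord_col i w) j 0 = M j i + M j (rev_ord i) * w.
Proof.
by rewrite mxE (sum_ord2 _ i) !mxE eqxx (negbTE (rev_ord2 i)) mulr1.
Qed.

Lemma coord_colZ (c : 'cV[C]_2) i : c i 0 != 0 ->
  c = c i 0 *: coord_col i (c (rev_ord i) 0 / c i 0).
Proof.
move=> n0; apply/colP => j; rewrite !mxE.
have [->|ji] := eqVneq j i; first by rewrite mulr1.
have -> : j = rev_ord i.
  by move: ji; case: (ord2P i) (ord2P j) => -> [] ->; rewrite // => _; exact: val_inj.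
by rewrite mulrC divfK.
Qed.

Definition fibre_coord v : C := (v 0 (inord 2) +i* v 0 (inord 3))%C.

Lemma smooth_fibre_coord A : smooth_cfun A fibre_coord.
Proof. by split; exact: SmoothCoord. Qed.

Lemma smooth_cfun_near_neq0 (A : set U) (f : U -> C) (u : U) : smooth_cfun A f -> A u ->
  f u != 0 -> \forall v \near u, f v != 0.
Proof.
move=> [f1 f2] Au n0; have s := SmoothAdd (SmoothMul f1 f1) (SmoothMul f2 f2).
have [d _] := smooth_fun_deriv s; have c := differentiable_continuous (d u Au).
have N := complex_ReIm_neq0 n0.
have : \forall v \near u, complex.Re (f v : R[i]) * complex.Re (f v : R[i]) +
    complex.Im (f v : R[i]) * complex.Im (f v : R[i]) != 0.
  suff NP : \forall t \near complex.Re (f u : R[i]) * complex.Re (f u : R[i]) +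
      complex.Im (f u : R[i]) * complex.Im (f u : R[i]), t != 0 by exact: (c _ NP).
  apply/nearRP; exists (`|complex.Re (f u : R[i]) * complex.Re (f u : R[i]) +
    complex.Im (f u : R[i]) * complex.Im (f u : R[i])|).
    by rewrite normr_gt0 complex_ReIm_neq0.
  by move=> t; apply: contraTneq => ->; rewrite sub0r normrN ltxx.
apply: filterS => v; apply: contraNneq => ->; by rewrite /= !mul0r addr0.
Qed.

(** The lift sends (z, w) to the conjugates of T(z) and of N_(1-i') / N_i', where the entries N_j of
    M (e_i + w e_(1-i)) are affine in w with coefficients holomorphic in z. *)
Lemma lift_smooth : smooth_map (total_map F).
Proof.
move=> [x pp] phi e i u phi' e' i' u' aphi Fe [/= xphi xe ux sp] aphi' Fe' [/= xphi' xe' ux' sp'].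
have [M hM ME] := lift_frame Fe xe Fe' xe'.
pose T := ctau tau (cmap phi').
have hT : hol_at x T := hol_at_conj_tau tauP (hol_at_cmap aphi' xphi').
pose m j k : C -> C := (fun y => M y j k) \o cinv phi.
pose N j v := m j i (base_coord v) + m j (rev_ord i) (base_coord v) * fibre_coord v.
have uE : base_coord u = cmap phi x by rewrite ux.
rewrite -frame_sum_coord in sp; rewrite -frame_sum_coord in sp'.
have NE v y c : cinv phi (base_coord v) = y -> fibre_coord v = c -> forall j,
    N j v = (M y *m coord_col i c) j 0.
  by move=> vy vc j; rewrite mul_coord_col /N /m /= vy vc.
(* The image of the base point lies in the patch of index i', where the coefficient of e'_i' is
   nonzero. *)
have N0 : N i' u != 0.
  have s2 := nbhs_singleton ME _ _ sp.
  have [k k0] := spans_prop sp' s2.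
  rewrite -frame_sumZ => /(frame_sum_inj Fe' xe')/colP/(_ i').
  rewrite [LHS]mxE [RHS]mxE [coord_col i' _ _ _]mxE eqxx mulr1 => E; rewrite (NE u x _ _ erefl);
    last by rewrite uE chart_inv.
  by apply: contraNneq k0 => Z0; rewrite -E [X in Num.conj X]Z0 rmorph0.
pose G (z : C) := [/\ cdom phi (cinv phi z), holomorphic_near (T \o cinv phi) z,
    forall j k, holomorphic_near (m j k) z,
    cdom phi' (tau (cinv phi z)) /\ fdom e' (tau (cinv phi z)) &
    forall (c : 'cV[C]_2) p, spans (frame_sum e (cinv phi z) c) p ->
      spans (frame_sum e' (tau (cinv phi z)) (map_mx Num.conj (M (cinv phi z) *m c))) (F p)].
have G0 : \forall z \near base_coord u, G z.
  rewrite uE; have D := proj1 (chart_near _ aphi xphi) (chart_near_dom aphi xphi).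
  have K : \forall y \near x, hol_at y T /\ hol_mx y M.
    exact: nearS2 (hol_at_near hT) (hol_mx_near hM) (fun y a b => conj a b).
  have K' : \forall y \near x, cdom phi' (tau y) /\ fdom e' (tau y).
    exact: nearS2 (tau_near tauP (chart_near_dom aphi' xphi'))
      (tau_near tauP (frame_near2 Fe' xe')) (fun y a b => conj a b).
  have Q := nearS3 K K' ME (fun y a b c => conj a (conj b c)).
  apply: (nearS3 D (chart_near_image aphi xphi) (proj1 (chart_near _ aphi xphi) Q)).
  move=> z zd [_ zE] [[hTz hMz] [d Mz]]; split; [exact: zd| | |exact: d|exact: Mz].
    by have := hTz phi aphi zd; rewrite zE.
  by move=> j k; have := hMz j k phi aphi zd; rewrite zE.
pose A1 := interior [set v | G (base_coord v)].
have GA v (h : A1 v) : G (base_coord v) := interior_subset h.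
have mA v j k : A1 v -> holomorphic_near (m j k) (base_coord v).
  by move=> /GA[_ _ H _ _]; exact: H.
have TA v : A1 v -> holomorphic_near (T \o cinv phi) (base_coord v).
  by move=> /GA[_ H _ _ _]; exact: H.
have sN (A : set U) j : A `<=` A1 -> smooth_cfun A (N j).
  move=> AA; apply: smooth_cfun_add.
    by apply: smooth_cfun_hol => v /AA; exact: mA.
  apply: smooth_cfun_mul; last exact: smooth_fibre_coord.
  by apply: smooth_cfun_hol => v /AA; exact: mA.
have uA1 : A1 u := base_coord_near G0.
have G2 := smooth_cfun_near_neq0 (sN A1 i' (fun v h => h)) uA1 N0.
pose A := A1 `&` interior [set v | N i' v != 0].
have oA : open A by apply: openI; exact: open_interior.
have AA1 : A `<=` A1 by move=> v [].
have An0 v : A v -> N i' v != 0 by move=> [_ /interior_subset].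
pose Z v := Num.conj ((T \o cinv phi) (base_coord v)).
pose W v := Num.conj (N (rev_ord i') v / N i' v).
have sZ : smooth_cfun A Z.
  by apply: smooth_cfun_conj; apply: smooth_cfun_hol => v /AA1; exact: TA.
have sW : smooth_cfun A W.
  apply: smooth_cfun_conj; apply: smooth_cfun_mul; first exact: sN.
  by apply: smooth_cfun_inv => //; exact: sN.
pose f (k : 'I_4) (v : U) : R := if k == 0 then complex.Re (Z v : R[i])
  else if k == 1 then complex.Im (Z v : R[i])
  else if k == inord 2 then complex.Re (W v : R[i]) else complex.Im (W v : R[i]).
exists (fun v => \row_k f k v).
  exists A; first by split; [exact: oA|split].
  apply: smooth_row_Ck => //; exists f => // k; rewrite /f.
  case: (k == 0); first exact: (proj1 sZ).
  case: (k == 1); first exact: (proj2 sZ).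
  by case: (k == inord 2); [exact: (proj1 sW)|exact: (proj2 sW)].
have Cri (z : C) : (complex.Re (z : R[i]) +i* complex.Im (z : R[i]))%C = z :> C by case: z.
have : \forall v \near u, A v by apply: open_nbhs_nbhs; split => //; split.
apply: filterS => v Av [y p] [/= yphi ye yv sy].
have vy : cinv phi (base_coord v) = y.
  by have -> : base_coord v = cmap phi y; [rewrite yv|exact: chart_inv].
have [_ _ _ [d1 d2] Mv] := GA _ (AA1 _ Av); rewrite vy in d1 d2 Mv.
split; [exact: d1|exact: d2| |].
  rewrite !mxE /f /= -[LHS]conjCK -[RHS]Cri /=.
  by rewrite /Z /= vy /T /ctau conjCK.
rewrite !mxE /f.
have -> : (inord 2 == 0 :> 'I_4) = false by rewrite -val_eqE /= inordK.
have -> : (inord 3 == 0 :> 'I_4) = false by rewrite -val_eqE /= inordK.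
have -> : (inord 2 == 1 :> 'I_4) = false by rewrite -val_eqE /= inordK.
have -> : (inord 3 == 1 :> 'I_4) = false by rewrite -val_eqE /= inordK.
have -> : (inord 3 == inord 2 :> 'I_4) = false by rewrite -val_eqE /= !inordK.
rewrite eqxx Cri -frame_sum_coord.
rewrite -frame_sum_coord in sy; have := Mv _ _ sy.
have Nv := NE v y _ vy erefl.
set c := map_mx _ _; have cE j : c j 0 = Num.conj (N j v) by rewrite /c mxE Nv.
have c0 : c i' 0 != 0 by rewrite cE conjC_eq0; exact: An0.
rewrite (coord_colZ c0).
rewrite frame_sumZ => /(spans_scale (invr_neq0 c0)); rewrite scalerA mulVf// scale1r !cE.
by rewrite /W fmorph_div.
Qed.

End LiftSmooth.

Theorem lemma2p5 (R : realType) (X : riemann_surface (cplx R))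
    (Xcompact : compact [set: X]) (Xconnected : connected [set: X])
    (tau : X -> X) (tau_invol : antiholomorphic_involution tau)
    (L : line_bundle X) (q : tangent_root L) :
  exists tauhat :
      forall x, pspace (jet_bundle L x) -> pspace (jet_bundle L (tau x)),
    [/\ unique (canonical_lift q) tauhat,
        involutive (total_map tauhat),
        smooth_map (total_map tauhat)
      & forall S : projective_structure X,
          exists D : hol_connection (jet_bundle L),
            unique (corresponding_connection q S) D /\
            (real_structure tau S <-> preserves_connection tauhat D)].
Proof.
have [tauhat tauhatU] := exists_canonical_lift tau_invol q.
have [tauhatP _] := tauhatU; exists tauhat; split.
- exact: tauhatU.
- exact (canonical_lift_involutive tau_invol tauhatP).
- exact (lift_smooth tau_invol tauhatP).
move=> S; have [D [DU DE]] := exists_corresponding_connection q S.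
exists D; split; first exact: DU.
exact (real_iff_preserves tau_invol tauhatP DE).
Qed.
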